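(* For any finite group $N$, the following are equivalent: (1) For every finite Galois extension of fields $L/K$ and every Hopf--Galois structure $(H,\star)$ on $L/K$ of type $N$, the Hopf--Galois correspondence for $H$ is bijective. (2) The group $N$ is isomorphic to $C_2$ or to $C_2\times C_2$, or $N$ is cyclic of odd order and $q\nmid p-1$ for all prime divisors $p,q$ of $|N|$.
   Context: Let $L/K$ be a finite extension of fields. A Hopf--Galois structure on $L/K$ is a $K$-Hopf algebra $H$ together with an action $\star$ of $H$ on $L$ such that $L$ is an $H$-module algebra and the $K$-linear map $L\otimes_K H\to \mathrm{End}_K(L)$, $\ell\otimes h\mapsto (x\mapsto \ell(h\star x))$, is bijective. For each $K$-Hopf subalgebra $H'$ of $H$ one attaches the intermediate field $L^{H'}=\{x\in L: h'\star x=\varepsilon(h')x \text{ for all } h'\in H'\}$, where $\varepsilon\colon H\to K$ is the counit; the map $H'\mapsto L^{H'}$ from $K$-Hopf subalgebras of $H$ to intermediate fields of $L/K$ is called the Hopf--Galois correspondence for $H$ (it is always injective). When $L/K$ is Galois, the type of a Hopf--Galois structure $H$ is the isomorphism class of a finite group $N$ such that $L\otimes_K H\simeq L[N]$ as $L$-Hopf algebras (such $N$ is unique up to isomorphism); ''of type $N$'' means the type is the isomorphism class of $N$. $C_n$ denotes the cyclic group of order $n$. *)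

(* Defs.v *)
From HB Require Import structures.
From mathcomp Require Import all_boot all_order all_fingroup all_algebra.
From mathcomp Require Import all_solvable all_field.

Set Implicit Arguments.
Unset Strict Implicit.
Unset Printing Implicit Defensive.

Import GRing.Theory VectorInternalTheory.
Local Open Scope ring_scope.

(* U (x)_K V for finite-dimensional U and V, in coordinates: tens u v is the
   pure tensor, and tens_liftE, tensP1 give the universal property. *)
Definition tensor (K : fieldType) (U V : vectType K) : Type :=
  'M[K]_(dim U, dim V).

HB.instance Definition _ (K : fieldType) (U V : vectType K) :=
  Vector.copy (tensor U V) 'M[K]_(dim U, dim V).

Definition stdb (K : fieldType) (U : vectType K) (i : 'I_(dim U)) : U :=
  r2v (delta_mx 0 i).

Section Tensor.
Variables (K : fieldType) (U V : vectType K).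

Definition tens (u : U) (v : V) : tensor U V := (v2r u)^T *m v2r v.

Lemma stdb_sum (W : vectType K) (u : W) : u = \sum_i v2r u 0 i *: stdb i.
Proof.
apply: v2r_inj; rewrite linear_sum [LHS]row_sum_delta; apply: eq_bigr => i _.
by rewrite linearZ /= r2vK.
Qed.

Lemma tens_linearl v : linear (tens^~ v).
Proof. by move=> a u u'; rewrite /tens !linearP /= mulmxDl -scalemxAl. Qed.

Lemma tens_linearr u : linear (tens u).
Proof. by move=> a v v'; rewrite /tens !linearP. Qed.

HB.instance Definition _ u :=
  GRing.isLinear.Build K V (tensor U V) _ (tens u) (tens_linearr u).

Lemma tensDl u u' v : tens (u + u') v = tens u v + tens u' v.
Proof. by have := tens_linearl v 1 u u'; rewrite !scale1r. Qed.
Lemma tensDr u v v' : tens u (v + v') = tens u v + tens u v'.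
Proof. exact: linearD. Qed.
Lemma tens0l v : tens 0 v = 0.
Proof. by apply: (addrI (tens 0 v)); rewrite -tensDl !addr0. Qed.
Lemma tensZl a u v : tens (a *: u) v = a *: tens u v.
Proof. by have := tens_linearl v a u 0; rewrite tens0l !addr0. Qed.
Lemma tensZr a u v : tens u (a *: v) = a *: tens u v.
Proof. exact: linearZ. Qed.

Lemma tens_std i j : tens (stdb i) (stdb j) = delta_mx i j.
Proof. by rewrite /tens !r2vK trmx_delta mul_delta_mx. Qed.

Lemma tensor_sum (t : tensor U V) :
  t = \sum_i \sum_j t i j *: tens (stdb i) (stdb j).
Proof.
rewrite [LHS]matrix_sum_delta; apply: eq_bigr => i _; apply: eq_bigr => j _.
by rewrite tens_std.
Qed.

Lemma tensor_ind (P : tensor U V -> Prop) :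
    P 0 -> (forall x y, P x -> P y -> P (x + y)) ->
    (forall u v, P (tens u v)) -> forall t, P t.
Proof.
move=> P0 PD Pt t; rewrite [t]tensor_sum.
apply: (big_ind P) => // i _; apply: (big_ind P) => // j _.
by rewrite -tensZl.
Qed.

End Tensor.

Section Lift.
Variables (K : fieldType) (U V : vectType K).

Section Semi.
Variables (R : nzRingType) (nu : {rmorphism K -> R}) (W : lmodType R).
Variable f : U -> V -> W.

(* The lift of a map f that is bilinear over nu : K -> R; tens_lift below is the
   case nu = id. *)
Definition tens_slift (t : tensor U V) : W :=
  \sum_i \sum_j nu (t i j) *: f (stdb i) (stdb j).

Lemma tens_sliftD : {morph tens_slift : x y / x + y}.
Proof.
move=> x y; rewrite -big_split; apply: eq_bigr => i _.
by rewrite -big_split; apply: eq_bigr => j _; rewrite mxE rmorphD scalerDl.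
Qed.

Lemma tens_sliftZ a x : tens_slift (a *: x) = nu a *: tens_slift x.
Proof.
rewrite scaler_sumr; apply: eq_bigr => i _; rewrite scaler_sumr.
by apply: eq_bigr => j _; rewrite mxE rmorphM scalerA.
Qed.

Lemma tens_slift0 : tens_slift 0 = 0.
Proof. by rewrite -(scale0r 0) tens_sliftZ rmorph0 scale0r. Qed.

Hypothesis fl : forall v, linear_for (nu \; *:%R) (f^~ v).
Hypothesis fr : forall u, linear_for (nu \; *:%R) (f u).

Lemma tens_sliftE u v : tens_slift (tens u v) = f u v.
Proof.
pose fL v := HB.pack_for {linear U -> W | nu \; *:%R} (f^~ v)
  (GRing.isLinear.Build K U W _ (f^~ v) (fl v)).
pose fR u := HB.pack_for {linear V -> W | nu \; *:%R} (f u)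
  (GRing.isLinear.Build K V W _ (f u) (fr u)).
rewrite -[RHS]/(fL v u) {2}[u]stdb_sum linear_sum; apply: eq_bigr => i _.
rewrite linearZ_LR /= -[f _ v]/(fR (stdb i) v) {2}[v]stdb_sum linear_sum.
rewrite scaler_sumr; apply: eq_bigr => j _.
by rewrite linearZ_LR /= scalerA mxE big_ord1 mxE rmorphM.
Qed.

End Semi.

Section Lin.
Variables (W : lmodType K) (f : U -> V -> W).

Definition tens_lift (t : tensor U V) : W :=
  \sum_i \sum_j t i j *: f (stdb i) (stdb j).

Lemma tens_lift_linear : linear tens_lift.
Proof.
move=> a x y; rewrite -[tens_lift]/(tens_slift idfun f).
by rewrite tens_sliftD tens_sliftZ.
Qed.

HB.instance Definition _ :=
  GRing.isLinear.Build K (tensor U V) W _ tens_lift tens_lift_linear.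

Lemma tens_liftE (fl : forall v, linear (f^~ v)) (fr : forall u, linear (f u))
  u v : tens_lift (tens u v) = f u v.
Proof. exact: (@tens_sliftE _ idfun). Qed.
End Lin.
End Lift.

Lemma eq_tens_lift (K : fieldType) (U V : vectType K) (W : lmodType K)
  (f g : U -> V -> W) : f =2 g -> tens_lift f =1 tens_lift g.
Proof.
by move=> fg t; apply: eq_bigr => i _; apply: eq_bigr => j _; rewrite fg.
Qed.

Lemma tens_lift_funP (K : fieldType) (U V : vectType K) (W : lmodType K)
    (f g h : U -> V -> W) a :
  (forall u v, h u v = a *: f u v + g u v) ->
  forall t, tens_lift h t = a *: tens_lift f t + tens_lift g t.
Proof.
move=> hE t; rewrite /tens_lift scaler_sumr -big_split; apply: eq_bigr => i _.
rewrite scaler_sumr -big_split; apply: eq_bigr => j _.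
by rewrite hE scalerDr !scalerA [a * _]mulrC.
Qed.

Lemma tens_lift_comp (K : fieldType) (U V : vectType K) (W W' : lmodType K)
    (g : {linear W -> W'}) (f : U -> V -> W) t :
  g (tens_lift f t) = tens_lift (fun u v => g (f u v)) t.
Proof.
rewrite /tens_lift linear_sum; apply: eq_bigr => i _.
by rewrite linear_sum; apply: eq_bigr => j _; rewrite linearZ.
Qed.

Lemma tensP1 (K : fieldType) (U V : vectType K) (W : zmodType)
    (g h : tensor U V -> W) :
    {morph g : x y / x + y} -> {morph h : x y / x + y} ->
  (forall u v, g (tens u v) = h (tens u v)) -> g =1 h.
Proof.
move=> gD hD gh; apply: tensor_ind => //; last first.
  by move=> x y gx gy; rewrite gD hD gx gy.
have g0 : g 0 = 0 by apply: (addrI (g 0)); rewrite -gD !addr0.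
by rewrite g0; apply: (addrI (h 0)); rewrite -hD !addr0.
Qed.

Section TensorAlgebra.
Variables (K : fieldType) (A B : falgType K).
Implicit Types (t : tensor A B) (a : A) (b : B).

Definition tens_mul t t' : tensor A B :=
  tens_lift (fun a b => tens_lift (fun a' b' => tens (a * a') (b * b')) t') t.

Let mul_inner_l t' b : linear (fun a =>
  tens_lift (fun a' b' => tens (a * a') (b * b')) t' : tensor A B).
Proof.
move=> k x y; apply: tens_lift_funP => u v.
by rewrite mulrDl -scalerAl tensDl tensZl.
Qed.

Let mul_inner_r t' a : linear (fun b =>
  tens_lift (fun a' b' => tens (a * a') (b * b')) t' : tensor A B).
Proof.
move=> k x y; apply: tens_lift_funP => u v.
by rewrite mulrDl -scalerAl tensDr tensZr.
Qed.

Lemma tens_mulDl : left_distributive tens_mul +%R.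
Proof. by move=> x y z; rewrite /tens_mul linearD. Qed.
Lemma tens_mulZl k x y : tens_mul (k *: x) y = k *: tens_mul x y.
Proof. by rewrite /tens_mul linearZ. Qed.

Lemma tens_mul_linearr x : linear (tens_mul x).
Proof.
by move=> k y z; apply: tens_lift_funP => u v; rewrite linearP.
Qed.
HB.instance Definition _ x := GRing.isLinear.Build K (tensor A B) (tensor A B)
  _ (tens_mul x) (tens_mul_linearr x).

Lemma tens_mulDr : right_distributive tens_mul +%R.
Proof. by move=> x y z; rewrite linearD. Qed.
Lemma tens_mulZr k x y : tens_mul x (k *: y) = k *: tens_mul x y.
Proof. by rewrite linearZ. Qed.

Lemma tens_mulE a b a' b' :
  tens_mul (tens a b) (tens a' b') = tens (a * a') (b * b').
Proof.
rewrite /tens_mul tens_liftE // tens_liftE // => [v|u] k x y.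
  by rewrite mulrDr -scalerAr tensDl tensZl.
by rewrite mulrDr -scalerAr tensDr tensZr.
Qed.

Lemma tens_mulA : associative tens_mul.
Proof.
move=> x y z; move: x.
apply: tensP1 => [u v|u v|a b]; rewrite ?tens_mulDl //.
move: y; apply: tensP1 => [u v|u v|a' b']; rewrite ?(tens_mulDl, tens_mulDr) //.
move: z; apply: tensP1 => [u v|u v|a'' b'']; rewrite ?(tens_mulDl, tens_mulDr) //.
by rewrite !tens_mulE !mulrA.
Qed.

Lemma tens_mul1l : left_id (tens 1 1) tens_mul.
Proof.
apply: tensP1 => // [u v|a b]; first by rewrite tens_mulDr.
by rewrite tens_mulE !mul1r.
Qed.

Lemma tens_mul1r : right_id (tens 1 1) tens_mul.
Proof.
apply: tensP1 => // [u v|a b]; first by rewrite tens_mulDl.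
by rewrite tens_mulE !mulr1.
Qed.

Lemma tens1_neq0 : tens 1 1 != 0 :> tensor A B.
Proof.
have /matrix0Pn[i0 [i ai]] : v2r (1 : A) != 0.
  by rewrite -(inj_eq (@r2v_inj _ A)) v2rK linear0 oner_neq0.
have /matrix0Pn[j0 [j bj]] : v2r (1 : B) != 0.
  by rewrite -(inj_eq (@r2v_inj _ B)) v2rK linear0 oner_neq0.
rewrite (ord1 i0) in ai; rewrite (ord1 j0) in bj.
by apply/matrix0Pn; exists i, j; rewrite mxE big_ord1 mxE mulf_neq0.
Qed.

HB.instance Definition _ := GRing.Zmodule_isNzRing.Build (tensor A B)
  tens_mulA tens_mul1l tens_mul1r tens_mulDl tens_mulDr tens1_neq0.
HB.instance Definition _ := GRing.Lmodule_isLalgebra.Build K (tensor A B)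
  (fun k x y => esym (tens_mulZl k x y)).
HB.instance Definition _ := GRing.Lalgebra_isAlgebra.Build K (tensor A B)
  (fun k x y => esym (tens_mulZr k x y)).
HB.instance Definition _ := Algebra_isFalgebra.Build K (tensor A B).

Lemma tensM a b a' b' : tens a b * tens a' b' = tens (a * a') (b * b').
Proof. exact: tens_mulE. Qed.
End TensorAlgebra.

Definition tens_map (K : fieldType) (U V U' V' : vectType K)
    (f : U -> U') (g : V -> V') : tensor U V -> tensor U' V' :=
  tens_lift (fun u v => tens (f u) (g v)).

HB.instance Definition _ (K : fieldType) (U V U' V' : vectType K)
    (f : U -> U') (g : V -> V') :=
  GRing.Linear.copy (tens_map f g) (tens_lift (fun u v => tens (f u) (g v))).

Definition tens_assoc (K : fieldType) (U V W : vectType K) :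
    tensor (tensor U V) W -> tensor U (tensor V W) :=
  tens_lift (fun t w => tens_lift (fun u v => tens u (tens v w)) t).

HB.instance Definition _ (K : fieldType) (U V W : vectType K) :=
  GRing.Linear.copy (@tens_assoc K U V W)
    (tens_lift (fun t w => tens_lift (fun u v => tens u (tens v w)) t)).

Lemma tens_mapE (F : fieldType) (U V U' V' : vectType F)
    (f : {linear U -> U'}) (g : {linear V -> V'}) u v :
  tens_map f g (tens u v) = tens (f u) (g v).
Proof.
rewrite /tens_map tens_liftE // => [y|x] k a b.
  by rewrite linearP tensDl tensZl.
by rewrite !linearP.
Qed.

Lemma tens_assoc_lift (F : fieldType) (U V W : vectType F)
    (t : tensor U V) (w : W) :
  tens_assoc (tens t w) = tens_lift (fun u v => tens u (tens v w)) t.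
Proof.
rewrite /tens_assoc tens_liftE // => [y|x] k a b; first by rewrite linearP.
by apply: tens_lift_funP => u v; rewrite !linearP.
Qed.

Lemma tens_assocE (F : fieldType) (U V W : vectType F) (u : U) (v : V) (w : W) :
  tens_assoc (tens (tens u v) w) = tens u (tens v w).
Proof.
rewrite tens_assoc_lift tens_liftE // => [y|x] k a b.
  by rewrite tensDl tensZl.
by rewrite tensDl tensZl linearP.
Qed.

(* A falgType is finite-dimensional.  This costs no generality here: the
   bijection of L (x)_K H with End_K(L) forces \dim_K H = [L : K]. *)
HB.mixin Record Falgebra_isHopf (K : fieldType) H of Falgebra K H := {
  comul : {lrmorphism H -> tensor H H};
  counit : {lrmorphism H -> K^o};
  antipode : {linear H -> H};
  comulA : forall x : H, tens_assoc (tens_map comul idfun (comul x))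
                       = tens_map idfun comul (comul x);
  counitl : forall x : H, tens_lift (fun a b => (counit a : K) *: b) (comul x) = x;
  counitr : forall x : H, tens_lift (fun a b => (counit b : K) *: a) (comul x) = x;
  antipodel : forall x : H,
    tens_lift (fun a b => antipode a * b) (comul x) = (counit x : K)%:A;
  antipoder : forall x : H,
    tens_lift (fun a b => a * antipode b) (comul x) = (counit x : K)%:A
}.

#[short(type="hopfType")]
HB.structure Definition Hopf (K : fieldType) :=
  {H of Falgebra_isHopf K H & Falgebra K H}.

Section HopfIso.
Variables (K : fieldType) (A B : hopfType K).

(* Bialgebra morphisms automatically commute with antipodes; the last
   clause is included for definiteness. *)
Definition hopf_morphism (f : A -> B) : Prop :=
  [/\ forall x, comul (f x) = tens_map f f (comul x),
      forall x, counit (f x) = counit x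
    & forall x, antipode (f x) = f (antipode x)].

Definition hopf_isomorphic : Prop :=
  exists2 f : {lrmorphism A -> B}, bijective f & hopf_morphism f.
End HopfIso.

Section GroupAlgebra.
Variables (F : fieldType) (N : finGroupType).

Definition group_algebra : Type := {ffun N -> F^o}.
HB.instance Definition _ := Vector.copy group_algebra {ffun N -> F^o}.

Definition gelt (g : N) : group_algebra := [ffun x => (x == g)%:R].

Section GLift.
Variables (W : lmodType F) (f : N -> W).
Definition galg_lift (x : group_algebra) : W := \sum_g x g *: f g.

Lemma galg_lift_linear : linear galg_lift.
Proof.
move=> a x y; rewrite /galg_lift scaler_sumr -big_split.
by apply: eq_bigr => g _; rewrite !ffunE scalerDl scalerA.
Qed.
HB.instance Definition _ :=
  GRing.isLinear.Build F group_algebra W _ galg_lift galg_lift_linear.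

Lemma galg_liftE g : galg_lift (gelt g) = f g.
Proof.
rewrite /galg_lift (bigD1 g) //= big1 => [|h /negPf hg].
  by rewrite ffunE eqxx scale1r addr0.
by rewrite ffunE hg scale0r.
Qed.
End GLift.

Lemma galg_sum (x : group_algebra) : x = \sum_g x g *: gelt g.
Proof.
apply/ffunP => h; rewrite sum_ffunE (bigD1 h) //= big1 => [|g /negPf gh].
  by rewrite addr0 !ffunE eqxx /= [RHS]mulr1.
by rewrite !ffunE eq_sym gh /= [LHS]mulr0.
Qed.

Lemma galgP (W : lmodType F) (f g : {linear group_algebra -> W}) :
  (forall x, f (gelt x) = g (gelt x)) -> f =1 g.
Proof.
move=> fg x; rewrite [x]galg_sum !linear_sum; apply: eq_bigr => h _.
by rewrite !linearZ fg.
Qed.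

(* The convolution product, i.e. the bilinear extension of the group law. *)
Definition galg_mul (x y : group_algebra) : group_algebra :=
  galg_lift (fun g => galg_lift (fun h => gelt (g * h)%g) y) x.

Lemma galg_mulDl : left_distributive galg_mul +%R.
Proof. by move=> x y z; rewrite /galg_mul linearD. Qed.
Lemma galg_mulZl k x y : galg_mul (k *: x) y = k *: galg_mul x y.
Proof. by rewrite /galg_mul linearZ. Qed.
Lemma galg_mul_linearr x : linear (galg_mul x).
Proof.
move=> k y z; rewrite /galg_mul {1 3 5}/galg_lift scaler_sumr -big_split.
apply: eq_bigr => g _.
by rewrite linearP scalerDr !scalerA [k * _]mulrC.
Qed.
HB.instance Definition _ x := GRing.isLinear.Build F group_algebra
  group_algebra _ (galg_mul x) (galg_mul_linearr x).
Lemma galg_mulDr : right_distributive galg_mul +%R.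
Proof. by move=> x y z; rewrite linearD. Qed.
Lemma galg_mulZr k x y : galg_mul x (k *: y) = k *: galg_mul x y.
Proof. by rewrite linearZ. Qed.
Lemma galg_mulE g h : galg_mul (gelt g) (gelt h) = gelt (g * h)%g.
Proof. by rewrite /galg_mul !galg_liftE. Qed.

Let ind (P : group_algebra -> Prop) :
    (forall a x y, P x -> P y -> P (a *: x + y)) -> P 0 ->
  (forall g, P (gelt g)) -> forall x, P x.
Proof.
move=> PD P0 Pg x; rewrite [x]galg_sum.
by elim/big_rec: _ => // g y _; apply: PD.
Qed.

Let mul0l x : galg_mul 0 x = 0.
Proof. by rewrite /galg_mul linear0. Qed.

Let mulPl a x y z : galg_mul (a *: x + y) z = a *: galg_mul x z + galg_mul y z.
Proof. by rewrite galg_mulDl galg_mulZl. Qed.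

Let mulPr a x y z : galg_mul z (a *: x + y) = a *: galg_mul z x + galg_mul z y.
Proof. exact: linearP. Qed.

Let mul0r x : galg_mul x 0 = 0.
Proof. exact: linear0. Qed.

Lemma galg_mulA : associative galg_mul.
Proof.
move=> x y z; move: x; apply: ind => [a u v IHu IHv||g].
- by rewrite !mulPl IHu IHv.
- by rewrite !mul0l.
move: y; apply: ind => [a u v IHu IHv||h].
- by rewrite !(mulPl, mulPr) IHu IHv.
- by rewrite !(mul0l, mul0r).
move: z; apply: ind => [a u v IHu IHv||k].
- by rewrite !mulPr IHu IHv.
- by rewrite !mul0r.
by rewrite !galg_mulE mulgA.
Qed.

Lemma galg_mul1l : left_id (gelt 1%g) galg_mul.
Proof.
apply: ind => [a u v IHu IHv||g]; first by rewrite mulPr IHu IHv.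
  exact: mul0r.
by rewrite galg_mulE mul1g.
Qed.
Lemma galg_mul1r : right_id (gelt 1%g) galg_mul.
Proof.
apply: ind => [a u v IHu IHv||g]; first by rewrite mulPl IHu IHv.
  exact: mul0l.
by rewrite galg_mulE mulg1.
Qed.
Lemma gelt1_neq0 : gelt 1%g != 0.
Proof.
by apply/eqP => /ffunP/(_ 1%g)/eqP; rewrite !ffunE eqxx oner_eq0.
Qed.

HB.instance Definition _ := GRing.Zmodule_isNzRing.Build group_algebra
  galg_mulA galg_mul1l galg_mul1r galg_mulDl galg_mulDr gelt1_neq0.
HB.instance Definition _ := GRing.Lmodule_isLalgebra.Build F group_algebra
  (fun k x y => esym (galg_mulZl k x y)).
HB.instance Definition _ := GRing.Lalgebra_isAlgebra.Build F group_algebra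
  (fun k x y => esym (galg_mulZr k x y)).
HB.instance Definition _ := Algebra_isFalgebra.Build F group_algebra.

Lemma geltM g h : gelt g * gelt h = gelt (g * h)%g.
Proof. exact: galg_mulE. Qed.
Lemma gelt1 : gelt 1%g = 1. Proof. by []. Qed.

Definition galg_comul : group_algebra -> tensor group_algebra group_algebra :=
  galg_lift (fun g => tens (gelt g) (gelt g)).
HB.instance Definition _ := GRing.Linear.copy galg_comul
  (galg_lift (fun g => tens (gelt g) (gelt g))).

Definition galg_counit : group_algebra -> F^o := galg_lift (fun=> 1 : F^o).
HB.instance Definition _ :=
  GRing.Linear.copy galg_counit (galg_lift (fun=> 1 : F^o)).

Definition galg_antipode : group_algebra -> group_algebra :=
  galg_lift (fun g => gelt g^-1%g).
HB.instance Definition _ :=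
  GRing.Linear.copy galg_antipode (galg_lift (fun g => gelt g^-1%g)).

Lemma galg_comulE g : galg_comul (gelt g) = tens (gelt g) (gelt g).
Proof. exact: galg_liftE. Qed.
Lemma galg_counitE g : galg_counit (gelt g) = 1.
Proof. exact: galg_liftE. Qed.
Lemma galg_antipodeE g : galg_antipode (gelt g) = gelt g^-1%g.
Proof. exact: galg_liftE. Qed.

Let monoidP (A : algType F) (f : {linear group_algebra -> A}) :
    f (gelt 1%g) = 1 ->
    (forall g h, f (gelt (g * h)%g) = f (gelt g) * f (gelt h)) ->
  monoid_morphism f.
Proof.
move=> f1 fM; split=> // x y; move: x; apply: ind => [a u v IHu IHv||g].
- by rewrite mulrDl -scalerAl !linearP IHu IHv mulrDl scalerAl.
- by rewrite GRing.mul0r linear0 GRing.mul0r.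
move: y; apply: ind => [a u v IHu IHv||h].
- by rewrite mulrDr -scalerAr !linearP IHu IHv mulrDr scalerAr.
- by rewrite mulr0 linear0 mulr0.
by rewrite geltM fM.
Qed.

Lemma galg_comul_monoid : monoid_morphism galg_comul.
Proof.
by apply: monoidP => [|g h] /=; rewrite !galg_comulE // tensM geltM.
Qed.
HB.instance Definition _ := GRing.isMonoidMorphism.Build group_algebra
  (tensor group_algebra group_algebra) galg_comul galg_comul_monoid.

Lemma galg_counit_monoid : monoid_morphism galg_counit.
Proof. by apply: monoidP => [|g h] /=; rewrite !galg_counitE ?mulr1. Qed.
HB.instance Definition _ := GRing.isMonoidMorphism.Build group_algebra F^o
  galg_counit galg_counit_monoid.

Lemma galg_comulA x :
  tens_assoc (tens_map galg_comul idfun (galg_comul x))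
  = tens_map idfun galg_comul (galg_comul x).
Proof.
apply: (galgP (f := tens_assoc (W := _) \o tens_map _ _ \o galg_comul)
              (g := tens_map _ _ \o galg_comul)) => g /=.
rewrite galg_comulE /tens_map /tens_assoc tens_liftE; last 2 first.
- by move=> v a u u'; rewrite linearP tensDl tensZl.
- by move=> u a v v'; rewrite tensDr tensZr.
rewrite tens_liftE; last 2 first.
- by move=> v a u u'; rewrite linearP.
- move=> u a v v'; apply: tens_lift_funP => x0 y0.
  by rewrite tensDr tensZr tensDr tensZr.
rewrite galg_comulE tens_liftE; last 2 first.
- by move=> v a u u'; rewrite tensDl tensZl.
- by move=> u a v v'; rewrite tensDl tensZl tensDr tensZr.
rewrite tens_liftE ?galg_comulE //.
- by move=> v a u u'; rewrite tensDl tensZl.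
- by move=> u a v v'; rewrite linearP tensDr tensZr.
Qed.

Lemma galg_counitl x :
  tens_lift (fun a b => (galg_counit a : F) *: b) (galg_comul x) = x.
Proof.
apply: (galgP (f := tens_lift _ \o galg_comul) (g := idfun)) => g /=.
rewrite galg_comulE tens_liftE ?galg_counitE ?scale1r // => [v|u] a y z.
  by rewrite linearP scalerDl scalerA.
by rewrite scalerDr !scalerA mulrC.
Qed.

Lemma galg_counitr x :
  tens_lift (fun a b => (galg_counit b : F) *: a) (galg_comul x) = x.
Proof.
apply: (galgP (f := tens_lift _ \o galg_comul) (g := idfun)) => g /=.
rewrite galg_comulE tens_liftE ?galg_counitE ?scale1r // => [v|u] a y z.
  by rewrite scalerDr !scalerA mulrC.
by rewrite linearP scalerDl scalerA.
Qed.

Lemma galg_antipodel x :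
  tens_lift (fun a b => galg_antipode a * b) (galg_comul x)
  = (galg_counit x : F)%:A.
Proof.
move: x; apply: ind => [k u v IHu IHv||g].
- by rewrite !linearP /= IHu IHv scalerDl scalerA.
- by rewrite !linear0 scale0r.
rewrite galg_comulE tens_liftE => [||u a y z].
- by rewrite galg_antipodeE galg_counitE geltM mulVg scale1r.
- by move=> v a y z; rewrite linearP mulrDl scalerAl.
- by rewrite mulrDr scalerAr.
Qed.

Lemma galg_antipoder x :
  tens_lift (fun a b => a * galg_antipode b) (galg_comul x)
  = (galg_counit x : F)%:A.
Proof.
move: x; apply: ind => [k u v IHu IHv||g].
- by rewrite !linearP /= IHu IHv scalerDl scalerA.
- by rewrite !linear0 scale0r.
rewrite galg_comulE tens_liftE => [||u a y z].
- by rewrite galg_antipodeE galg_counitE geltM mulgV scale1r.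
- by move=> v a y z; rewrite mulrDl scalerAl.
- by rewrite linearP mulrDr scalerAr.
Qed.

HB.instance Definition _ := Falgebra_isHopf.Build F group_algebra
  galg_comulA galg_counitl galg_counitr galg_antipodel galg_antipoder.
End GroupAlgebra.

(* L (x)_K H as an L-algebra: it has the same underlying ring as tensor L H,
   but scalars in L. *)
Section ScalarExt.
Variables (K : fieldType) (L : fieldExtType K).

Section Algebra.
Variable H : falgType K.

Definition scalar_ext : Type := tensor L H.
HB.instance Definition _ := GRing.NzRing.copy scalar_ext (tensor L H).

Definition sext_scale (l : L) (t : scalar_ext) : scalar_ext := tens l 1 * t.

Lemma sext_scaleA a b t :
  sext_scale a (sext_scale b t) = sext_scale (a * b) t.
Proof. by rewrite /sext_scale mulrA tensM mulr1. Qed.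
Lemma sext_scale1 : left_id 1 sext_scale.
Proof. exact: mul1r. Qed.
Lemma sext_scaleDr : right_distributive sext_scale +%R.
Proof. by move=> a x y; apply: mulrDr. Qed.
Lemma sext_scaleDl t : {morph sext_scale^~ t : a b / a + b}.
Proof. by move=> a b; rewrite /sext_scale tensDl mulrDl. Qed.

HB.instance Definition _ := GRing.Zmodule_isLmodule.Build L scalar_ext
  sext_scaleA sext_scale1 sext_scaleDr sext_scaleDl.

Lemma sext_scaleAl (a : L) (x y : scalar_ext) : a *: (x * y) = (a *: x) * y.
Proof. exact: mulrA. Qed.
HB.instance Definition _ := GRing.Lmodule_isLalgebra.Build L scalar_ext
  sext_scaleAl.

Lemma sext_comm (a : L) (x : scalar_ext) : tens a 1 * x = x * tens a 1.
Proof.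
move: x; apply: tensP1 => [u v|u v|b h]; first exact: mulrDr.
  exact: mulrDl.
by rewrite [LHS]tensM [RHS]tensM mulrC mul1r mulr1.
Qed.

Lemma sext_scaleAr (a : L) (x y : scalar_ext) : a *: (x * y) = x * (a *: y).
Proof. by rewrite [LHS]mulrA sext_comm -mulrA. Qed.
HB.instance Definition _ := GRing.Lalgebra_isAlgebra.Build L scalar_ext
  sext_scaleAr.

Lemma sext_scaleE (a b : L) (h : H) :
  a *: (tens b h : scalar_ext) = tens (a * b) h.
Proof. by rewrite [LHS]tensM mul1r. Qed.

Definition sext_coords (t : scalar_ext) : 'rV[L]_(dim H) :=
  \row_j r2v (col j (t : 'M__))^T.

Lemma sext_coordsD : {morph sext_coords : x y / x + y}.
Proof. by move=> x y; apply/rowP => j; rewrite !mxE !linearD. Qed.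

Lemma sext_coordsE a h j : sext_coords (tens a h) 0 j = v2r h 0 j *: a.
Proof.
rewrite mxE; apply: v2r_inj; rewrite r2vK linearZ /=.
by apply/rowP => i; rewrite !mxE big_ord1 !mxE mulrC.
Qed.

Lemma sext_coords_linear : linear sext_coords.
Proof.
move=> a x y; rewrite sext_coordsD; congr (_ + _).
move: x; apply: tensP1 => [u v|u v|b h].
- by rewrite [in LHS]scalerDr sext_coordsD.
- by rewrite sext_coordsD scalerDr.
apply/rowP => j; rewrite sext_scaleE [RHS]mxE !sext_coordsE.
by rewrite scalerAr.
Qed.

Lemma sext_coords_bij : bijective sext_coords.
Proof.
pose inv (u : 'rV[L]_(dim H)) : scalar_ext :=
  \matrix_(i, j) v2r (u 0 j) 0 i : 'M[K]_(dim L, dim H).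
exists inv.
  move=> t; apply/matrixP => i j; rewrite mxE [sext_coords _ _ _]mxE r2vK.
  by rewrite !mxE.
move=> u; apply/rowP => j; rewrite mxE.
apply: v2r_inj; rewrite r2vK; apply/rowP => i.
by rewrite !mxE.
Qed.

HB.instance Definition _ := Lmodule_hasFinDim.Build L scalar_ext
  (exist2 _ _ sext_coords sext_coords_linear sext_coords_bij).
HB.instance Definition _ := Algebra_isFalgebra.Build L scalar_ext.

Definition sext_in (h : H) : scalar_ext := tens 1 h.

Lemma sext_inE a h : tens a h = a *: sext_in h :> scalar_ext.
Proof. by rewrite sext_scaleE mulr1. Qed.
Lemma sext_inD : {morph sext_in : x y / x + y}.
Proof. by move=> x y; apply: tensDr. Qed.
Lemma sext_inZ k h : sext_in (k *: h) = k%:A *: sext_in h.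
Proof. by rewrite -sext_inE [LHS]tensZr -tensZl. Qed.
Lemma sext_inM x y : sext_in (x * y) = sext_in x * sext_in y.
Proof. by rewrite [RHS]tensM mul1r. Qed.

Section Lift.
Variables (W : lmodType L) (g : H -> W).

(* l (x) h |-> l *: g h *)
Definition sext_lift (t : scalar_ext) : W :=
  tens_slift (in_alg L) (fun (l : L) h => l *: g h) t.

Lemma sext_liftD : {morph sext_lift : x y / x + y}.
Proof. exact: tens_sliftD. Qed.

Hypothesis gl : linear_for (in_alg L \; *:%R) g.

Lemma sext_liftE0 l h : sext_lift (tens l h) = l *: g h.
Proof.
rewrite /sext_lift tens_sliftE // => [v|u] a x y /=.
  by rewrite scalerDl scalerA mulr_algl.
by rewrite gl /= scalerDr !scalerA mulrC.
Qed.

Lemma sext_lift_linear : linear sext_lift.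
Proof.
move=> a x y; rewrite sext_liftD; congr (_ + _).
move: x; apply: tensP1 => [u v|u v|b h].
- by rewrite [in LHS]scalerDr sext_liftD.
- by rewrite sext_liftD scalerDr.
by rewrite sext_scaleE !sext_liftE0 scalerA.
Qed.
End Lift.

Lemma sextP (W : lmodType L) (f g : {linear scalar_ext -> W}) :
  (forall h, f (sext_in h) = g (sext_in h)) -> f =1 g.
Proof.
move=> fg; apply: tensP1 => [u v|u v|b h]; [exact: linearD|exact: linearD|].
by rewrite sext_inE !linearZ fg.
Qed.

(* The canonical map H (x)_K H -> (L (x)_K H) (x)_L (L (x)_K H). *)
Definition sext_in2 : tensor H H -> tensor scalar_ext scalar_ext :=
  tens_slift (in_alg L) (fun a b => tens (sext_in a) (sext_in b)).

Lemma sext_in2D : {morph sext_in2 : x y / x + y}.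
Proof. exact: tens_sliftD. Qed.
Lemma sext_in2Z k x : sext_in2 (k *: x) = k%:A *: sext_in2 x.
Proof. exact: tens_sliftZ. Qed.
Lemma sext_in2E a b : sext_in2 (tens a b) = tens (sext_in a) (sext_in b).
Proof.
rewrite /sext_in2 tens_sliftE // => [v|u] k x y /=.
  by rewrite sext_inD sext_inZ tensDl tensZl.
by rewrite sext_inD sext_inZ tensDr tensZr.
Qed.
Lemma sext_in2M x y : sext_in2 (x * y) = sext_in2 x * sext_in2 y.
Proof.
move: x; apply: tensP1 => [u v|u v|a b].
- by rewrite mulrDl sext_in2D.
- by rewrite sext_in2D mulrDl.
move: y; apply: tensP1 => [u v|u v|a' b'].
- by rewrite mulrDr sext_in2D.
- by rewrite sext_in2D mulrDr.
by rewrite tensM !sext_in2E tensM -!sext_inM.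
Qed.

End Algebra.

Section HopfStr.
Variable H : hopfType K.
Notation HL := (scalar_ext H).

Definition sext_comul : HL -> tensor HL HL :=
  sext_lift (fun h => sext_in2 (comul h)).
Definition sext_counit : HL -> L^o :=
  sext_lift (fun h => (counit h : K)%:A : L^o).
Definition sext_antipode : HL -> HL :=
  sext_lift (fun h => sext_in (antipode h)).

Let comul_lin :
  linear_for (in_alg L \; *:%R) (fun h : H => sext_in2 (comul h)).
Proof. by move=> k x y /=; rewrite linearP sext_in2D sext_in2Z. Qed.
Let counit_lin :
  linear_for (in_alg L \; *:%R) (fun h : H => (counit h : K)%:A : L^o).
Proof. by move=> k x y /=; rewrite linearP scalerDl [X in _ = X + _]mulr_algl scalerA. Qed.
Let antipode_lin :
  linear_for (in_alg L \; *:%R) (fun h : H => sext_in (antipode h)).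
Proof. by move=> k x y /=; rewrite linearP sext_inD sext_inZ. Qed.

HB.instance Definition _ := GRing.isLinear.Build L HL (tensor HL HL) _
  sext_comul (sext_lift_linear comul_lin).
HB.instance Definition _ := GRing.isLinear.Build L HL L^o _
  sext_counit (sext_lift_linear counit_lin).
HB.instance Definition _ := GRing.isLinear.Build L HL HL _
  sext_antipode (sext_lift_linear antipode_lin).

Lemma sext_comulE h : sext_comul (sext_in h) = sext_in2 (comul h).
Proof. by rewrite [LHS](sext_liftE0 comul_lin) scale1r. Qed.
Lemma sext_counitE h : sext_counit (sext_in h) = (counit h : K)%:A.
Proof. by rewrite [LHS](sext_liftE0 counit_lin) scale1r. Qed.
Lemma sext_antipodeE h : sext_antipode (sext_in h) = sext_in (antipode h).
Proof. by rewrite [LHS](sext_liftE0 antipode_lin) scale1r. Qed.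

Let monoidP (A : algType L) (f : {linear HL -> A}) :
    f (sext_in 1) = 1 ->
    (forall x y, f (sext_in (x * y)) = f (sext_in x) * f (sext_in y)) ->
  monoid_morphism f.
Proof.
move=> f1 fM; split=> // x y; move: x; apply: tensP1 => [u v|u v|a h].
- by rewrite mulrDl linearD.
- by rewrite linearD mulrDl.
move: y; apply: tensP1 => [u v|u v|b k].
- by rewrite mulrDr linearD.
- by rewrite linearD mulrDr.
rewrite !sext_inE -scalerAl -scalerAr -sext_inM !linearZ fM.
by rewrite /= -scalerAl -scalerAr.
Qed.

Lemma sext_comul_monoid : monoid_morphism sext_comul.
Proof.
apply: monoidP => [|x y] /=.
  by rewrite sext_comulE rmorph1 sext_in2E.
by rewrite !sext_comulE rmorphM sext_in2M.
Qed.
HB.instance Definition _ := GRing.isMonoidMorphism.Build HL (tensor HL HL)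
  sext_comul sext_comul_monoid.

Lemma sext_counit_monoid : monoid_morphism sext_counit.
Proof.
apply: monoidP => [|x y] /=.
  by rewrite sext_counitE rmorph1 scale1r.
by rewrite !sext_counitE rmorphM; exact: (rmorphM (in_alg L)).
Qed.
HB.instance Definition _ := GRing.isMonoidMorphism.Build HL L^o
  sext_counit sext_counit_monoid.

Definition sext_in3 :
    tensor H (tensor H H) -> tensor HL (tensor HL HL) :=
  tens_slift (in_alg L) (fun a t => tens (sext_in a) (sext_in2 t)).

Let in3D : {morph sext_in3 : x y / x + y}.
Proof. exact: tens_sliftD. Qed.

Let in3E a t : sext_in3 (tens a t) = tens (sext_in a) (sext_in2 t).
Proof.
rewrite /sext_in3 tens_sliftE // => [v|u] k x y /=.
  by rewrite sext_inD sext_inZ tensDl tensZl.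
by rewrite sext_in2D sext_in2Z tensDr tensZr.
Qed.

Lemma sext_comulA x :
  tens_assoc (tens_map sext_comul idfun (sext_comul x))
  = tens_map idfun sext_comul (sext_comul x).
Proof.
apply: (sextP (f := @tens_assoc _ _ _ _ \o tens_map _ _ \o sext_comul)
              (g := tens_map _ _ \o sext_comul)) => h /=.
rewrite sext_comulE.
have -> : forall t, tens_map idfun sext_comul (sext_in2 t)
                    = sext_in3 (tens_map idfun comul t).
  apply: tensP1 => [u v|u v|a b]; rewrite ?sext_in2D ?linearD ?in3D //.
  by rewrite sext_in2E !tens_mapE /= in3E sext_comulE.
rewrite -comulA; move: (comul h).
apply: tensP1 => [u v|u v|a b].
- by rewrite sext_in2D !linearD.
- by rewrite !linearD in3D.
rewrite sext_in2E !tens_mapE /= sext_comulE; move: (comul a).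
apply: tensP1 => [u v|u v|c d].
- by rewrite sext_in2D tensDl linearD.
- by rewrite tensDl linearD in3D.
by rewrite sext_in2E !tens_assocE in3E sext_in2E.
Qed.

Let sliftP (f : HL -> HL -> HL) (f0 : H -> H -> H) t
    (f_l : forall v, linear (f^~ v)) (f_r : forall u, linear (f u))
    (f0_l : forall v, linear (f0^~ v)) (f0_r : forall u, linear (f0 u)) :
  (forall a b, f (sext_in a) (sext_in b) = sext_in (f0 a b)) ->
  tens_lift f (sext_in2 t) = sext_in (tens_lift f0 t).
Proof.
move=> ff0; move: t; apply: tensP1 => [u v|u v|a b].
- by rewrite sext_in2D linearD.
- by rewrite linearD sext_inD.
by rewrite sext_in2E !tens_liftE.
Qed.

Lemma sext_counitl x :
  tens_lift (fun a b => (sext_counit a : L) *: b) (sext_comul x) = x.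
Proof.
apply: (sextP (f := tens_lift _ \o sext_comul) (g := idfun)) => h /=.
rewrite sext_comulE (sliftP (f0 := fun a b => (counit a : K) *: b)) ?counitl //.
- by move=> v k a b; rewrite linearP scalerDl scalerA.
- by move=> u k a b; rewrite scalerDr !scalerA mulrC.
- by move=> v k a b; rewrite linearP scalerDl scalerA.
- by move=> u k a b; rewrite scalerDr !scalerA mulrC.
by move=> a b; rewrite sext_counitE sext_inZ.
Qed.

Lemma sext_counitr x :
  tens_lift (fun a b => (sext_counit b : L) *: a) (sext_comul x) = x.
Proof.
apply: (sextP (f := tens_lift _ \o sext_comul) (g := idfun)) => h /=.
rewrite sext_comulE (sliftP (f0 := fun a b => (counit b : K) *: a)) ?counitr //.
- by move=> u k a b; rewrite scalerDr !scalerA mulrC.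
- by move=> v k a b; rewrite linearP scalerDl scalerA.
- by move=> u k a b; rewrite scalerDr !scalerA mulrC.
- by move=> v k a b; rewrite linearP scalerDl scalerA.
by move=> a b; rewrite sext_counitE sext_inZ.
Qed.

Let sextP2 (g : HL -> HL) : linear g ->
  (forall h, g (sext_in h) = (sext_counit (sext_in h) : L)%:A) ->
  forall x, g x = (sext_counit x : L)%:A.
Proof.
move=> gl gE; apply: tensP1 => [u v|u v|b h].
- by have := gl 1 u v; rewrite !scale1r.
- by rewrite linearD scalerDl.
have g0 : g 0 = 0.
  by apply: (addrI (g 0)); have := gl 1 0 0; rewrite !scale1r !addr0.
rewrite sext_inE -[_ *: _]addr0 gl gE g0 !addr0 scalerA.
by rewrite [sext_counit (_ *: _)]linearZ.
Qed.

Lemma sext_antipodel x :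
  tens_lift (fun a b => sext_antipode a * b) (sext_comul x)
  = (sext_counit x : L)%:A.
Proof.
move: x; apply: sextP2 => [k u v|h]; first by rewrite !linearP.
rewrite sext_comulE (sliftP (f0 := fun a b => antipode a * b)) ?antipodel.
- by rewrite sext_inZ sext_counitE.
- by move=> v k a b; rewrite linearP mulrDl scalerAl.
- by move=> u k a b; rewrite mulrDr scalerAr.
- by move=> v k a b; rewrite linearP mulrDl scalerAl.
- by move=> u k a b; rewrite mulrDr scalerAr.
by move=> a b; rewrite sext_antipodeE sext_inM.
Qed.

Lemma sext_antipoder x :
  tens_lift (fun a b => a * sext_antipode b) (sext_comul x)
  = (sext_counit x : L)%:A.
Proof.
move: x; apply: sextP2 => [k u v|h]; first by rewrite !linearP.
rewrite sext_comulE (sliftP (f0 := fun a b => a * antipode b)) ?antipoder.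
- by rewrite sext_inZ sext_counitE.
- by move=> v k a b; rewrite mulrDl scalerAl.
- by move=> u k a b; rewrite linearP mulrDr scalerAr.
- by move=> v k a b; rewrite mulrDl scalerAl.
- by move=> u k a b; rewrite linearP mulrDr scalerAr.
by move=> a b; rewrite sext_antipodeE sext_inM.
Qed.

HB.instance Definition _ := Falgebra_isHopf.Build L HL
  sext_comulA sext_counitl sext_counitr sext_antipodel sext_antipoder.
End HopfStr.
End ScalarExt.

Record hopf_galois (K : fieldType) (L : fieldExtType K) (H : hopfType K) :=
  HopfGalois {
    hg_act :> {linear H -> 'End(L)};
    hg_act1 : hg_act 1 = \1%VF;
    hg_actM : forall h h' : H, hg_act (h * h') = (hg_act h \o hg_act h')%VF;
    hg_unit : forall h : H, hg_act h 1 = (counit h : K)%:A;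
    hg_mul : forall (h : H) (x y : L),
      hg_act h (x * y)
      = tens_lift (fun h1 h2 => hg_act h1 x * hg_act h2 y) (comul h);
    hg_bij : bijective
      (tens_lift (fun (l : L) (h : H) => (amull l \o hg_act h)%VF)
         : tensor L H -> 'End(L)) }.

Section Subalgebra.
Variables (K : fieldType) (H : hopfType K).
Implicit Types A : {vspace H}.

(* The image of A (x) B in U (x) V. *)
Definition tensv (U V : vectType K) (A : {vspace U}) (B : {vspace V}) :
    {vspace tensor U V} :=
  <<[seq tens a b | a <- vbasis A, b <- vbasis B]>>%VS.

Lemma memv_tens (U V : vectType K) (A : {vspace U}) (B : {vspace V}) :
  {in A & B, forall a b, tens a b \in tensv A B}.
Proof.
move=> a b /coord_vbasis-> Bb; elim/big_rec: _ => [|i x _ IHx].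
  by rewrite tens0l mem0v.
rewrite tensDl tensZl memvD ?memvZ //.
move: Bb => /coord_vbasis->; rewrite linear_sum memv_suml // => j _.
rewrite linearZ memvZ // memv_span //.
by apply: allpairs_f; rewrite memt_nth.
Qed.

Lemma tens_lift_tensv (U V : vectType K) (A : {vspace U}) (B : {vspace V})
    (W : lmodType K) (f g : U -> V -> W) t :
    (forall v, linear (f^~ v)) -> (forall u, linear (f u)) ->
    (forall v, linear (g^~ v)) -> (forall u, linear (g u)) ->
    {in A & B, f =2 g} -> t \in tensv A B ->
  tens_lift f t = tens_lift g t.
Proof.
move=> fl fr gl gr fg /(coord_span (X := in_tuple _))->.
rewrite !linear_sum; apply: eq_bigr => i _; rewrite !linearZ; congr (_ *: _).
have /allpairsP[[a b] /= [Aa Bb ->]] := mem_nth 0 (ltn_ord i).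
by rewrite !tens_liftE // fg ?vbasis_mem.
Qed.

(* Injectivity of A (x) A -> H (x) H, automatic over a field, lets one express
   comul(A) <= A (x) A inside H (x) H. *)
Definition is_hopf_sub A : bool :=
  [&& 1 \in A, (A * A <= A)%VS, (linfun comul @: A <= tensv A A)%VS
    & (linfun antipode @: A <= A)%VS].

Record hopf_sub := HopfSub {
  hopf_sub_val :> {vspace H}; hopf_subP : is_hopf_sub hopf_sub_val }.
HB.instance Definition _ := [isSub for hopf_sub_val].
HB.instance Definition _ := [Choice of hopf_sub by <:].
End Subalgebra.

Section Correspondence.
Variables (K : fieldType) (L : fieldExtType K) (H : hopfType K).
Variable S : hopf_galois L H.

(* The subspace L^A; see hg_fixedP. *)
Definition hg_fixed (A : {vspace H}) : {vspace L} :=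
  (\bigcap_(i < \dim A)
     lker (S (vbasis A)`_i - (counit (vbasis A)`_i : K) *: \1)%VF)%VS.

Lemma hg_fixedP (A : {vspace H}) (x : L) :
  reflect (forall h, h \in A -> S h x = (counit h : K) *: x)
          (x \in hg_fixed A).
Proof.
have E h : (x \in lker (S h - (counit h : K) *: \1)%VF)
           = (S h x == (counit h : K) *: x).
  by rewrite memv_ker !lfunE /= opp_lfunE scale_lfunE id_lfunE subr_eq0.
apply: (iffP idP) => [xA h /coord_vbasis->|xA].
  rewrite !linear_sum sum_lfunE scaler_suml; apply: eq_bigr => i _.
  rewrite !linearZ scale_lfunE -scalerA; congr (_ *: _); apply/eqP.
  rewrite -E; apply: subvP xA; exact: bigcapv_inf.
rewrite memvE; apply/subv_bigcapP => i _; rewrite -memvE E xA //.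
by rewrite vbasis_mem ?memt_nth.
Qed.

Fact hg_fixed_aspace (A : hopf_sub H) : is_aspace (hg_fixed A).
Proof.
case: A => A /= /and4P[A1 AM AD AS]; apply/andP; split.
  apply: has_algid1; apply/hg_fixedP => h _.
  by rewrite hg_unit.
apply/prodvP => x y /hg_fixedP Ax /hg_fixedP Ay; apply/hg_fixedP => h Ah.
have Dh : comul h \in tensv A A.
  by apply: subvP AD _ _; rewrite -[comul h](lfunE comul) memv_img.
rewrite hg_mul (tens_lift_tensv (g := fun h1 h2 =>
  ((counit h1 : K) *: x) * ((counit h2 : K) *: y)) _ _ _ _ _ Dh).
- rewrite -[in RHS](counitl h) /tens_lift linear_sum scaler_suml.
  apply: eq_bigr => i _; rewrite linear_sum scaler_suml.
  apply: eq_bigr => j _; rewrite !linearZ -scalerAl -scalerAr !scalerA.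
  by rewrite /= -!mulrA.
- by move=> v k a b; rewrite !linearP add_lfunE scale_lfunE mulrDl scalerAl.
- by move=> u k a b; rewrite !linearP add_lfunE scale_lfunE mulrDr scalerAr.
- by move=> v k a b; rewrite linearP scalerDl mulrDl -scalerA scalerAl.
- by move=> u k a b; rewrite linearP scalerDl mulrDr -scalerA scalerAr.
by move=> a b Aa Ab; rewrite /= Ax ?Ay.
Qed.

Definition hg_correspondence (A : hopf_sub H) : {subfield L} :=
  ASpace (hg_fixed_aspace A).
End Correspondence.

Definition of_type (K : fieldType) (L : fieldExtType K) (H : hopfType K)
    (N : finGroupType) : Prop :=
  hopf_isomorphic (scalar_ext L H) (group_algebra L N).

(* Main.v *)
Require Import Defs.
From mathcomp Require Import all_boot all_order all_fingroup all_algebra.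
From mathcomp Require Import all_solvable all_field.
From mathcomp Require Import zify mpoly.
From HB Require Import structures.

(* Let L/K be Galois with group G and H of type N.  Composing
   H -> L (x) H = L[N] with the coefficient functions gives N coordinate forms
   H -> L.  The group G permutes them, and H acts on L by
   h.x = \sum_n n(h) theta_n(x) for a bijection theta : N -> G.  Transporting the
   law of G along theta makes N a skew brace.  Hopf subalgebras of H correspond
   to the left ideals of this skew brace and intermediate fields to its
   circle-subgroups, so the Hopf-Galois correspondence is bijective if and only
   if every circle-subgroup is a left ideal.  Conversely, every skew brace with
   additive group N occurs: its circle group is the Galois group of some L/K,
   as every finite group permutes the variables of a field of rational functions,
   and H is the K-algebra of equivariant elements of L[N].

   It remains to find the groups N all of whose skew braces have this property.
   The law h * g forces all subgroups of N to be normal, and deformations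
   g * h * z ^ (e1 g * e2 h) and g * h ^ (r ^ e g), for characters e, e1, e2,
   reduce to N being C_2, C_2 x C_2 or cyclic of odd order with q not dividing
   p - 1.  In this last case every lam_g is a power map with exponent congruent
   to 1 modulo each prime divisor of |N|, so that an element of a circle-subgroup
   of order d is killed by d; hence the circle-subgroup is the subgroup of order
   d of N, which is characteristic. *)

Set Implicit Arguments.
Unset Strict Implicit.
Unset Printing Implicit Defensive.

(** * Skew braces *)

(** The record [coordinates] is the only interface between Hopf-Galois structures and skew braces.
    It describes H by its L-valued coordinate forms, so that no identification inside a tensor
    product over L has to be carried along: equalities in H or in its tensor square are tested on
    forms. Such coordinates come from any structure of type N and, for a prescribed brace, from
    explicit averages, so that one criterion serves both implications. The Galois theory needed is
    the independence of automorphisms and an element of trace 1.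

    On the group side each reduction exhibits a circle-subgroup that is not a left ideal. When N is
    non-abelian or of even order, a pair {1, g} with circle square 1 suffices. In the odd non-cyclic
    case it is a parabola, the elements x^n z^(n^2). When q divides p - 1 the circle group is
    non-abelian, and a conjugate of a subgroup on which all [lam g] are trivial does it. *)

Section Brace.
Local Open Scope group_scope.

(* A skew brace with additive group N, given by its lambda-map:
   the second group law is g o h = g * lam g h. *)
Record brace (N : finGroupType) := Brace {
  lam :> N -> N -> N;
  lamM : forall g, {morph lam g : x y / x * y};
  lam_comp : forall g h x, lam g (lam h x) = lam (g * lam g h) x;
  lam_inj : forall g, injective (lam g) }.

Definition circ N (B : brace N) (g h : N) : N := g * B g h.

(** As [N] is finite, such a set is a subgroup of the circle group: circle inverses are circle
    powers. *)
Definition circ_subgroup N (B : brace N) (A : {set N}) : Prop :=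
  1 \in A /\ {in A &, forall g h, circ B g h \in A}.

Definition left_ideal N (B : brace N) (A : {set N}) : Prop :=
  group_set A /\ forall g, {in A, forall x, B g x \in A}.

Definition all_ideals N (B : brace N) : Prop :=
  forall A, circ_subgroup B A -> left_ideal B A.

Section Theory.
Variables (N : finGroupType) (B : brace N).

Lemma lamg1 g : B g 1 = 1.
Proof. by apply: (mulgI (B g 1)); rewrite -lamM !mulg1. Qed.

(** [B 1] is injective and, by [lam_comp], idempotent. *)
Lemma lam1g x : B 1 x = x.
Proof. by apply: (@lam_inj _ B 1); rewrite lam_comp lamg1 mul1g. Qed.

Lemma lamX g x n : B g (x ^+ n) = B g x ^+ n.
Proof. by elim: n => [|n IHn]; rewrite ?lamg1 // !expgS lamM IHn. Qed.

Lemma circA : associative (circ B).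
Proof. by move=> g h k; rewrite /circ lamM lam_comp mulgA. Qed.

Lemma circ1g : left_id 1 (circ B).
Proof. by move=> g; rewrite /circ lam1g mul1g. Qed.

Lemma circg1 : right_id 1 (circ B).
Proof. by move=> g; rewrite /circ lamg1 mulg1. Qed.

Lemma circI g : injective (circ B g).
Proof. by move=> x y /mulgI/lam_inj. Qed.

Definition circ_inv (g : N) : N := invF (@circI g) 1.

Lemma circVg g : circ B g (circ_inv g) = 1.
Proof. exact: f_invF. Qed.

Lemma circgV : left_inverse 1 circ_inv (circ B).
Proof.
move=> g; apply: (@circI g).
by rewrite circA circVg circ1g circg1.
Qed.

(** An alias of [N] indexed by the brace, so that the same carrier can bear the circle law as a
    second group structure. *)
Definition circ_of (_ : brace N) : Type := N.
HB.instance Definition _ := Finite.copy (circ_of B) N.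
HB.instance Definition _ :=
  Finite_isGroup.Build (circ_of B) circA circ1g circgV.

Lemma left_ideal_circ A : left_ideal B A -> circ_subgroup B A.
Proof.
case=> /group_setP[A1 AM] Al; split=> // g h Ag Ah.
by rewrite AM ?Al.
Qed.
End Theory.

(* The almost trivial skew brace: g o h = h * g. *)
Section Opposite.
Variable N : finGroupType.
Let lam (g h : N) := h ^ g.
Let lam_comp g h x : lam g (lam h x) = lam (g * lam g h) x.
Proof. by rewrite /lam -conjgM -conjgC. Qed.
Definition opp_brace := @Brace N lam (fun g x y => conjMg x y g) lam_comp
  (fun g => @conjg_inj _ g).

Lemma opp_brace_normal : all_ideals opp_brace ->
  forall (A : {group N}) x g, x \in A -> x ^ g \in A.
Proof.
move=> idB A x g Ax; have [|_] := idB A; last exact.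
by split=> // y z Ay Az; rewrite /circ /= /lam conjgE mulKVg groupM.
Qed.
End Opposite.

(** * Twists of the group law by a bilinear map into the centre *)

Section Twist.
Variables (N : finGroupType) (p : nat) (z : N) (e1 e2 : N -> nat).
Hypothesis zC : forall g, commute z g.
Hypothesis zp : z ^+ p = 1.
Hypothesis e1M : forall g h, e1 (g * h) = e1 g + e1 h %[mod p].
Hypothesis e2M : forall g h, e2 (g * h) = e2 g + e2 h %[mod p].
Hypothesis e1z : e1 z = 0 %[mod p].
Hypothesis e2z : e2 z = 0 %[mod p].

(** [e1] and [e2] are characters modulo [p] that vanish at the central element [z]. Hence the
    exponent is bilinear modulo [p] and unchanged when an argument is multiplied by a power of [z];
    this is what makes [lam g] an automorphism and [lam] multiplicative for the circle law. *)
Let lam (g h : N) := h * z ^+ (e1 g * e2 h).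

Let zmod a b : a = b %[mod p] -> z ^+ a = z ^+ b.
Proof. by move=> ab; rewrite -(expg_mod a zp) ab expg_mod. Qed.

Let eX (e : N -> nat) (eM : forall g h, e (g * h) = e g + e h %[mod p])
  (ez : e z = 0 %[mod p]) n : e (z ^+ n) = 0 %[mod p].
Proof.
have e1_0 : e 1 = 0 %[mod p].
  by apply/eqP; rewrite -(eqn_modDl (e 1)) -eM mulg1 addn0.
by elim: n => [|n IHn] //; rewrite expgS eM -modnDm ez IHn modnDm.
Qed.

Let eMz (e : N -> nat) (eM : forall g h, e (g * h) = e g + e h %[mod p])
  (ez : e z = 0 %[mod p]) g n : e (g * z ^+ n) = e g %[mod p].
Proof. by rewrite eM -modnDmr eX // modnDmr addn0. Qed.

Let lamM g : {morph lam g : x y / x * y}.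
Proof.
have zXC n h : z ^+ n * h = h * z ^+ n by apply/commute_sym/commuteX/commute_sym.
move=> x y; rewrite /lam -!mulgA [z ^+ _ * (y * _)]mulgA zXC -!mulgA -expgD.
congr (_ * (_ * _)); rewrite -mulnDr.
by apply: zmod; rewrite -modnMmr e2M modnMmr.
Qed.

Let lam_comp g h x : lam g (lam h x) = lam (g * lam g h) x.
Proof.
rewrite /lam -mulgA -expgD; congr (_ * _); apply: zmod.
rewrite -modnDmr -modnMmr eMz // modnMmr modnDmr -mulnDl.
rewrite -modnMml -[RHS]modnMml mulgA eMz // e1M [e1 h + _]addnC //.
Qed.

Let lam_inj g : injective (lam g).
Proof.
move=> x y xy; have : lam g (x * y^-1) = 1.
  have := lamM g (x * y^-1) y; rewrite mulgKV xy.
  by move/(canLR (mulgK _)); rewrite mulgV.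
(* The quotient [x * y^-1] is a power of [z]; [e2] vanishes there, so [k] is 0 modulo [p]. *)
move=> /(canRL (mulgK _)); rewrite mul1g => xyE; set k := (e1 g * _)%N in xyE.
have /zmod k0 : k = 0 %[mod p].
  by rewrite /k -modnMmr xyE -expgVn invg_expg -expgM (eX e2M e2z) modnMmr muln0.
by move: xyE; rewrite k0 invg1 => /(canRL (mulgKV _)); rewrite mul1g.
Qed.

Definition twist_brace := @Brace N lam lamM lam_comp lam_inj.

Lemma twist_circ g h : circ twist_brace g h = g * h * z ^+ (e1 g * e2 h).
Proof. by rewrite /circ /= /lam mulgA. Qed.
End Twist.

(** * Twists of an abelian group by power automorphisms *)

Section Power.
Variables (N : finGroupType) (m r : nat) (e : N -> nat).
Hypothesis abN : abelian [set: N].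
Hypothesis m_gt0 : (0 < m)%N.
Hypothesis eM : forall g h, e (g * h) = e g + e h %[mod m].
Hypothesis r1 : r = 1 %[mod m].
Hypothesis rm : forall x : N, x ^+ (r ^ m) = x.

(** By [rm], raising to the power [r ^ e g] depends only on [e g] modulo [m]. By [r1], it preserves
    the character [e], so that [e] is additive for the circle law as well. *)
Let lam (g h : N) := h ^+ (r ^ e g).

Let rX k : forall x : N, x ^+ (r ^ (m * k)) = x.
Proof.
elim: k => [|k IHk] x; first by rewrite muln0 expg1.
by rewrite mulnS expnD expgM rm IHk.
Qed.

Let rmod a b x : a = b %[mod m] -> x ^+ (r ^ a) = x ^+ (r ^ b) :> N.
Proof.
move=> ab; rewrite (divn_eq a m) (divn_eq b m) ab !expnD.
by rewrite ![(_ %/ m * m)%N]mulnC !expgM !rX.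
Qed.

Lemma powchar1 : e 1 = 0 %[mod m].
Proof. by apply/eqP; rewrite -(eqn_modDl (e 1)) -eM mulg1 addn0. Qed.

Lemma powcharX x k : e (x ^+ k) = k * e x %[mod m].
Proof.
elim: k => [|k IHk]; first exact: powchar1.
by rewrite expgS eM -modnDmr IHk modnDmr mulSn.
Qed.

Let abC (x y : N) : commute x y.
Proof. by apply: (centsP abN); rewrite inE. Qed.

Let lamM g : {morph lam g : x y / x * y}.
Proof. by move=> x y; rewrite /lam expgMn. Qed.

Let lam_comp g h x : lam g (lam h x) = lam (g * lam g h) x.
Proof.
rewrite /lam -expgM -expnD; apply: rmod.
rewrite eM -[RHS]modnDmr powcharX -modnMml -modnXm r1 modnXm exp1n.
by rewrite modnMml mul1n modnDmr addnC.
Qed.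

Let lam_inj g : injective (lam g).
Proof.
(* The power [r ^ (m * e g)] acts trivially, so [r ^ (m * e g - e g)] undoes [r ^ e g] with a
   natural exponent. *)
move=> x y /(congr1 (fun t => t ^+ (r ^ (m * e g - e g)))).
by rewrite /lam -!expgM -!expnD subnKC ?rX // leq_pmull.
Qed.

Definition power_brace := @Brace N lam lamM lam_comp lam_inj.

Lemma power_circ g h k : e g = k %[mod m] ->
  circ power_brace g h = g * h ^+ (r ^ k).
Proof. by move=> gk; rewrite /circ /= /lam (rmod _ gk). Qed.
End Power.

(** * Non-abelian groups all of whose subgroups are normal *)

Section Dedekind.
Variable N : finGroupType.
Hypothesis normN : forall (A : {group N}) x g, x \in A -> x ^ g \in A.
Local Notation Z := 'C([set: N]).

Let comm_l (x y : N) : [~ x, y] \in <[x]>.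
Proof. by rewrite commgEl groupM ?groupV ?normN ?cycle_id. Qed.

Let comm_r (x y : N) : [~ x, y] \in <[y]>.
Proof. by rewrite commgEr groupM ?groupV ?normN ?groupV ?cycle_id. Qed.

Let cyc_comm (x y : N) : x \in <[y]> -> commute x y.
Proof. by case/cycleP=> k ->; apply/commute_sym/commuteX. Qed.

Let centT (x : N) : reflect (forall y, commute x y) (x \in Z).
Proof.
by apply: (iffP centP) => cx y //; apply: cx; rewrite inE.
Qed.

Let ncentT (x y : N) : [~ x, y] != 1 -> x \notin Z.
Proof. by apply: contra => /centT/(_ y)/commgP. Qed.

Let commX (x y : N) k : [~ x ^+ k, y] = [~ x, y] ^+ k.
Proof. by apply/commXg/commute_sym/cyc_comm/comm_l. Qed.

Let comXr (x y : N) k : [~ x, y ^+ k] = [~ x, y] ^+ k.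
Proof. by apply/commgX/commute_sym/cyc_comm/comm_r. Qed.

(* Elements i and j of minimal order subject to not being central, resp. not
   commuting with i, generate a quaternion group of order 8. *)
Lemma dedekind_nonabelian : ~~ abelian [set: N] ->
  exists i j c : N, [/\ forall g, [~ i, g] \in [set 1; c], [~ i, j] = c,
    c \in Z, c != 1 & (c ^+ 2 = 1 /\ j ^+ 2 = c)].
Proof.
case/subsetPn=> i0 _ i0Z.
have [i iZ i_min] := @arg_minnP _ i0 [pred x | x \notin Z] order i0Z.
have [j1 j1P] : exists j, [~ i, j] != 1.
  apply/existsP; apply: contraR iZ; rewrite negb_exists => /forallP ij.
  by apply/centT => y; apply/commgP; have := ij y; rewrite negbK.
have [j ijn1 j_min] := @arg_minnP _ j1 [pred y | [~ i, y] != 1] order j1P.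
rewrite /= in iZ ijn1 i_min j_min; set c := [~ i, j] in ijn1.
have jZ : j \notin Z.
  by apply: (@ncentT _ i); rewrite -invg_comm invg_eq1.
have i_gt1 : 1 < #[i].
  by rewrite order_gt1; apply: contraNneq iZ => ->; apply: group1.
have j_gt1 : 1 < #[j].
  by rewrite order_gt1; apply: contraNneq jZ => ->; apply: group1.
have order_lt (x : N) q : prime q -> q %| #[x] -> #[x ^+ q] < #[x].
  move=> q_pr qx; rewrite orderXdiv // ltn_Pdiv ?prime_gt1 ?order_gt0 //.
have iq q : prime q -> q %| #[i] -> i ^+ q \in Z.
  move=> q_pr qi; apply: contraLR (order_lt i q q_pr qi) => iqZ.
  by rewrite -leqNgt i_min.
have jq q : prime q -> q %| #[j] -> [~ i, j ^+ q] = 1.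
  move=> q_pr qj; apply/eqP; apply: contraLR (order_lt j q q_pr qj) => iqZ.
  by rewrite -leqNgt j_min.
have ciq q : prime q -> q %| #[i] -> c ^+ q = 1.
  by move=> q_pr qi; rewrite -commX; apply/eqP/commgP/centT/iq.
have cjq q : prime q -> q %| #[j] -> c ^+ q = 1.
  by move=> q_pr qj; rewrite -comXr jq.
pose p := pdiv #[i]; have p_pr : prime p by rewrite pdiv_prime.
have cp : c ^+ p = 1 by rewrite ciq ?pdiv_dvd.
have oc : #[c] = p by apply: nt_prime_order.
have pnat_of (x : N) : (forall q, prime q -> q %| #[x] -> c ^+ q = 1) ->
    p.-nat #[x].
  move=> cq; apply/pnatP; rewrite ?order_gt0 // => q q_pr qx.
  by rewrite inE /= eq_sym -(dvdn_prime2 p_pr q_pr) -oc order_dvdn cq.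
have [a oi] := p_natP (pnat_of i ciq); have [b oj] := p_natP (pnat_of j cjq).
have a_gt0 : 0 < a by rewrite lt0n; apply: contraTneq i_gt1 => a0; rewrite oi a0.
have le_ab : a <= b.
  by rewrite -(@leq_exp2l p) ?prime_gt1 // -oi -oj i_min.
(* If [c], of order [p], were not central, minimality of [#[i]] would give [<[c]> = <[i]>]; as [c]
   lies in [<[j]>], [i] would then commute with [j]. *)
have cZ : c \in Z.
  apply: contraLR ijn1 => cZ; have := i_min c cZ.
  rewrite oc oi -{2}(expn1 p) leq_exp2l ?prime_gt1 // => a1; rewrite negbK.
  have ic : i \in <[c]>.
    suff /eqP-> : <[c]> == <[i]> by apply: cycle_id.
    rewrite eqEcard cycle_subG comm_l /= -!orderE oc oi.
    by rewrite -{2}(expn1 p) leq_exp2l ?prime_gt1.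
  apply/commgP/cyc_comm; apply: subsetP ic.
  by rewrite cycle_subG comm_r.
(* An element of order [p] in a cyclic group of order [p ^ n] is a power of the generator with
   exponent [u * p ^ n.-1], [u] prime to [p]. *)
have cyc_pow (x : N) n : 0 < n -> #[x] = (p ^ n)%N -> c \in <[x]> ->
    exists2 u, ~~ (p %| u) & c = x ^+ (u * p ^ n.-1).
  move=> n_gt0 ox /cycleP[k cE]; have : #[x] %| k * p.
    by rewrite order_dvdn expgM -cE cp.
  rewrite ox -(prednK n_gt0) expnSr dvdn_pmul2r ?prime_gt0 //.
  case/dvdnP=> u kE; exists u; last by rewrite -kE.
  apply: contra ijn1 => /dvdnP[v uE]; rewrite /= cE kE uE -mulnA -expnS.
  by rewrite prednK // mulnC expgM -ox expg_order expg1n.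
have [u pu cu] := cyc_pow i a a_gt0 oi (comm_l i j).
have [v pv cv] := cyc_pow j b (leq_trans a_gt0 le_ab) oj (comm_r i j).
have cXY k l : [~ i ^+ k, j ^+ l] = c ^+ (k * l).
  by rewrite commX comXr -expgM mulnC.
(* The exponents are chosen so that the [p ^ a.-1]-th powers of [j ^+ K] and [i ^+ U] are [c] and
   [c^-1]. Up to a commutator term, the non-central product [w] then has order at most [p ^ a.-1],
   below the minimal order of [i]; so the commutator term cannot vanish. *)
pose U := (u * #[i].-1)%N; pose K := (v * p ^ (b - a))%N.
have iU : i ^+ U = i ^- u by rewrite /U mulnC expgM -invg_expg expgVn.
have jK : j ^+ (K * p ^ a.-1) = c.
  rewrite /K -mulnA -expnD cv; congr (_ ^+ (_ * _ ^ _)).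
  by rewrite -!subn1 addnBA // subnK.
pose w := j ^+ K * i ^+ U.
have wZ : w \notin Z.
  apply: contra pu => /centT/(_ j) wj.
  have : commute (i ^+ u) j.
    have -> : i ^+ u = w^-1 * j ^+ K by rewrite /w iU invMg invgK mulgKV.
    apply/commute_sym/commuteM; first exact/commuteV/commute_sym.
    exact/commuteX.
  by move/commgP; rewrite commX -order_dvdn oc.
have cent_c (x : N) k : commute x (c ^+ k).
  by apply/commuteX/commute_sym; move/centT: cZ; apply.
have w_exp : w ^+ (p ^ a.-1) = c ^+ (U * K * 'C(p ^ a.-1, 2)).
  rewrite /w expMg_Rmul ?cXY //; try exact: cent_c.
  have -> : i ^+ U ^+ (p ^ a.-1) = c^-1 by rewrite iU expgVn -expgM -cu.
  by rewrite -[_ ^+ K ^+ _]expgM jK mulgV mul1g [RHS]expgM.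
have pKC : ~~ (p %| K * 'C(p ^ a.-1, 2)).
  apply: contraL (i_min w wZ) => pKC; rewrite -ltnNge oi.
  apply: (@leq_ltn_trans (p ^ a.-1)); last first.
    by rewrite ltn_exp2l ?prime_gt1 // prednK.
  rewrite dvdn_leq ?expn_gt0 ?prime_gt0 // order_dvdn w_exp -mulnA.
  by rewrite -order_dvdn oc dvdn_mull.
have ba : b = a.
  apply/eqP; rewrite eqn_leq le_ab andbT leqNgt -subn_gt0.
  by apply: contra pKC => ab; rewrite dvdn_mulr // dvdn_mull // dvdn_exp.
have {}pKC : ~~ (p %| 'C(p ^ a.-1, 2)) by apply: contra pKC => /dvdn_mull->.
(* The binomial coefficient is 0 for [a = 1], divisible by [p] for odd [p] and [a > 1], and even
   when 4 divides [2 ^ a.-1]. *)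
have [p2 a2] : p = 2 /\ a = 2.
  have a_gt1 : 1 < a.
    case: a a_gt0 pKC {oi le_ab cu K jK w wZ w_exp ba} => [|[|a]] //=.
    by rewrite bin_small ?dvdn0.
  have p2 : p = 2.
    apply/(prime_oddPn p_pr); apply: contra pKC => p_odd.
    rewrite bin2odd ?oddX ?p_odd ?orbT // dvdn_mulr // dvdn_exp //.
    by rewrite -subn1 subn_gt0.
  split=> //; apply/eqP; rewrite eqn_leq a_gt1 andbT leqNgt.
  apply: contra pKC => a_gt2; rewrite p2.
  have /dvdnP[t ->] : 4 %| 2 ^ a.-1.
    by rewrite (@dvdn_exp2l 2 2) //; case: (a) a_gt2.
  rewrite bin2 mulnAC -[4]/(2 * 2)%N mulnA muln2 doubleK.
  exact: dvdn_mull.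
have two_odd (x : N) n : #[x] = 4 -> ~~ (2 %| n) -> x ^+ (n * 2) = x ^+ 2.
  rewrite dvdn2 negbK => ox n_odd; rewrite -expg_mod_order ox.
  by rewrite -[n](odd_double_half n) n_odd mulnDl -muln2 -mulnA addnC modnMDl.
have p2v : ~~ (2 %| v) by rewrite -{1}p2.
have p2u : ~~ (2 %| u) by rewrite -{1}p2.
have i2 : i ^+ 2 = c.
  have oi4 : #[i] = 4 by rewrite oi a2 p2.
  by rewrite cu {1}a2 {1}p2 (two_odd _ _ oi4).
have j2 : j ^+ 2 = c.
  have oj4 : #[j] = 4 by rewrite oj ba a2 p2.
  by rewrite cv {1}ba {1}a2 {1}p2 (two_odd _ _ oj4).
exists i, j, c; split=> //; last by split; first rewrite -p2.
move=> g; have /cycleP[k gE] := comm_l i g.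
have : 4 %| k * 2.
  have -> : 4 = #[i] by rewrite oi a2 p2.
  rewrite order_dvdn expgM -gE -commX.
  by apply/commgP/centT; rewrite -p2 iq ?pdiv_dvd.
rewrite -[4]/(2 * 2)%N dvdn_pmul2r // dvdn2 => /negPf k_even.
rewrite gE -(odd_double_half k) k_even add0n -mul2n expgM i2 -(expg_mod _ cp) p2.
by rewrite modn2 !inE; case: (odd _); rewrite ?eqxx ?orbT.
Qed.
End Dedekind.

(** * Congruences for powers and geometric sums *)

Section Arithmetic.
Local Open Scope nat_scope.

Lemma geom_mod x k d : x = 1 %[mod d] -> \sum_(i < k) x ^ i = k %[mod d].
Proof.
move=> x1; elim: k => [|k IHk]; first by rewrite big_ord0.
by rewrite big_ord_recr /= -modnDm IHk -modnXm x1 modnXm exp1n modnDm addn1.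
Qed.

(** [y ^ p - 1] is [y - 1] times a sum of [p] powers of [y], each congruent to 1 modulo [p]; so each
    further [p]-th power gains a factor [p]. *)
Lemma expn_lift p k x : 0 < x -> x = 1 %[mod p] -> x ^ (p ^ k) = 1 %[mod p ^ k.+1].
Proof.
move=> x0 x1; elim: k => [|k IHk]; first by rewrite !expn1.
set y := x ^ (p ^ k) in IHk; have y0 : 0 < y by rewrite expn_gt0 x0.
rewrite expnSr expnM -/y; apply/eqP; rewrite eqn_mod_dvd ?expn_gt0 ?x0 //.
rewrite subn1 predn_exp expnSr dvdn_mul //.
  by rewrite -subn1 -eqn_mod_dvd // IHk.
have y1 : y = 1 %[mod p].
  have pd : p %| p ^ k.+1 by apply: dvdn_exp.
  by rewrite -(modn_dvdm _ pd) IHk modn_dvdm.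
by rewrite /dvdn geom_mod // modnn.
Qed.

Lemma root_of_unity_mod p q : prime p -> prime q -> q %| p - 1 ->
  exists r, forall j, (r ^ j == 1 %[mod p]) = (q %| j).
Proof.
move=> p_pr q_pr qp; have p_gt1 := prime_gt1 p_pr.
have : q %| #|units_Zp p| by rewrite card_units_Zp ?totient_prime ?prime_gt0 // -subn1.
case/Cauchy=> // s _ os; exists (FinRing.uval s : 'Z_p) => j.
rewrite -os order_dvdn -val_eqE /= FinRing.val_unitX /=.
have := val_Zp_nat p_gt1 ((FinRing.uval s : 'Z_p) ^ j).
rewrite GRing.natrX natr_Zp => <-.
by congr (_ == _ %% _); rewrite Zp_cast.
Qed.

(** With [r = 1 + p * e], the [i]-th term is [1 + i * p * e] modulo [p ^ 2], and the sum of the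
    [i * p * e] is [p * e] times [p * (p - 1) / 2], a multiple of [p ^ 2] because [p] is odd. *)
Lemma geom_prime p r : prime p -> odd p -> r = 1 %[mod p] ->
  \sum_(i < p) r ^ i = p %[mod p ^ 2].
Proof.
move=> p_pr p_odd r1; have p_gt1 := prime_gt1 p_pr.
have [e rE] : exists e, r = 1 + p * e.
  exists (r %/ p); rewrite {1}(divn_eq r p) r1 modn_small // addnC mulnC //.
have rX i : exists c, r ^ i = 1 + i * (p * e) + c * p ^ 2.
  elim: i => [|i [c IHi]]; first by exists 0.
  exists (i * e * e + c + c * p * e); rewrite expnSr IHi rE -!mulnn; lia.
have {}rX i : r ^ i = 1 + i * (p * e) %[mod p ^ 2].
  by have [c ->] := rX i; rewrite addnC modnMDl.
have -> : \sum_(i < p) r ^ i = \sum_(i < p) (1 + i * (p * e)) %[mod p ^ 2].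
  apply: (big_ind2 (fun x y => x = y %[mod p ^ 2])) => // x x' y y' xx' yy'.
  by rewrite -modnDm xx' yy' modnDm.
rewrite big_split /= sum1_card card_ord -big_distrl /= -modnDmr.
rewrite -(big_mkord xpredT id) bin2_sum bin2odd //.
have -> : p * p.-1./2 * (p * e) = p.-1./2 * e * p ^ 2 by rewrite -mulnn; lia.
by rewrite modnMl addn0.
Qed.

Lemma geom_mul r m k :
  \sum_(i < m * k) r ^ i = (\sum_(i < m) r ^ i) * \sum_(j < k) (r ^ m) ^ j.
Proof.
elim: k => [|k IHk]; first by rewrite muln0 !big_ord0 muln0.
rewrite mulnSr big_split_ord /= IHk big_ord_recr /= mulnDr; congr (_ + _).
rewrite big_distrl /=; apply: eq_bigr => i _.
by rewrite expnD mulnC expnM.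
Qed.

(** Circle powers are geometric sums, so this turns a relation in the circle group into one in the
    additive group. Induction on [d] splits off a prime [p] at a time: the sum of [p] powers of [r]
    is [p * w] with [w] prime to [n], and [w] can be cancelled. *)
Lemma dvdn_geom n r d x : odd n ->
    (forall p, prime p -> p %| n -> r = 1 %[mod p]) -> d %| n ->
  n %| (\sum_(i < d) r ^ i) * x -> n %| d * x.
Proof.
move=> oddn; have [b] := ubnP d; elim: b r d x => // b IHb r d x lt_d r1 dn.
have n_gt0 : 0 < n by case: (n) oddn.
have d_gt0 : 0 < d := dvdn_gt0 n_gt0 dn.
have [d1 | d_gt1] := leqP d 1.
  have -> : d = 1 by apply/eqP; rewrite eqn_leq d1.
  by rewrite big_ord1.
pose p := pdiv d; have p_pr : prime p by rewrite pdiv_prime.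
have pd : p %| d := pdiv_dvd d; have pn : p %| n := dvdn_trans pd dn.
have p_odd : odd p := dvdn_odd pn oddn.
have dE : d = p * (d %/ p) by rewrite mulnC divnK.
rewrite dE geom_mul; set s := \sum_(i < p) r ^ i.
have s2 : s = p %[mod p ^ 2] by apply: geom_prime => //; apply: r1.
have /dvdnP[w sE] : p %| s.
  have pp : p %| p ^ 2 by apply: dvdn_exp.
  by rewrite /dvdn -(modn_dvdm _ pp) s2 modn_dvdm // modnn.
(* A prime [l] dividing [n] and [w] divides [s], which is congruent to [p] modulo [l], so [l = p].
   Then [p ^ 2] divides [s], which is congruent to [p] modulo [p ^ 2]. *)
have cop : coprime n w.
  rewrite /coprime eqn_leq gcdn_gt0 n_gt0 andbT leqNgt; apply/negP => gt1.
  pose l := pdiv (gcdn n w); have l_pr : prime l by rewrite pdiv_prime.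
  have /andP[ln lw] : (l %| n) && (l %| w) by rewrite -dvdn_gcd pdiv_dvd.
  have lp : l = p.
    apply/eqP; rewrite -(dvdn_prime2 l_pr p_pr) /dvdn -(geom_mod p (r1 l l_pr ln)).
    by rewrite -/(l %| s) sE dvdn_mulr.
  have : p ^ 2 %| s by rewrite sE -mulnn dvdn_mul // -lp.
  rewrite /dvdn s2 -/(p ^ 2 %| p) => /dvdn_leq; rewrite prime_gt0 // -mulnn.
  by move=> /(_ isT); rewrite -{3}(muln1 p) leq_pmul2l ?prime_gt0 // leqNgt prime_gt1.
rewrite sE -!mulnA Gauss_dvdr // ![p * (_ * x)]mulnCA => H.
apply: IHb H => [|l l_pr ln|].
- by rewrite -ltnS (leq_trans _ lt_d) // ltnS ltn_Pdiv ?prime_gt1.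
- by rewrite -modnXm r1 // modnXm exp1n.
by apply: dvdn_trans dn; apply/dvdnP; exists p.
Qed.
End Arithmetic.

End Brace.

(** * Groups whose skew braces have only left ideals as circle-subgroups *)

Section Forward.
Local Open Scope group_scope.
Variable N : finGroupType.

(** A discrete logarithm along a direct factor, with values in nat that matter only modulo [#[x]].
    It supplies the characters that twist an abelian [N]. *)
Lemma cyclic_log (x : N) (K : {group N}) : <[x]> \x K = [set: N] ->
  exists e : N -> nat,
    (forall g h, e (g * h) = e g + e h %[mod #[x]]) /\
    (forall k n, k \in K -> e (x ^+ n * k) = n %[mod #[x]]).
Proof.
case/dprodP=> _ defN cxK tiK.
(* The default 0 is never taken, since every element factors through the direct product. *)
pose e g := if [pick n : 'I_#[x] | x ^- n * g \in K] is Some n then val n else 0.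
have eP g : exists2 k, k \in K & g = x ^+ e g * k.
  have : g \in <[x]> * K by rewrite defN inE.
  case/mulsgP=> y k /cyclePmin[n lt_n ->] Kk gE; rewrite /e.
  case: pickP => [m Km | /(_ (Ordinal lt_n))]; last by rewrite /= gE mulKg Kk.
  by exists (x ^- m * g); rewrite ?mulKVg.
have e_uniq k n : k \in K -> e (x ^+ n * k) = n %[mod #[x]].
  move=> Kk; have [k' Kk' eq_x] := eP (x ^+ n * k).
  set E := e _ in eq_x *; have dE : x ^- E * x ^+ n = k' * k^-1.
    by apply: (mulIg k); rewrite -mulgA eq_x mulKg mulgKV.
  apply/eqP; rewrite -eq_expg_mod_order eq_mulVg1.
  suff : x ^- E * x ^+ n \in <[x]> :&: K by rewrite tiK inE.
  by rewrite inE groupM ?groupV ?mem_cycle // dE groupM ?groupV.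
exists e; split=> // g h; have [[k Kk gE] [l Kl hE]] := (eP g, eP h).
rewrite {1}gE {1}hE.
have -> : x ^+ e g * k * (x ^+ e h * l) = x ^+ (e g + e h) * (k * l).
  rewrite expgD -!mulgA; congr (_ * _); rewrite !mulgA; congr (_ * _).
  exact: (centsP cxK _ Kk _ (mem_cycle _ _)).
by rewrite e_uniq ?groupM.
Qed.

Hypothesis idN : forall B : brace N, all_ideals B.

(** The commutator with [i] is a character with values in {1, c}. Twisting by it with [z = c] gives
    [j] the circle square [j ^+ 2 * c = 1], so {1, j} is a circle-subgroup; but [j ^+ 2 = c] lies
    outside it. *)
Lemma ideals_abelian : abelian [set: N].
Proof.
have normN := opp_brace_normal (@idN _).
apply: contraT => /(dedekind_nonabelian normN)[i [j [c]]].
case=> ic ijc /centP cZ c1 [c2 j2].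
have {}cZ g : commute c g by apply: cZ; rewrite inE.
have cc : c * c = 1 := c2.
pose e g : nat := [~ i, g] != 1.
have eM g h : e (g * h) = e g + e h %[mod 2].
  have cg : [~ i, g] ^ h = [~ i, g].
    by have:= ic g; rewrite !inE => /orP[]/eqP->; rewrite ?conj1g // conjgE cZ mulKg.
  rewrite /e commgMJ cg; have:= ic g; have:= ic h; rewrite !inE.
  by move=> /orP[]/eqP-> /orP[]/eqP->;
    rewrite ?mulg1 ?mul1g ?eqxx ?c1 // cc eqxx.
have ec : e c = 0 %[mod 2].
  by have /commgP/eqP ci := commute_sym (cZ i); rewrite /e ci eqxx.
have [|/group_setP[_ jM] _] := @idN (twist_brace cZ c2 eM eM ec ec) [set 1; j].
  split=> [|g h]; rewrite !inE ?eqxx //.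
  move=> /orP[]/eqP-> /orP[]/eqP->; rewrite ?circ1g ?circg1 ?eqxx ?orbT //.
  by rewrite twist_circ /e ijc c1 -[j * j]/(j ^+ 2) j2 cc eqxx.
have := jM j j; rewrite !inE eqxx orbT => /(_ isT isT).
rewrite -[j * j]/(j ^+ 2) j2 (negPf c1) /= => /eqP cj.
by have := c1; rewrite -j2 -cj c2 eqxx.
Qed.

(** A character [e] onto Z/2 lets the elements with [e g] odd act by inversion. Such a [g] has
    circle square 1, so {1, g} must be a subgroup and [g ^+ 2 = 1]. An element with [e g] even is
    reached through [x * g]. *)
Lemma ideals_abelem : 2 %| #|N| -> 2.-abelem [set: N].
Proof.
have abN := ideals_abelian => evN.
(* An element whose order is the exponent generates a direct factor, and its order is even; the
   logarithm along it can be reduced modulo 2. *)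
have [x _ ox] := exponent_witness (abelian_nil abN).
have /splitsP[K /complP[tiK defN]] := abelian_splits (in_setT x) (esym ox) abN.
have [|e [eM eK]] := @cyclic_log x K.
  by rewrite dprodE //; apply: sub_abelian_cent2 abN _ _; apply: subsetT.
have two_x : 2 %| #[x].
  have : 2 \in \pi([set: N]) by rewrite mem_primes /= cardsT evN -cardsT cardG_gt0.
  by rewrite -pi_of_exponent ox mem_primes => /and3P[].
have {}eM g h : e (g * h) = e g + e h %[mod 2].
  by rewrite -(modn_dvdm _ two_x) eM modn_dvdm.
have N0 : 0 < #|N| by rewrite -cardsT cardG_gt0.
have gN (g : N) : g ^+ #|N| = 1 by rewrite -cardsT expg_cardG ?inE.
(* The exponent [#|N|.-1] is inversion written as a natural, and odd, power. *)
have r1 : #|N|.-1 = 1 %[mod 2].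
  by rewrite !modn2 -subn1 oddB // dvdn2 in evN *; case: odd evN.
have rm (g : N) : g ^+ (#|N|.-1 ^ 2) = g.
  have inv (h : N) : h ^+ #|N|.-1 = h^-1.
    by apply: (mulgI h); rewrite -expgS mulgV prednK.
  by rewrite -mulnn expgM !inv invgK.
have sq g : odd (e g) -> g ^+ 2 = 1.
  move=> eg; pose B := power_brace abN (isT : 0 < 2)%N eM r1 rm.
  have [|/group_setP[_ gM] _] := @idN B [set 1; g].
    split=> [|h k]; rewrite !inE ?eqxx //.
    move=> /orP[]/eqP-> /orP[]/eqP->; rewrite ?circ1g ?circg1 ?eqxx ?orbT //.
    rewrite (power_circ _ _ _ _ _ _ (k := 1)) ?modn2 ?eg // expn1.
    by rewrite -expgS prednK // gN eqxx.
  have := gM g g; rewrite !inE eqxx orbT => /(_ isT isT).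
  case/orP=> [/eqP // | /eqP gg].
  by have := mulgI _ _ _ (etrans gg (esym (mulg1 g))) => ->; rewrite expg1n.
rewrite abelemE // abN /=; apply/exponentP=> g _.
have [eg | eg] := boolP (odd (e g)); first exact: sq.
have ex : odd (e x).
  have := eK 1 1%N (group1 _); rewrite expg1 mulg1 => /(congr1 (modn^~ 2)).
  by rewrite !(modn_dvdm _ two_x) !modn2; case: odd.
have := sq (x * g); rewrite expgMn; last by apply: (centsP abN); rewrite inE.
rewrite (sq x ex) mul1g; apply.
by have := eM x g; rewrite !modn2 oddD ex (negPf eg); case: odd.
Qed.

(** The elements [x], [y], [w] are chosen with [e1] odd on [x] and even on [y], [w], and [e2] odd on
    [y] and even on [w]. Twisting by [w] leaves {1, y} a circle-subgroup, while [x] sends [y] to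
    [y * w]. Order above 4 is what makes [K :&: M], the home of [w], nontrivial. *)
Lemma ideals_rank2 : 2.-abelem [set: N] -> #|N| <= 4.
Proof.
move=> abN; rewrite leqNgt; apply/negP => gt4.
have split_cyc (x : N) : x != 1 -> exists (K : {group N}) (e : N -> nat),
    [/\ (#|K| * 2 = #|N|)%N, x \notin K,
        forall g h, e (g * h) = e g + e h %[mod 2],
        e x = 1 %[mod 2] & forall k, k \in K -> e k = 0 %[mod 2]].
  move=> x1; have ox : #[x] = 2 by apply: abelem_order_p abN (in_setT x) x1.
  have /splitsP[K /complP[tiK defN]] := abelem_splits abN (subsetT <[x]>).
  have defD : <[x]> \x K = [set: N].
    rewrite dprodE //.
    by apply: sub_abelian_cent2 (abelem_abelian abN) _ _; apply: subsetT.
  have [e [eM eK]] := cyclic_log defD; rewrite ox in eM eK.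
  exists K, e; split=> //.
  - by rewrite -[RHS]cardsT -(dprod_card defD) -orderE ox mulnC.
  - apply: contra x1 => Kx; have : x \in <[x]> :&: K by rewrite inE cycle_id.
    by rewrite tiK inE.
  - by rewrite -{1}[x]mulg1 -{1}[x]expg1 eK.
  by move=> k Kk; rewrite -[k]mul1g -(expg0 x) eK.
have N0 : 0 < #|N| by apply: leq_trans gt4.
have nt (K : {group N}) : 1 < #|K| -> exists2 x, x \in K & x != 1.
  by move=> K1; apply/trivgPn; rewrite trivg_card_le1 -ltnNge.
have [|x _ /split_cyc[K [e1 [oK _ e1M e1x e1K]]]] := nt setT%G.
  by rewrite cardsT (leq_trans _ gt4).
have [|y Ky y1] := nt K.
  by rewrite -(ltn_pmul2r (isT : 0 < 2)%N) oK mul1n (leq_trans _ gt4).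
have [M [e2 [oM My e2M e2y e2K]]] := split_cyc y y1.
have [|w] := nt (K :&: M)%G.
  have := leq_mul (leqnn #|K :&: M|) (subset_leq_card (subsetT (K * M))).
  rewrite mulnC -mul_cardG cardsT -(leq_pmul2r (isT : 0 < 2 * 2)%N).
  rewrite mulnACA oK oM mulnAC leq_pmul2r // => /(leq_trans gt4).
  by rewrite -{1}[4]mul1n (@ltn_pmul2r 4).
rewrite inE => /andP[Kw Mw] w1.
have zC g : commute w g by apply: (centsP (abelem_abelian abN)); rewrite inE.
have sq (g : N) : g ^+ 2 = 1.
  by case/and3P: abN => _ _ /exponentP; apply; rewrite inE.
have [|_ /(_ x y)] :=
  @idN (twist_brace zC (sq w) e1M e2M (e1K w Kw) (e2K w Mw)) [set 1; y].
  split=> [|h k]; rewrite !inE ?eqxx //.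
  move=> /orP[]/eqP-> /orP[]/eqP->; rewrite ?circ1g ?circg1 ?eqxx ?orbT //.
  rewrite twist_circ -[y * y]/(y ^+ 2) sq mul1g -(expg_mod _ (sq w)).
  by rewrite -modnMml (e1K y Ky) mod0n eqxx.
rewrite !inE eqxx orbT => /(_ isT) /=.
rewrite -(expg_mod _ (sq w)) -modnMml e1x -modnMmr e2y expg1.
case/orP=> [/eqP yw | /eqP yw].
  by case/negP: My; rewrite -(mulgK w y) yw mul1g groupV.
by case/negP: w1; apply/eqP/(mulgI y); rewrite yw mulg1.
Qed.

(** If the complement of a maximal cyclic factor [<[x]>] is nontrivial, it contains [z] of prime
    order [p] dividing [#[x]]. The twist by [e] and [2 * e] completes squares: the circle powers of
    [x * z] are [x ^+ n * z ^+ (n * n)]. A left ideal containing [x * z] would contain [x * z ^+ 3],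
    which is off this parabola as [p] is odd. *)
Lemma ideals_cyclic : odd #|N| -> cyclic [set: N].
Proof.
have abN := ideals_abelian => oddN.
have [x _ ox] := exponent_witness (abelian_nil abN).
have /splitsP[K /complP[tiK defN]] := abelian_splits (in_setT x) (esym ox) abN.
have [|e [eM eK]] := @cyclic_log x K.
  by rewrite dprodE //; apply: sub_abelian_cent2 abN _ _; apply: subsetT.
have [K1 | /trivgPn[y Ky y1]] := eqVneq (K : {set N}) 1.
  by rewrite -defN K1 mulg1 cycle_cyclic.
pose p := pdiv #[y]; have p_pr : prime p by rewrite pdiv_prime ?order_gt1.
have [z yz oz] := Cauchy p_pr (pdiv_dvd #[y]).
have Kz : z \in K by apply: subsetP yz; rewrite cycle_subG.
have p_x : p %| #[x] by rewrite -ox -oz dvdn_exponent ?inE.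
have p_odd : odd p.
  by apply: dvdn_odd oddN; rewrite -oz -cardsT order_dvdG ?inE.
have abC (g h : N) : commute g h by apply: (centsP abN); rewrite inE.
have zp : z ^+ p = 1 by rewrite -oz expg_order.
have e1M g h : e (g * h) = e g + e h %[mod p].
  by rewrite -(modn_dvdm _ p_x) eM modn_dvdm.
have e2M g h : 2 * e (g * h) = 2 * e g + 2 * e h %[mod p].
  by rewrite -modnMmr e1M modnMmr mulnDr.
have e1z : e z = 0 %[mod p].
  by rewrite -(modn_dvdm _ p_x) -[z]mul1g -(expg0 x) eK // modn_dvdm.
have e2z : 2 * e z = 0 %[mod p] by rewrite -modnMmr e1z modnMmr muln0.
(* The circ-subgroup generated by x * z. *)
pose A := [set g | g == x ^+ e g * z ^+ (e g * e g)].
have memA n : x ^+ n * z ^+ (n * n) \in A.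
  have en : e (x ^+ n * z ^+ (n * n)) = n %[mod #[x]] by rewrite eK ?groupX.
  have enp : e (x ^+ n * z ^+ (n * n)) = n %[mod p].
    by rewrite -(modn_dvdm _ p_x) en modn_dvdm.
  rewrite inE; apply/eqP; congr (_ * _); apply/eqP.
    by rewrite eq_expg_mod_order en.
  rewrite eq_expg_mod_order oz -[X in _ == X]modnMml.
  by rewrite -[X in _ == X]modnMmr enp modnMml modnMmr eqxx.
have e_xz : e (x * z) = 1 %[mod #[x]] by have := eK z 1%N Kz; rewrite expg1.
have Axz : x * z \in A by have := memA 1%N; rewrite muln1 !expg1.
have [|_ /(_ (x * z) _ Axz)] := @idN (twist_brace (abC z) zp e1M e2M e1z e2z) A.
  split=> [|g h]; first by have := memA 0; rewrite mul1g.
  rewrite [g \in A]inE [h \in A]inE => /eqP gE /eqP hE.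
  rewrite twist_circ {1}gE {1}hE.
  have := memA (e g + e h)%N; congr (_ \in mem A).
  rewrite -!mulgA expgD -mulgA; congr (_ * _).
  rewrite [RHS]mulgA (abC (z ^+ _) (x ^+ _)) -mulgA; congr (_ * _).
  by rewrite -!expgD !mulnn sqrnD -addnA mulnCA.
rewrite inE /= => /eqP; set k := (_ * (2 * _))%N; set t := x * z * z ^+ k => tE.
have et : e t = 1 %[mod #[x]].
  by rewrite /t -mulgA -expgS -{1}[x]expg1 eK ?groupX.
have etp : e t = 1 %[mod p] by rewrite -(modn_dvdm _ p_x) et modn_dvdm.
have e_xzp : e (x * z) = 1 %[mod p] by rewrite -(modn_dvdm _ p_x) e_xz modn_dvdm.
have xt : x ^+ e t = x by apply/eqP; rewrite -{2}[x]expg1 eq_expg_mod_order et.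
have zt : z ^+ (e t * e t) = z.
  apply/eqP; rewrite -{2}[z]expg1 eq_expg_mod_order oz.
  by rewrite -modnMml -modnMmr etp modnMml modnMmr.
have : z ^+ k = 1 by apply: (mulgI (x * z)); rewrite mulg1 -[LHS]/t tE xt zt.
have k2 : k = 2 %[mod p].
  by rewrite /k -modnMml e_xzp modnMml mul1n -modnMmr e_xzp modnMmr.
rewrite -(expg_mod _ zp) k2 expg_mod // => /eqP; rewrite -order_dvdn oz.
rewrite (dvdn_prime2 p_pr) // => /eqP p2.
by move: p_odd; rewrite p2.
Qed.

(** A power map of order [q] on the [p]-part, trivial on the part of order [m], makes the circle
    group non-abelian. The subgroup [T] of order [m] is a circle-subgroup, and its circle conjugate
    by an element [x] of order [p] fails to be a left ideal. *)
Lemma ideals_primes p q : cyclic [set: N] -> prime p -> prime q ->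
  p %| #|N| -> q %| #|N| -> ~~ (q %| p - 1).
Proof.
have abN := ideals_abelian.
case/cyclicP=> u defN p_pr q_pr pN qN; apply/negP=> qp.
have q_p : q != p.
  apply: contraTneq qp => ->; rewrite subn1 gtnNdvd //.
    by rewrite -subn1 subn_gt0 prime_gt1.
  by rewrite prednK ?prime_gt0.
have N0 : (0 < #|N|)%N by rewrite -cardsT cardG_gt0.
have ou : #[u] = #|N| by rewrite /order -defN cardsT.
have [|e [eM eK]] := @cyclic_log u 1; first by rewrite dprodg1 -defN.
have eu n : e (u ^+ n) = n %[mod q].
  by rewrite -ou in qN; rewrite -(modn_dvdm _ qN) -[u ^+ n]mulg1 eK ?inE // modn_dvdm.
have {}eM g h : e (g * h) = e g + e h %[mod q].
  by rewrite -ou in qN; rewrite -(modn_dvdm _ qN) eM modn_dvdm.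
have [a [m [pm nE]]] : exists a m, ~~ (p %| m) /\ #|N| = (p ^ a.+1 * m)%N.
  have [m pm nE] := pfactor_coprime p_pr N0; rewrite prime_coprime // in pm.
  exists (logn p #|N|).-1, m; rewrite prednK ?logn_gt0 ?mem_primes ?p_pr ?N0 //.
  by rewrite mulnC.
have qm : q %| m.
  have := qN; rewrite nE Euclid_dvdM // Euclid_dvdX // dvdn_prime2 //.
  by rewrite (negPf q_p).
have [r0 r0P] := root_of_unity_mod p_pr q_pr qp.
have r0_gt0 : (0 < r0)%N.
  rewrite lt0n; apply: contraTneq (dvdnn q) => r00.
  by rewrite -r0P r00 exp0n ?prime_gt0 // mod0n modn_small ?prime_gt1.
have cop : coprime m (p ^ a.+1) by rewrite coprime_sym coprimeXl ?prime_coprime.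
(* [r0] has order [q] modulo [p]. Its [p ^ a]-th power has order dividing [q] modulo [p ^ a.+1] by
   [expn_lift], and still order [q] modulo [p] because [q != p]. *)
pose r := chinese m (p ^ a.+1) 1 (r0 ^ (p ^ a)).
have r1m : r = 1 %[mod m] := chinese_modl cop _ _.
have r1 : r = 1 %[mod q] by rewrite -(modn_dvdm _ qm) r1m modn_dvdm.
have r_pa : r = r0 ^ (p ^ a) %[mod p ^ a.+1] := chinese_modr cop _ _.
have r_p : r = r0 ^ (p ^ a) %[mod p].
  have pp : p %| p ^ a.+1 by rewrite dvdn_exp.
  by rewrite -(modn_dvdm _ pp) r_pa modn_dvdm.
have rp j : (r ^ j == 1 %[mod p]) = (q %| j).
  rewrite -modnXm r_p modnXm -expnM r0P Euclid_dvdM // Euclid_dvdX // dvdn_prime2 //.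
  by rewrite (negPf q_p).
have rm (g : N) : g ^+ (r ^ q) = g.
  rewrite -{2}[g]expg1; apply/eqP; rewrite eq_expg_mod_order.
  have oN : #[g] %| m * p ^ a.+1.
    by rewrite mulnC -nE -cardsT order_dvdG ?inE.
  apply/eqP; rewrite -(modn_dvdm _ oN) -[RHS](modn_dvdm _ oN); congr (_ %% _).
  apply/eqP; rewrite chinese_remainder // -modnXm r1m modnXm exp1n eqxx /=.
  rewrite -modnXm r_pa modnXm -expnM mulnC expnM.
  apply/eqP/expn_lift; first by rewrite expn_gt0 r0_gt0.
  by apply/eqP; rewrite r0P.
pose B := power_brace abN (prime_gt0 q_pr) eM r1 rm.
have BE g h k : e g = k %[mod q] -> circ B g h = g * h ^+ (r ^ k).
  exact: power_circ.
have [x xE ox] : exists2 x, x = u ^+ (p ^ a * m) & #[x] = p.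
  exists (u ^+ (p ^ a * m)) => //.
  have pa : (0 < p ^ a * m)%N.
    by rewrite muln_gt0 expn_gt0 prime_gt0 //=; case: (m) pm; rewrite ?dvdn0.
  have nE' : #[u] = (p * (p ^ a * m))%N by rewrite ou nE expnS mulnA.
  by rewrite orderXdiv nE' ?mulnK // dvdn_mull.
have yB (y : N) k : y \in <[x]> -> y ^+ (r ^ k) = y -> y = 1 \/ q %| k.
  move=> xy yk; have [-> | y1] := eqVneq y 1; [by left | right].
  have oy : #[y] = p.
    have : #[y] %| p by rewrite -ox order_dvdG.
    by case/primeP: p_pr => _ pP /pP/orP[]/eqP // /eqP; rewrite order_eq1 (negPf y1).
  by rewrite -rp -oy -eq_expg_mod_order expg1 yk.
have abC (g h : N) : commute g h by apply: (centsP abN); rewrite inE.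
pose T := <[u ^+ (p ^ a.+1)]>%G.
have Tm t : t \in T -> t ^+ m = 1.
  by case/cycleP=> k ->; rewrite -!expgM mulnCA -nE mulnC expgM -ou expg_order expg1n.
have tiT : T :&: <[x]> = 1.
  apply: coprime_TIg; rewrite -!orderE ox coprime_sym prime_coprime //.
  apply: contra pm => /dvdn_trans; apply; rewrite order_dvdn Tm ?cycle_id //.
pose w k := x * x^-1 ^+ (r ^ k).
have w_x k : w k \in <[x]> by rewrite groupM ?groupX ?groupV ?cycle_id.
have w_mod k l : k = l %[mod q] -> w k = w l.
  have rk n : r ^ n = r ^ (n %% q) %[mod p].
    rewrite {1}(divn_eq n q) expnD -modnMml [(_ %/ _ * _)%N]mulnC expnM -modnXm.
    have rq : r ^ q = 1 %[mod p] by apply/eqP; rewrite rp.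
    by rewrite rq modnXm exp1n modnMml mul1n.
  move=> kl; congr (_ * _); apply/eqP.
  by rewrite eq_expg_mod_order orderV ox rk kl -rk.
have ew k : e (w k) = 0 %[mod q].
  have /cycleP[n ->] := w_x k.
  rewrite xE -expgM eu mod0n; apply/eqP.
  by rewrite -/(q %| _) dvdn_mulr ?dvdn_mull.
(* A is the conjugate of T by x in the circle group. *)
pose A := [set t * w (e t) | t in T].
have [|gA Al] := @idN B A.
  split=> [|_ _ /imsetP[t Tt ->] /imsetP[t' Tt' ->]].
    apply/imsetP; exists 1; rewrite ?group1 // (w_mod _ 0%N); last exact: powchar1 eM.
    by rewrite /w expg1 mulgV mulg1.
  apply/imsetP; exists (t * t'); first by rewrite groupM.
  rewrite (BE _ _ (e t)); last by rewrite eM -modnDmr ew modnDmr addn0.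
  rewrite expgMn; last exact: abC.
  have -> : t' ^+ (r ^ e t) = t'.
    rewrite -(expg_mod _ (Tm _ Tt')) -modnXm r1m modnXm exp1n.
    by rewrite expg_mod ?Tm.
  rewrite -!mulgA; congr (_ * _); rewrite mulgA (abC (w _)) -mulgA.
  congr (_ * _); rewrite (w_mod (e (t * t')) (e t' + e t)%N); last by rewrite addnC eM.
  rewrite /w expgMn; last exact: abC.
  rewrite -expgM -expnD [x^-1 ^+ (r ^ e t)]expgVn (abC x) (abC (x ^+ _)) -mulgA.
  by rewrite mulKVg; apply: abC.
pose t := u ^+ (p ^ a.+1); pose k := e t.
have Tt : t \in T by apply: cycle_id.
have At : t * w k \in A by apply/imsetP; exists t.
have := Al t _ At.
have -> : B t (t * w k) = t * w k ^+ (r ^ k).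
  apply: (mulgI t); rewrite -[LHS]/(circ B t _) (BE _ _ k) // expgMn; last exact: abC.
  rewrite -(expg_mod _ (Tm _ Tt)) -modnXm r1m modnXm exp1n.
  by rewrite expg_mod ?Tm.
rewrite -[A]/(group gA : {set N}) in At *.
move=> At'; have := groupM (groupVr At) At'.
rewrite invMg -mulgA mulKg => /imsetP[t1 Tt1 t1E].
(* The quotient of the two elements of [A] lies in [<[x]>], so its component in [T] is trivial.
   Hence [w k] is fixed by the power [r ^ k], which forces [q] to divide [k = e t]; but [e t] is
   [p ^ a.+1] modulo [q]. *)
have t1_1 : t1 = 1.
  apply/set1gP; rewrite -tiT inE Tt1 /=.
  have -> : t1 = (w k)^-1 * w k ^+ (r ^ k) * (w (e t1))^-1.
    by rewrite t1E mulgK.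
  by rewrite !groupM ?groupV ?groupX.
have w0 : w (e 1) = 1.
  by rewrite (w_mod _ 0%N) ?(powchar1 eM) // /w expg1 mulgV.
move: t1E; rewrite t1_1 w0 mulg1 => /(canRL (mulKVg _)); rewrite mulg1 => wk.
have q_k : q %| k.
  have [wk1 | //] := yB _ _ (w_x k) wk.
  have [||/eqP|//] := yB x^-1 k; first by rewrite groupV cycle_id.
    by apply: (mulgI x); rewrite mulgV -[LHS]/(w k).
  by rewrite invg_eq1 -order_eq1 ox => /eqP p1; rewrite p1 in p_pr.
move: q_k; rewrite /dvdn eu -/(dvdn _ _) Euclid_dvdX // dvdn_prime2 //.
by rewrite (negPf q_p).
Qed.
End Forward.

Section Classification.
Local Open Scope group_scope.

Lemma abelem_Z2 : 2.-abelem [set: 'Z_2].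
Proof.
rewrite abelemE //; apply/andP; split.
  by apply/centsP=> x _ y _; apply: Zp_addC.
by apply/exponentP=> x _; apply/val_inj; case: x => [[|[|//]] ?].
Qed.

Lemma abelem_Z2Z2 : 2.-abelem [set: ('Z_2 * 'Z_2)%type].
Proof.
rewrite abelemE //; apply/andP; split.
  apply/centsP=> -[x1 x2] _ [y1 y2] _; congr (_, _); exact: Zp_addC.
apply/exponentP=> -[x1 x2] _; congr (_, _); apply/val_inj.
  by case: x1 => [[|[|//]] ?].
by case: x2 => [[|[|//]] ?].
Qed.

Definition arithmetic_type (N : finGroupType) :=
  [\/ [set: N] \isog [set: 'Z_2],
      [set: N] \isog [set: ('Z_2 * 'Z_2)%type]
    | [/\ cyclic [set: N], odd #|[set: N]|
       & forall p q : nat, prime p -> prime q ->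
           p %| #|[set: N]| -> q %| #|[set: N]| -> ~~ (q %| p - 1)%N]].

Lemma arithmetic_type_of_ideals (N : finGroupType) :
  (forall B : brace N, all_ideals B) -> arithmetic_type N.
Proof.
move=> idN; have [oddN | evN] := boolP (odd #|N|).
  have cN := ideals_cyclic idN oddN.
  by apply: Or33; rewrite cardsT; split=> // p q p_pr q_pr; apply: ideals_primes.
rewrite -dvdn2 in evN.
have aN := ideals_abelem idN evN; have := ideals_rank2 idN aN.
have N0 : 0 < #|N| by rewrite -cardsT cardG_gt0.
case: #|N| {evN} (evN) N0 (cardsT N) => [|[|[|[|[|]]]]] // _ _ oN _.
  by apply: Or31; rewrite (isog_abelem_card _ aN) abelem_Z2 oN cardsT card_ord.
apply: Or32; rewrite (isog_abelem_card _ aN) abelem_Z2Z2 oN cardsT card_prod.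
by rewrite !card_ord.
Qed.

(** * Skew braces on the groups of the classification *)

Section Converse.
Variables (N : finGroupType) (B : brace N).

Lemma circ_group_set A : circ_subgroup B A -> group_set (A : {set circ_of B}).
Proof. by case=> A1 AM; apply/group_setP. Qed.

Lemma circ_card A : circ_subgroup B A -> #|A| %| #|N|.
Proof.
move/circ_group_set=> gA; rewrite -[#|N|](cardsT (circ_of B)).
exact: cardSg (subsetT (group gA)).
Qed.

(** A nontrivial proper circle-subgroup is {1, s} with circle square [ss = 1]. If some [B g s]
    differed from [s], then 1, s, g, s * g and [B g s] would be five distinct elements; right
    cancellation in the circle group separates the last one from [g] and [s * g]. *)
Lemma ideals_of_abelem : 2.-abelem [set: N] -> #|N| <= 4 -> all_ideals B.
Proof.
move=> abN N4 A cA; have [A1 AM] := cA.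
have sq (g : N) : g * g = 1.
  by case/and3P: abN => _ _ /exponentP /(_ g (in_setT g)).
have [[s As s1] | A_triv] :=
  altP (exists_inP (D := mem A) (P := fun s => s != 1)); last first.
  have A2 : A = 1%G.
    apply/setP=> x; rewrite inE; apply/idP/eqP => [Ax | -> //].
    by apply: contraNeq A_triv => x1; apply/exists_inP; exists x.
  rewrite A2; split=> [|g x]; first exact: groupP.
  by rewrite !inE => /eqP->; rewrite lamg1.
have [A3 | A_proper] := eqVneq A setT.
  by rewrite A3; split=> [|g x _]; rewrite ?inE //; apply: (groupP [set: N]).
have s2 : #|[set 1; s]| = 2 by rewrite cards2 eq_sym s1.
have sA : [set 1; s] \subset A.
  by apply/subsetP=> x; rewrite !inE => /orP[]/eqP->.
have A4 : #|A| = 2.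
  have A_lt : #|A| < #|N| by rewrite -cardsT proper_card // properT.
  have /dvdnP[k kE] := circ_card cA; apply/eqP; rewrite eqn_leq.
  rewrite -{2}s2 subset_leq_card // andbT -(@leq_pmul2l 2) //.
  rewrite (leq_trans _ N4) // kE leq_mul2r; apply/orP; right.
  by rewrite leqNgt; apply: contraL A_lt; rewrite kE; case: (k) => [|[|]] // _;
    rewrite -leqNgt ?mul0n ?mul1n.
have AE : A = [set 1; s].
  by apply/esym/eqP; rewrite eqEcard A4 s2 sA.
have ss : circ B s s = 1.
  have := AM s s As As; rewrite AE !inE => /orP[/eqP // | /eqP ss].
  by have := circI (etrans ss (esym (circg1 B s))) => s_1; rewrite s_1 eqxx in s1.
have Bss : B s s = s by apply: (mulgI s); rewrite sq -[LHS]/(circ B s s).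
have Bs g : B g s = s.
  have [-> | g1] := eqVneq g 1; first exact: lam1g.
  have [-> // | gs] := eqVneq g s; apply: contraTeq N4 => Bgs.
  have circIr (h k : N) : circ B h s = circ B k s -> h = k.
    by move=> hk; apply: (@mulIg (circ_of B) s).
  have uniq_s : uniq [:: 1; s; g; s * g; B g s].
    have e3 : 1 != s * g.
      by apply: contra gs => /eqP sg1; rewrite -(mulg1 s) sg1 mulgA sq mul1g.
    have e4 : 1 != B g s by rewrite -(lamg1 B g) (inj_eq (@lam_inj _ B g)) eq_sym.
    have e6 : s != s * g by rewrite -{1}(mulg1 s) (inj_eq (mulgI s)) eq_sym.
    have e8 : g != s * g by rewrite -{1}(mul1g g) (inj_eq (mulIg g)) eq_sym.
    have e9 : g != B g s.
      by apply: contra gs => /eqP gE; apply/eqP/circIr; rewrite ss /circ -gE sq.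
    have e10 : s * g != B g s.
      apply: contra g1 => /eqP sgE; apply/eqP/circIr; rewrite circ1g /circ -sgE.
      have gC : commute g s by apply: (centsP (abelem_abelian abN)); rewrite inE.
      by rewrite mulgA gC -mulgA sq mulg1.
    rewrite /= !inE !negb_or (eq_sym 1 s) s1 (eq_sym 1 g) g1 (eq_sym s g) gs.
    by rewrite e3 e4 e6 (eq_sym s (B g s)) Bgs e8 e9 e10.
  by rewrite -ltnNge -[5]/(size [:: 1; s; g; s * g; B g s]) -(card_uniqP uniq_s) max_card.
rewrite AE; split.
  apply/group_setP; split=> [|x y]; rewrite !inE ?eqxx //.
  by move=> /orP[]/eqP-> /orP[]/eqP->; rewrite ?mul1g ?mulg1 ?sq ?eqxx ?orbT.
by move=> g x; rewrite !inE => /orP[]/eqP->; rewrite ?lamg1 ?Bs eqxx ?orbT.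
Qed.

Lemma lam_cyclic (u : N) : <[u]> = [set: N] ->
  forall g, exists r, forall x, B g x = x ^+ r.
Proof.
move=> defN g; have : B g u \in <[u]> by rewrite defN inE.
case/cycleP=> r Bu; exists r => x; have : x \in <[u]> by rewrite defN inE.
by case/cycleP=> k ->; rewrite lamX Bu -!expgM mulnC.
Qed.

Lemma circ_exp (g : N) r n : (forall x, B g x = x ^+ r) ->
  ((g : circ_of B) ^+ n = g ^+ (\sum_(i < n) r ^ i) :> N) /\
  (forall x, B ((g : circ_of B) ^+ n) x = x ^+ (r ^ n)).
Proof.
move=> Bg; elim: n => [|n [IHn IHB]].
  by rewrite big_ord0; split=> // x; rewrite expg0 lam1g.
split; last first.
  move=> x; rewrite expgS -[_ * _]/(circ B g _) /circ -lam_comp IHB Bg.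
  by rewrite -expgM mulnC -expnS.
rewrite expgS -[_ * _]/(circ B g _) /circ IHn Bg -expgM -expgS.
congr (_ ^+ _); rewrite big_ord_recl expn0 add1n; congr _.+1.
by rewrite mulnC big_distrr; apply: eq_bigr => i _; rewrite /= expnS.
Qed.

Lemma ideals_of_cyclic : cyclic [set: N] -> odd #|N| ->
  (forall p q, prime p -> prime q -> p %| #|N| -> q %| #|N| -> ~~ (q %| p - 1)) ->
  all_ideals B.
Proof.
case/cyclicP=> u defN oddN N_primes A cA; have [A1 AM] := cA.
set d := #|A|; have dN : d %| #|N| := circ_card cA.
have ou : #[u] = #|N| by rewrite /order -defN cardsT.
have N0 : 0 < #|N| by rewrite -cardsT cardG_gt0.
have A_d a : a \in A -> a ^+ d = 1.
  move=> Aa; have [r Br] := lam_cyclic (esym defN) a.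
  (* Modulo [p], both [r ^ #|N|] (the circle power [a ^+ #|N|] is 1) and [r ^ (p - 1)] (Fermat) are
     1, and the arithmetic condition makes the two exponents coprime. *)
  have r1 p : prime p -> p %| #|N| -> r = 1 %[mod p].
    move=> p_pr pN; have p0 := prime_gt0 p_pr.
    have rN : r ^ #|N| = 1 %[mod p].
      have aN : (a : circ_of B) ^+ #|N| = 1.
        by rewrite -[#|N|](cardsT (circ_of B)) expg_cardG ?inE.
      have [_ /(_ u)] := circ_exp #|N| Br; rewrite aN lam1g => /esym/eqP.
      rewrite -{2}[u]expg1 eq_expg_mod_order ou => /eqP rN.
      by rewrite -(modn_dvdm _ pN) rN modn_dvdm.
    have p1 : 0 < p - 1 by rewrite subn_gt0 prime_gt1.
    have cop : coprime #|N| (p - 1).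
      rewrite /coprime eqn_leq gcdn_gt0 N0 andbT leqNgt; apply/negP => gt1.
      pose q := pdiv (gcdn #|N| (p - 1)); have q_pr : prime q by rewrite pdiv_prime.
      have /andP[qN qp] : (q %| #|N|) && (q %| p - 1) by rewrite -dvdn_gcd pdiv_dvd.
      by have := N_primes p q p_pr q_pr pN qN; rewrite qp.
    have rp : coprime r p.
      rewrite coprime_sym prime_coprime //; apply: contraTN (eqxx (1 %% p)%N) => pr.
      rewrite -{1}rN -modnXm (eqP pr) exp0n // mod0n modn_small ?prime_gt1 //.
    have rp1 : r ^ (p - 1) = 1 %[mod p].
      by rewrite subn1 -totient_prime // Euler_exp_totient.
    have /(coprimeP _ N0)[[k l] /= kl] := cop.
    have kl' : (k * #|N| = l * (p - 1) + 1)%N.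
      by rewrite -[X in (_ + X)%N]kl subnKC // ltnW // -subn_gt0 kl.
    have : r ^ (k * #|N|) = 1 %[mod p].
      by rewrite mulnC expnM -modnXm rN modnXm exp1n.
    rewrite kl' expnD expn1 mulnC [(l * _)%N]mulnC expnM -modnMmr -modnXm rp1.
    by rewrite modnXm exp1n modnMmr muln1.
  have ad : (a : circ_of B) ^+ d = 1.
    by apply/eqP; rewrite -order_dvdn; apply: (@order_dvdG _ (group (circ_group_set cA))).
  have [as1 _] := circ_exp d Br; rewrite ad in as1.
  have {as1} : a ^+ (\sum_(i < d) r ^ i) = 1 := esym as1.
  have : a \in <[u]> by rewrite -defN inE.
  case/cycleP=> k ->; rewrite -!expgM => /eqP; rewrite -order_dvdn ou mulnC => kd.
  by apply/eqP; rewrite -order_dvdn ou mulnC (dvdn_geom oddN r1).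
have defA : A = [set x | x ^+ d == 1].
  apply/eqP; rewrite eqEcard; apply/andP; split.
    by apply/subsetP => x Ax; rewrite inE A_d.
  have d0 : 0 < d := dvdn_gt0 N0 dN.
  have oud : #[u ^+ (#|N| %/ d)] = d.
    rewrite orderXdiv ou ?divnA // ?mulKn //.
    by apply/dvdnP; exists d; rewrite mulnC divnK.
  rewrite -[X in _ <= X]oud subset_leq_card //; apply/subsetP=> x; rewrite inE.
  have : x \in <[u]> by rewrite -defN inE.
  case/cycleP=> k ->; rewrite -expgM -order_dvdn ou -{1}(divnK dN).
  rewrite dvdn_pmul2r // => /dvdnP[l ->].
  by rewrite mulnC expgM mem_cycle.
rewrite defA; split.
  apply/group_setP; split=> [|x y]; rewrite !inE ?expg1n // => /eqP xd /eqP yd.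
  rewrite expgMn ?xd ?yd ?mulg1 //.
  by apply: (centsP (cyclic_abelian (cycle_cyclic u))); rewrite -defN inE.
by move=> g x; rewrite !inE -lamX => /eqP->; rewrite lamg1.
Qed.
End Converse.

Theorem all_idealsP (N : finGroupType) :
  (forall B : brace N, all_ideals B) <-> arithmetic_type N.
Proof.
split=> [|[isoN | isoN | [cN oddN N_primes]] B]; first exact: arithmetic_type_of_ideals.
- by apply: ideals_of_abelem;
    rewrite ?(isog_abelem isoN) ?abelem_Z2 // -cardsT (card_isog isoN) cardsT card_ord.
- apply: ideals_of_abelem; rewrite ?(isog_abelem isoN) ?abelem_Z2Z2 //.
  by rewrite -cardsT (card_isog isoN) cardsT card_prod card_ord.
by rewrite cardsT in oddN N_primes; apply: ideals_of_cyclic.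
Qed.
End Classification.

Import GRing.Theory VectorInternalTheory.

(** * Every finite group is a Galois group *)

Section ArtinExtension.
Local Open Scope ring_scope.

(** [fa_gen] has [#|G|] distinct conjugates: it will be a primitive element, and its powers the
    basis of [M] over the fixed field. *)
Record field_action (M : fieldType) (G : finGroupType) := FieldAction {
  fa_mor :> G -> {rmorphism M -> M};
  fa_mor1 : forall x, fa_mor 1%g x = x;
  fa_morM : forall g h x, fa_mor (g * h)%g x = fa_mor g (fa_mor h x);
  fa_gen : M;
  fa_gen_inj : injective (fun g => fa_mor g fa_gen) }.

Variables (M : fieldType) (G : finGroupType) (act : field_action M G).

Definition fixpred : {pred M} := fun x => [forall g, act g x == x].

Lemma fixpredP x : reflect (forall g, act g x = x) (x \in fixpred).
Proof. by apply: (iffP forallP) => fx g; apply/eqP; rewrite ?fx. Qed.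

Fact fixpred_divring : divring_closed fixpred.
Proof.
split=> [|x y /fixpredP fx /fixpredP fy|x y /fixpredP fx /fixpredP fy].
- by apply/fixpredP => g; rewrite rmorph1.
- by apply/fixpredP => g; rewrite rmorphB fx fy.
by apply/fixpredP => g; rewrite fmorph_div fx fy.
Qed.
HB.instance Definition _ := GRing.isDivringClosed.Build M fixpred fixpred_divring.

Record fix_field := FixField { fix_val :> M; fix_valP : fix_val \in fixpred }.
HB.instance Definition _ := [isSub for fix_val].
HB.instance Definition _ := [Choice of fix_field by <:].
HB.instance Definition _ := [SubChoice_isSubIntegralDomain of fix_field by <:].
HB.instance Definition _ := [SubIntegralDomain_isSubField of fix_field by <:].

Lemma act_fix (k : fix_field) g : act g (val k) = val k.
Proof. by apply/fixpredP; apply: valP. Qed.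

Definition artin_ext (_ : field_action M G) : Type := M.
Local Notation L := (artin_ext act).
HB.instance Definition _ := GRing.Field.copy L M.

Definition artin_scale (k : fix_field) (x : L) : L := val k * x.
Fact artin_scaleA a b x : artin_scale a (artin_scale b x) = artin_scale (a * b) x.
Proof. by rewrite /artin_scale mulrA rmorphM. Qed.
Fact artin_scale1 : left_id 1 artin_scale.
Proof. by move=> x; rewrite /artin_scale rmorph1 mul1r. Qed.
Fact artin_scaleDr : right_distributive artin_scale +%R.
Proof. by move=> a x y; apply: mulrDr. Qed.
Fact artin_scaleDl x : {morph artin_scale^~ x : a b / a + b}.
Proof. by move=> a b; rewrite /artin_scale rmorphD mulrDl. Qed.
HB.instance Definition _ := GRing.Zmodule_isLmodule.Build fix_field L
  artin_scaleA artin_scale1 artin_scaleDr artin_scaleDl.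
Fact artin_scaleAl (a : fix_field) (x y : L) : a *: (x * y) = (a *: x) * y.
Proof. exact: mulrA. Qed.
HB.instance Definition _ := GRing.Lmodule_isLalgebra.Build fix_field L
  artin_scaleAl.
Fact artin_scaleAr (a : fix_field) (x y : L) : a *: (x * y) = x * (a *: y).
Proof. exact: mulrCA. Qed.
HB.instance Definition _ := GRing.Lalgebra_isAlgebra.Build fix_field L
  artin_scaleAr.

Lemma artin_scaleE (a : fix_field) (x : L) : a *: x = (val a * x : M).
Proof. by []. Qed.

Local Notation n := #|G|.
Local Notation t := (fa_gen act).

Let V : 'M[M]_n := Vandermonde n (\row_j act (enum_val j) t).

Let V_unit : V \in unitmx.
Proof.
rewrite unitmxE det_Vandermonde unitfE; apply/prodf_neq0 => i _.
apply/prodf_neq0 => j lt_ij; rewrite !mxE subr_eq0.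
apply: contraTneq lt_ij => /(@fa_gen_inj _ _ act)/enum_val_inj->.
by rewrite ltnn.
Qed.

Definition conjugates (x : M) : 'rV[M]_n := \row_j act (enum_val j) x.

(** If [x] is the sum of [c i * t ^+ i] with fixed coefficients, its conjugates form the row
    [c *m V]; inverting the Vandermonde matrix recovers [c]. The result is fixed by [G], which only
    permutes the equations. *)
Let coordsM (x : M) : 'rV[M]_n := conjugates x *m invmx V.

Let coords_fix x i : coordsM x 0 i \in fixpred.
Proof.
apply/fixpredP => g; suff: map_mx (act g) (coordsM x) = coordsM x.
  by move/matrixP/(_ 0 i); rewrite mxE.
apply: (canRL (mulmxK V_unit)); apply/rowP => j.
pose k := enum_rank (g^-1 * enum_val j)%g.
have : map_mx (act g) (coordsM x *m V) 0 k = map_mx (act g) (conjugates x) 0 k.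
  by rewrite mulmxKV.
have gk y : act g (act (enum_val k) y) = act (enum_val j) y.
  by rewrite -fa_morM enum_rankK mulKVg.
rewrite !mxE gk => <-; rewrite rmorph_sum; apply: eq_bigr => l _.
by rewrite rmorphM !mxE rmorphXn gk.
Qed.

Let coords (x : L) : 'rV[fix_field]_n := \row_i FixField (coords_fix x i).

Let coords_linear : linear coords.
Proof.
move=> a x y; apply/rowP => i; apply: val_inj.
have cE : conjugates (a *: x + y) = val a *: conjugates x + conjugates y.
  by apply/rowP => j; rewrite !mxE rmorphD rmorphM act_fix.
have cval z : val (coords z 0 i) = coordsM z 0 i by rewrite mxE.
transitivity (val a * coordsM x 0 i + coordsM y 0 i).
  have cM : coordsM (a *: x + y) = val a *: coordsM x + coordsM y.
    by rewrite /coordsM cE mulmxDl -scalemxAl.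
  have mE b (A C : 'rV[M]_n) : (b *: A + C) 0 i = b * A 0 i + C 0 i by rewrite !mxE.
  by rewrite cval cM mE.
have mE b (A C : 'rV[fix_field]_n) : (b *: A + C) 0 i = b * A 0 i + C 0 i.
  by rewrite !mxE.
by rewrite mE rmorphD rmorphM; congr (_ * _ + _); apply/esym/cval.
Qed.

Let f (u : 'rV[fix_field]_n) : L := \sum_i u 0 i *: (t : L) ^+ i.

Let coords_sum x : x = f (coords x).
Proof.
have E : (coordsM x *m V) 0 (enum_rank 1%g) = x.
  by rewrite mulmxKV // mxE enum_rankK fa_mor1.
rewrite -{1}E mxE; apply: eq_bigr => i _; rewrite artin_scaleE; congr (_ * _).
  by rewrite [in RHS]mxE.
by rewrite !mxE enum_rankK fa_mor1.
Qed.

Let coords_bij : bijective coords.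
Proof.
exists f => [x | u]; first by rewrite -coords_sum.
have cE : conjugates (f u) = map_mx val u *m V.
  apply/rowP => j; rewrite !mxE rmorph_sum; apply: eq_bigr => k _.
  by rewrite !mxE rmorphM act_fix rmorphXn.
apply/rowP => i; apply: val_inj; transitivity (coordsM (f u) 0 i).
  by rewrite mxE.
by rewrite /coordsM cE mulmxK // mxE.
Qed.

HB.instance Definition _ := Lmodule_hasFinDim.Build fix_field L
  (exist2 _ _ coords coords_linear coords_bij).
HB.instance Definition _ := Algebra_isFalgebra.Build fix_field L.

Lemma artin_gen (x : L) : exists c : 'I_n -> fix_field, x = \sum_i c i *: (t : L) ^+ i.
Proof. by exists (coords x 0); apply: coords_sum. Qed.

Lemma artin_mem1 (x : L) : (x : M) \in fixpred -> x \in 1%VS.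
Proof.
move=> fx; have -> : x = (FixField fx)%:A by rewrite artin_scaleE mulr1.
by rewrite memvZ // mem1v.
Qed.

Let p : {poly L} := \prod_(g : G) ('X - (act g t)%:P).

Let p_over : p \is a polyOver 1%VS.
Proof.
apply/polyOverP => i; apply/artin_mem1/fixpredP => g.
have -> : act g p`_i = (map_poly (act g) p)`_i by rewrite coef_map.
suff -> : map_poly (act g) p = p by [].
rewrite rmorph_prod [RHS](reindex_inj (mulgI g)).
by apply: eq_bigr => h _; rewrite rmorphB /= map_polyX map_polyC /= fa_morM.
Qed.

Let p_split : splittingFieldFor 1 p {:L}.
Proof.
exists [seq act g t | g <- enum G].
  by rewrite big_map big_enum eqpxx.
apply/eqP; rewrite eqEsubv subvf /=; apply/subvP => x _.
have [c ->] := artin_gen x; apply: memv_suml => i _; rewrite memvZ // rpredX //.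
by rewrite seqv_sub_adjoin //; apply/mapP; exists 1%g; rewrite ?mem_enum ?fa_mor1.
Qed.

Let p_separable : separable_poly p.
Proof.
rewrite /p -big_enum /= -(big_map (fun g => act g t) xpredT (fun x => 'X - x%:P)).
by rewrite separable_prod_XsubC map_inj_uniq ?enum_uniq //; apply: (@fa_gen_inj _ _ act).
Qed.

HB.instance Definition _ := FieldExt_isSplittingField.Build fix_field L
  (ex_intro2 _ _ p p_over p_split).

Lemma artin_galois : galois 1 {:L}.
Proof. by apply/splitting_galoisField; exists p. Qed.

Let actL (g : G) : L -> L := act g.
Let actL_linear g : linear (actL g).
Proof. by move=> a x y; rewrite /actL rmorphD rmorphM act_fix. Qed.

Lemma artin_gal g : {x : gal_of {:L} | forall y, x y = act g y}.
Proof.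
pose lg := HB.pack_for {linear L -> L} (actL g)
  (GRing.isLinear.Build fix_field L L _ (actL g) (actL_linear g)).
have : kAut 1 {:L} (linfun lg).
  rewrite kAutfE; apply/kHom_monoid_morphism; split=> [|x y].
    by rewrite lfunE /= /actL rmorph1.
  by rewrite !lfunE /= /actL rmorphM.
case/kAut_to_gal=> x _ xE; exists x => y.
by rewrite -xE ?memvf // lfunE.
Qed.

Definition artin_theta g : gal_of {:L} := sval (artin_gal g).

Lemma artin_thetaE g y : artin_theta g y = act g y.
Proof. exact: (svalP (artin_gal g)). Qed.

(** Surjectivity is a count: an automorphism is determined by its value at [t], which is a root of
    [p], hence one of the [act g t]. *)
Lemma artin_theta_bij : bijective artin_theta.
Proof.
have inj : injective artin_theta.
  move=> g h gh; apply: (@fa_gen_inj _ _ act).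
  by rewrite /= -!artin_thetaE gh.
apply: (inj_card_bij inj).
have root_t (x : gal_of {:L}) : exists g, x t == act g t.
  have : root p (x t).
    apply: kHom_root_id (k1AHom _ x) p_over (memvf _) _; first exact: subvf.
    rewrite /root horner_prod (bigD1 1%g) //= fa_mor1 hornerXsubC subrr mul0r //.
  rewrite /root horner_prod => /prodf_eq0[g _].
  by rewrite hornerXsubC subr_eq0; exists g.
apply: (@leq_card _ _ (fun x => xchoose (root_t x))) => x y xy.
have xyt : x t = y t.
  by rewrite (eqP (xchooseP (root_t x))) xy -(eqP (xchooseP (root_t y))).
apply/eqP/gal_eqP => z _; have [c ->] := artin_gen z.
by rewrite !linear_sum; apply: eq_bigr => i _; rewrite !linearZ !rmorphXn;
  congr (_ *: _ ^+ _).
Qed.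

Lemma artin_realization :
  exists (K : fieldType) (L : splittingFieldType K) (theta : G -> gal_of {:L}),
    [/\ galois 1 {:L}, bijective theta
      & forall g h x, theta (g * h)%g x = theta g (theta h x)].
Proof.
exists fix_field, L, artin_theta; split=> [||g h x].
- exact: artin_galois.
- exact: artin_theta_bij.
by rewrite !artin_thetaE fa_morM.
Qed.
End ArtinExtension.

(** * Extension of an injective endomorphism to the field of fractions *)

Section FractionMorphism.
Local Open Scope ring_scope.
Variables (R : idomainType) (f : {rmorphism R -> R}).
Hypothesis f_inj : injective f.
Local Notation "x %:F" := (FracField.tofrac x).
Local Notation repr := generic_quotient.repr.

Lemma fraction_numden (x : {fraction R}) :
  x = (\n_(repr x))%:F / (\d_(repr x))%:F.
Proof.
rewrite -[LHS]generic_quotient.reprK; move: (repr x) => r.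
unlock FracField.tofrac.
rewrite -[X in _ = _ * X]FracField.pi_inv -[RHS]FracField.pi_mul.
rewrite /FracField.mulf /FracField.invf !numden_Ratio ?oner_neq0 ?denom_ratioP //.
by rewrite mulr1 mul1r Ratio_numden.
Qed.

Lemma fraction_repr (x : {fraction R}) :
  exists n d : R, d != 0 /\ x = n%:F / d%:F.
Proof.
exists \n_(repr x), \d_(repr x); split; first exact: denom_ratioP.
exact: fraction_numden.
Qed.

Definition fraction_map (x : {fraction R}) : {fraction R} :=
  (f \n_(repr x))%:F / (f \d_(repr x))%:F.

Let f_neq0 d : d != 0 -> (f d)%:F != 0.
Proof. by rewrite tofrac_eq0 raddf_eq0. Qed.

Lemma fraction_mapE n d : d != 0 ->
  fraction_map (n%:F / d%:F) = (f n)%:F / (f d)%:F.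
Proof.
move=> d0; set x := _ / _; have r0 := denom_ratioP (repr x).
have xE : x = (\n_(repr x))%:F / (\d_(repr x))%:F := fraction_numden x.
rewrite /fraction_map; apply/eqP; rewrite eqr_div ?f_neq0 //.
rewrite -!tofracM -!rmorphM tofrac_eq (inj_eq f_inj) -tofrac_eq !tofracM.
by rewrite -eqr_div ?tofrac_eq0 // -xE.
Qed.

Lemma fraction_map_monoid : monoid_morphism fraction_map.
Proof.
split=> [|x y].
  have -> : 1 = 1%:F / 1%:F :> {fraction R} by rewrite tofrac1 divr1.
  by rewrite fraction_mapE ?oner_neq0 // rmorph1 tofrac1 divr1.
have [[n [d [d0 ->]]] [m [e [e0 ->]]]] := (fraction_repr x, fraction_repr y).
rewrite mulf_div -!tofracM !fraction_mapE ?mulf_neq0 // !rmorphM mulf_div.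
by rewrite ?tofracM.
Qed.

Lemma fraction_map_zmod : zmod_morphism fraction_map.
Proof.
move=> x y.
have [[n [d [d0 ->]]] [m [e [e0 ->]]]] := (fraction_repr x, fraction_repr y).
rewrite -mulNr addf_div ?tofrac_eq0 // -tofracN -!tofracM -tofracD.
rewrite !fraction_mapE ?mulf_neq0 // -[in RHS]mulNr addf_div ?f_neq0 //.
by rewrite -tofracN -!tofracM -tofracD rmorphD !rmorphM rmorphN.
Qed.

HB.instance Definition _ := GRing.isZmodMorphism.Build {fraction R} {fraction R}
  fraction_map fraction_map_zmod.
HB.instance Definition _ := GRing.isMonoidMorphism.Build {fraction R} {fraction R}
  fraction_map fraction_map_monoid.

Definition fraction_rmorphism : {rmorphism {fraction R} -> {fraction R}} :=
  fraction_map.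
End FractionMorphism.

(** * The regular action on rational functions *)

Section Realization.
Local Open Scope ring_scope.
Variable G : finGroupType.

Let left_mul (g : G) (i : 'I_#|G|) : 'I_#|G| := enum_rank (g * enum_val i)%g.
Let left_mul_inj g : injective (left_mul g).
Proof. by move=> i j /enum_rank_inj/mulgI/enum_val_inj. Qed.
Let left_mul_perm (g : G) : 'S_#|G| := perm (@left_mul_inj g).

Let lperm (g : G) (i : 'I_#|G|) : left_mul_perm g i = enum_rank (g * enum_val i)%g.
Proof. by rewrite permE. Qed.

Local Notation R := {mpoly rat[#|G|]}.
Let act (g : G) : {fraction R} -> {fraction R} :=
  fraction_map (msym (left_mul_perm g)).

Let actE g n d : d != 0 -> act g (FracField.tofrac n / FracField.tofrac d) =
  FracField.tofrac (msym (left_mul_perm g) n)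
    / FracField.tofrac (msym (left_mul_perm g) d).
Proof. exact/fraction_mapE/inj_msym. Qed.

Let act1 x : act 1%g x = x.
Proof.
have [n [d [d0 ->]]] := fraction_repr x.
rewrite actE //; suff -> : left_mul_perm 1%g = 1%g by rewrite !msym1m.
by apply/permP => i; rewrite lperm mul1g enum_valK perm1.
Qed.

Let actM g h x : act (g * h)%g x = act g (act h x).
Proof.
have [n [d [d0 ->]]] := fraction_repr x.
have dh0 : msym (left_mul_perm h) d != 0.
  apply: contraNneq d0 => dh; apply/eqP/(@inj_msym _ _ (left_mul_perm h)).
  by rewrite dh msym0.
rewrite (actE h n d0) (actE g _ dh0) (actE _ n d0).
(* Permutations compose from left to right, whence the reversed product. *)
suff -> : left_mul_perm (g * h)%g = (left_mul_perm h * left_mul_perm g)%g.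
  by rewrite !msymMm.
by apply/permP => i; rewrite permM !lperm enum_rankK mulgA.
Qed.

Let gen : {fraction R} := FracField.tofrac 'X_(enum_rank 1%g).

Let gen_inj : injective (fun g => act g gen).
Proof.
move=> g h.
have actX k : act k gen = FracField.tofrac 'X_(enum_rank k).
  rewrite /gen -[FracField.tofrac _]divr1 -tofrac1 actE ?oner_neq0 //.
  by rewrite msym1 tofrac1 divr1 /msym mmapX mmap1U lperm enum_rankK mulg1.
rewrite !actX => /eqP; rewrite tofrac_eq => /eqP/(congr1 (mcoeff U_(enum_rank g))).
rewrite !mcoeffXU eqxx; case: eqP => [/enum_rank_inj -> // | _ /eqP].
by rewrite oner_eq0.
Qed.

Definition permutation_action : field_action {fraction R} G :=
  @FieldAction _ _ (fun g => fraction_rmorphism (@inj_msym _ _ (left_mul_perm g)))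
    act1 actM gen gen_inj.
End Realization.

Lemma galois_realization (G : finGroupType) :
  exists (K : fieldType) (L : splittingFieldType K) (theta : G -> gal_of {:L}),
    [/\ galois 1 {:L}, bijective theta
      & forall g h x, theta (g * h)%g x = theta g (theta h x)].
Proof. exact: (artin_realization (permutation_action G)). Qed.

(** * Galois descent *)

Lemma linear_bundle (K : fieldType) (U V : lmodType K) (f : U -> V) :
  linear f -> exists g : {linear U -> V}, f =1 g.
Proof.
move=> fl.
by exists (HB.pack_for {linear U -> V} f (GRing.isLinear.Build K U V _ f fl)).
Qed.

Section GaloisTools.
Local Open Scope ring_scope.
Variables (K : fieldType) (L : splittingFieldType K).
Local Notation G := (gal_of {:L}).

(** Automorphisms compose from left to right here, so a bijection onto the Galois group that
    respects composition of maps reverses products; the law of [theta] is therefore stated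
    pointwise. *)
Lemma gal_compE (g h : G) x : (g * h)%g x = h (g x).
Proof. exact: galM (memvf x). Qed.

Lemma gal_eq (g h : G) : g =1 h -> g = h.
Proof. by move=> gh; apply/eqP/gal_eqP => x _. Qed.

Lemma gal_alg (g : G) (k : K) : g k%:A = k%:A.
Proof. by rewrite linearZ rmorph1. Qed.

Lemma gal_free (c : G -> L) : (forall a, \sum_g c g * g a = 0) -> forall g, c g = 0.
Proof. by move=> c0 g; apply: (gal_independent (P := xpredT) (c_ := c)). Qed.

(** The inverse of [k |-> k%:A], meaningful only on [1%VS]. *)
Definition scalar_part (x : L) : K := coord [tuple (1 : L)] ord0 x.

Lemma scalar_partE x : x \in 1%VS -> (scalar_part x)%:A = x.
Proof.
move=> x1; have x_sp : x \in <<[tuple (1%R : L)]>>%VS by rewrite span_seq1.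
by rewrite [RHS](coord_span x_sp) big_ord1.
Qed.

Hypothesis galL : galois 1 {:L}.

Lemma gal_fixed x : (forall g : G, g x = x) -> x \in 1%VS.
Proof.
move=> fx; have /galois_fixedField fixL := galL; rewrite -[1%VS]fixL.
by apply/fixedFieldP; rewrite ?memvf // => g _; apply: fx.
Qed.

(** The matrix of conjugates of a basis [b] has independent rows, by independence of automorphisms;
    [a] is a column of a right inverse. By [dual_expand] the two families are dual for the trace. *)
Lemma dual_system : exists n (a b : 'I_n -> L),
  forall g : G, \sum_i a i * g (b i) = (g == 1%g)%:R.
Proof.
pose b (i : 'I_(\dim {:L})) : L := (vbasis {:L})`_i.
pose M := \matrix_(g < #|{: G}|, i < \dim {:L}) (enum_val g : G) (b i).
have /row_freeP[A MA] : row_free M.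
  apply: inj_row_free => u uM; apply/rowP => k; rewrite mxE.
  have ub i : \sum_(g : G) u 0 (enum_rank g) * g (b i) = 0.
    transitivity ((u *m M) 0 i); last by rewrite uM mxE.
    rewrite mxE [RHS](reindex _ (onW_bij _ (@enum_rank_bij _))) /=.
    by apply: eq_bigr => g _; rewrite mxE enum_rankK.
  rewrite -[k]enum_valK; apply: (@gal_free (fun g => u 0 (enum_rank g))) => x.
  rewrite (coord_vbasis (memvf x)).
  under eq_bigr => g _ do rewrite linear_sum mulr_sumr.
  rewrite exchange_big big1 // => i _ /=.
  under eq_bigr => g _ do rewrite linearZ -scalerAr.
  by rewrite -scaler_sumr [X in _ *: X]ub scaler0.
exists _, (fun i => A i (enum_rank 1%g)), b => g.
have /matrixP/(_ (enum_rank g) (enum_rank 1%g)) := MA.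
rewrite !mxE (inj_eq enum_rank_inj) => <-; apply: eq_bigr => i _.
by rewrite mxE enum_rankK mulrC.
Qed.

Definition trace (x : L) : L := \sum_(g : G) g x.

Lemma trace_gal (g : G) x : g (trace x) = trace x.
Proof.
rewrite rmorph_sum [RHS](reindex_inj (mulIg g)); apply: eq_bigr => h _.
by rewrite gal_compE.
Qed.

Lemma trace_in1 x : trace x \in 1%VS.
Proof. by apply: gal_fixed => g; apply: trace_gal. Qed.

Lemma traceZ k x : trace (k *: x) = k *: trace x.
Proof. by rewrite /trace scaler_sumr; apply: eq_bigr => g _; rewrite linearZ. Qed.

Lemma trace_surj : exists a, trace a = 1.
Proof.
have [a ta] : exists a, trace a != 0.
  have [/forallP t0 | ] :=
    boolP [forall i : 'I_(\dim {:L}), trace (vbasis {:L})`_i == 0]; last first.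
    by rewrite negb_forall => /existsP[i ti]; exists (vbasis {:L})`_i.
  suff /(_ 1%g)/eqP : forall g : G, (1 : L) = 0 by rewrite oner_eq0.
  apply: gal_free => x; rewrite (coord_vbasis (memvf x)).
  under eq_bigr => g _ do rewrite mul1r linear_sum.
  rewrite exchange_big big1 // => i _ /=.
  under eq_bigr => g _ do rewrite linearZ.
  by rewrite -scaler_sumr [X in _ *: X](eqP (t0 i)) scaler0.
exists ((scalar_part (trace a))^-1 *: a).
have ka : scalar_part (trace a) != 0.
  by apply: contraNneq ta => ka; rewrite -(scalar_partE (trace_in1 a)) ka scale0r.
rewrite traceZ.
by rewrite -{2}(scalar_partE (trace_in1 a)) scalerA mulVf // scale1r.
Qed.

(** Apply [l] to the expansion of [x] as the sum of [trace (b i * x)] times [a i]: the traces are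
    scalars, so [l] reaches only the [a i]. *)
Lemma dual_expand n (a b : 'I_n -> L) (l : {linear L -> L}) x :
    (forall g : G, \sum_i a i * g (b i) = (g == 1%g)%:R) ->
  l x = \sum_(g : G) (\sum_i l (a i) * g (b i)) * g x.
Proof.
move=> ab.
have {1}-> : x = \sum_i scalar_part (trace (b i * x)) *: a i.
  transitivity (\sum_(g : G) (\sum_i a i * g (b i)) * g x).
    rewrite (bigD1 1%g) //= ab eqxx mul1r gal_id big1 ?addr0 // => g /negPf g1.
    by rewrite ab g1 mul0r.
  under eq_bigr => g _ do rewrite mulr_suml.
  rewrite exchange_big; apply: eq_bigr => i _ /=.
  rewrite -mulr_algr scalar_partE ?trace_in1 // /trace mulr_sumr.
  by apply: eq_bigr => g _; rewrite rmorphM mulrA.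
rewrite linear_sum; under [RHS]eq_bigr => g _ do rewrite mulr_suml.
rewrite [RHS]exchange_big; apply: eq_bigr => i _ /=.
rewrite linearZ /= -mulr_algr scalar_partE ?trace_in1 // /trace mulr_sumr.
by apply: eq_bigr => g _; rewrite rmorphM mulrA.
Qed.

Lemma end_gal_span (f : L -> L) : linear f ->
  exists d : G -> L, forall x, f x = \sum_g d g * g x.
Proof.
case/linear_bundle=> l fE; have [n [a [b ab]]] := dual_system.
exists (fun g => \sum_i l (a i) * g (b i)) => x.
by rewrite fE (dual_expand l x ab).
Qed.
End GaloisTools.

(** * Spanning families of L-valued forms and their tensor products *)

Section Spanning.
Local Open Scope ring_scope.
Variables (K : fieldType) (L : fieldExtType K).

(** The forms [c^~ x] generate the [L]-space of [K]-linear maps from [U] to [L]. This expresses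
    injectivity of the map from the scalar extension of [U] to functions on [X] without forming that
    extension. *)
Definition spanning (U : vectType K) (X : finType) (c : U -> X -> L) : Prop :=
  forall f : U -> L, linear f -> exists b : X -> L, forall u, f u = \sum_x b x * c u x.

Lemma spanning_inj (U : vectType K) (X : finType) (c : U -> X -> L) u :
  spanning c -> (forall x, c u x = 0) -> u = 0.
Proof.
move=> sc cu; apply: v2r_inj; apply/rowP => i; rewrite linear0 mxE.
have [|b /(_ u)] := sc (fun u => (v2r u 0 i)%:A).
  by move=> a x y; rewrite linearP !mxE scalerDl scalerA.
rewrite big1 => [/eqP|x _]; last by rewrite cu mulr0.
by rewrite scaler_eq0 oner_eq0 orbF => /eqP.
Qed.

Definition tens_coord (U V : vectType K) (X Y : finType) (c : U -> X -> L)
  (d : V -> Y -> L) (t : tensor U V) (xy : X * Y) : L :=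
  tens_lift (fun u v => c u xy.1 * d v xy.2) t.

Section Tens.
Variables (U V : vectType K) (X Y : finType) (c : U -> X -> L) (d : V -> Y -> L).
Hypothesis cl : forall x, linear (c^~ x).
Hypothesis dl : forall y, linear (d^~ y).

Lemma tens_coordE u v x y : tens_coord c d (tens u v) (x, y) = c u x * d v y.
Proof.
rewrite /tens_coord tens_liftE //= => w a z z'.
  by rewrite cl mulrDl scalerAl.
by rewrite dl mulrDr scalerAr.
Qed.

Lemma tens_coord_linear xy : linear (fun t => tens_coord c d t xy).
Proof. by move=> a t t'; rewrite /tens_coord linearP. Qed.

Lemma spanning_tens : spanning c -> spanning d -> spanning (tens_coord c d).
Proof.
move=> sc sd f fl.
have /fin_all_exists[b bE] (j : 'I_(dim V)) : exists b : {ffun X -> L},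
    forall u, f (tens u (stdb j)) = \sum_x b x * c u x.
  have [|b bE] := sc (fun u => f (tens u (stdb j))).
    by move=> a u u'; rewrite tensDl tensZl fl.
  by exists (finfun b) => u; rewrite bE; apply: eq_bigr => x _; rewrite ffunE.
have /fin_all_exists[b' bE'] (j : 'I_(dim V)) : exists b : {ffun Y -> L},
    forall v, (v2r v 0 j)%:A = \sum_y b y * d v y.
  have [|b' bE'] := sd (fun v => (v2r v 0 j)%:A).
    by move=> a u u'; rewrite linearP !mxE scalerDl scalerA.
  by exists (finfun b') => u; rewrite bE'; apply: eq_bigr => x _; rewrite ffunE.
exists (fun xy => \sum_j b j xy.1 * b' j xy.2).
have tE : forall u v, f (tens u v) =
    \sum_xy (\sum_j b j xy.1 * b' j xy.2) * tens_coord c d (tens u v) xy.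
  move=> u v; transitivity (\sum_j v2r v 0 j *: f (tens u (stdb j))).
    have [l fE] := linear_bundle fl; rewrite fE {1}[v]stdb_sum !linear_sum.
    by apply: eq_bigr => j _; rewrite !linearZ fE.
  transitivity (\sum_j (\sum_y b' j y * d v y) * (\sum_x b j x * c u x)).
    by apply: eq_bigr => j _; rewrite -bE' -bE mulr_algl.
  under [RHS]eq_bigr => xy _ do rewrite mulr_suml.
  rewrite [RHS]exchange_big; apply: eq_bigr => j _ /=.
  rewrite -(pair_big xpredT xpredT
    (fun x y => b j x * b' j y * tens_coord c d (tens u v) (x, y))) /=.
  rewrite mulrC mulr_suml; apply: eq_bigr => x _.
  rewrite mulr_sumr; apply: eq_bigr => y _.
  by rewrite tens_coordE mulrACA.
apply: tensP1 => // x y.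
  by have := fl 1 x y; rewrite !scale1r.
rewrite -big_split; apply: eq_bigr => xy _.
by have := tens_coord_linear xy 1 x y; rewrite /= !scale1r => ->; rewrite mulrDr.
Qed.

Lemma tens_coord_inj t t' : spanning c -> spanning d ->
  (forall x y, tens_coord c d t (x, y) = tens_coord c d t' (x, y)) -> t = t'.
Proof.
move=> sc sd tt'; apply/eqP; rewrite -subr_eq0; apply/eqP.
apply: (spanning_inj (spanning_tens sc sd)) => -[x y].
by rewrite /tens_coord linearB; apply/eqP; rewrite subr_eq0; apply/eqP/tt'.
Qed.
End Tens.
End Spanning.

(** * Hopf-Galois structures in coordinates *)

Section Coordinates.
Local Open Scope ring_scope.

(** [cf h n] is the coefficient of [n] in the image of [h] in L[N]. Together [cf_span] and [cf_free]
    say that these forms are an [L]-basis of the [K]-linear maps from [H] to [L]; [cf_comul] says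
    that each [n] is group-like. *)
Record coordinates (K : fieldType) (L : splittingFieldType K) (H : hopfType K)
    (S : hopf_galois L H) (N : finGroupType) (B : brace N) := Coordinates {
  cf : H -> N -> L;
  th : N -> gal_of {:L};
  cf_linear : forall n, linear (cf^~ n);
  cf_mul : forall h k n, cf (h * k) n = \sum_m cf h m * cf k (m^-1 * n)%g;
  cf_one : forall n, cf 1 n = (n == 1%g)%:R;
  cf_comul : forall h m n, tens_coord cf cf (comul h) (m, n) = (m == n)%:R * cf h n;
  cf_counit : forall h, \sum_n cf h n = (counit h : K)%:A;
  cf_antipode : forall h n, cf (antipode h) n = cf h n^-1%g;
  cf_span : spanning cf;
  cf_free : forall b, (forall h, \sum_n b n * cf h n = 0) -> forall n, b n = 0;
  th_bij : bijective th;
  th_circ : forall m n x, th (circ B m n) x = th m (th n x);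
  cf_gal : forall m h n, th m (cf h n) = cf h (B m n);
  cf_act : forall h x, S h x = \sum_n cf h n * th n x }.

Variables (K : fieldType) (L : splittingFieldType K) (H : hopfType K).
Variables (S : hopf_galois L H) (N : finGroupType) (B : brace N).
Variable C : coordinates S B.
Hypothesis galL : galois 1 {:L}.
Local Notation c := (cf C).
Local Notation theta := (th C).

Definition ev (n : N) (h : H) : L := c h n.
HB.instance Definition _ n :=
  GRing.isLinear.Build K H L _ (ev n) (cf_linear C n).

Lemma cf_inj h k : (forall n, c h n = c k n) -> h = k.
Proof.
move=> hk; apply/eqP; rewrite -subr_eq0; apply/eqP/(spanning_inj (cf_span C)) => n.
by rewrite -[LHS]/(ev n _) linearB /= /ev hk subrr.
Qed.

Lemma tens_cf_inj t t' :
  (forall m n, tens_coord c c t (m, n) = tens_coord c c t' (m, n)) -> t = t'.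
Proof.
by move=> tt'; apply: (tens_coord_inj (cf_linear C) (cf_linear C)) => //; apply: cf_span.
Qed.

Lemma cf_gen (F : N -> L) : exists l : 'I_(dim H) -> L,
  forall n, F n = \sum_j l j * c (stdb j) n.
Proof.
pose M := \matrix_(n < #|N|, j < dim H) c (stdb j) (enum_val n).
have /row_freeP[A MA] : row_free M.
  apply: inj_row_free => u uM; apply/rowP => k; rewrite mxE -[k]enum_valK.
  apply: (@cf_free _ _ _ _ _ _ C (fun n => u 0 (enum_rank n))) => h.
  rewrite [h]stdb_sum.
  under eq_bigr => n _ do rewrite -[c _ n]/(ev n _) linear_sum mulr_sumr.
  rewrite exchange_big big1 // => j _ /=.
  under eq_bigr => n _ do rewrite linearZ -scalerAr.
  rewrite -scaler_sumr [X in _ *: X](_ : _ = 0) ?scaler0 //.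
  transitivity ((u *m M) 0 j); last by rewrite uM mxE.
  rewrite mxE [RHS](reindex _ (onW_bij _ (@enum_rank_bij _))) /=.
  by apply: eq_bigr => n _; rewrite mxE enum_rankK.
exists (fun j => \sum_k A j (enum_rank k) * F k) => n.
have MAE k : \sum_j A j (enum_rank k) * c (stdb j) n = (k == n)%:R.
  have /matrixP/(_ (enum_rank n) (enum_rank k)) := MA.
  rewrite !mxE (inj_eq enum_rank_inj) eq_sym => <-; apply: eq_bigr => j _.
  by rewrite mxE enum_rankK mulrC.
transitivity (\sum_k F k * (k == n)%:R).
  rewrite (bigD1 n) //= eqxx mulr1 big1 ?addr0 // => k /negPf->.
  by rewrite mulr0.
under [RHS]eq_bigr => j _ do rewrite mulr_suml.
rewrite [RHS]exchange_big; apply: eq_bigr => k _ /=; rewrite -MAE mulr_sumr.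
by apply: eq_bigr => j _; rewrite mulrCA mulrA.
Qed.

Definition equivariant (F : N -> L) := forall m n, F (B m n) = theta m (F n).

Lemma cf_equivariant h : equivariant (c h).
Proof. by move=> m n; rewrite cf_gal. Qed.

Lemma trace_theta x : trace x = \sum_m theta m x.
Proof. by rewrite /trace (reindex _ (onW_bij _ (th_bij C))). Qed.

(* Galois descent: averaging against an element of trace 1. *)
Lemma descend (I : finType) (a : I -> H) (l : I -> L) (F : N -> L) :
  equivariant F -> (forall n, F n = \sum_i l i * c (a i) n) ->
  exists k : I -> K, forall n, F n = c (\sum_i k i *: a i) n.
Proof.
move=> Feq Fl; have [e te] := trace_surj galL.
exists (fun i => scalar_part (trace (e * l i))) => n.
rewrite -[RHS]/(ev n _) linear_sum -[F n]mul1r -te trace_theta mulr_suml.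
transitivity (\sum_m \sum_i theta m (e * l i) * c (a i) n).
  apply: eq_bigr => m _; have [n' nE] : exists n', n = B m n'.
    by exists (B (circ_inv B m) n); rewrite lam_comp -/(circ B _ _) circVg lam1g.
  rewrite [in LHS]nE Feq -rmorphM Fl mulr_sumr rmorph_sum; apply: eq_bigr => i _.
  by rewrite mulrA rmorphM; congr (_ * _); rewrite nE -cf_gal.
rewrite exchange_big; apply: eq_bigr => i _ /=.
by rewrite linearZ /= -mulr_algl scalar_partE ?trace_in1 // trace_theta mulr_suml.
Qed.

Definition support (A : {vspace H}) : {set N} :=
  [set n | ~~ [forall i : 'I_(\dim A), c (vbasis A)`_i n == 0]].

Lemma supportP (A : {vspace H}) n :
  reflect (exists2 h, h \in A & c h n != 0) (n \in support A).
Proof.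
rewrite inE negb_forall; apply: (iffP existsP) => [[i ci] | [h Ah]].
  by exists (vbasis A)`_i => //; rewrite vbasis_mem ?memt_nth.
move=> hn; apply/existsP; apply: contraR hn => /existsPn ci.
rewrite (coord_vbasis Ah) -[c _ n]/(ev n _).
rewrite linear_sum big1 // => i _; rewrite linearZ /= /ev.
by have := ci i; rewrite negbK => /eqP->; rewrite scaler0.
Qed.

Definition supported (A : {set N}) : {vspace H} :=
  (\bigcap_(n in ~: A) lker (linfun (ev n)))%VS.

Lemma supportedP (A : {set N}) h :
  reflect (forall n, n \notin A -> c h n = 0) (h \in supported A).
Proof.
rewrite memvE; apply: (iffP subv_bigcapP) => hA n An.
  by have := hA n; rewrite inE An -memvE memv_ker lfunE => /(_ isT)/eqP.
by rewrite -memvE memv_ker lfunE /= /ev hA // -in_setC.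
Qed.

(** Restricting an equivariant function to a stable set keeps it equivariant, so the truncation of a
    coordinate vector descends to [H]. *)
Lemma projection (A : {set N}) : (forall g, {in A, forall x, B g x \in A}) ->
  exists P : {linear H -> H}, forall h n, c (P h) n = (n \in A)%:R * c h n.
Proof.
move=> Al; have lamA g x : (B g x \in A) = (x \in A).
  apply/idP/idP => [Agx | /Al //].
  by rewrite -(lam1g B x) -(circgV B g) /circ -lam_comp Al.
have /fin_all_exists[p pE] (j : 'I_(dim H)) :
    exists h, forall n, c h n = (n \in A)%:R * c (stdb j) n.
  pose F n := (n \in A)%:R * c (stdb j) n.
  have Feq : equivariant F.
    by move=> m n; rewrite /F lamA rmorphM rmorph_nat -cf_gal.
  have [l Fl] := cf_gen F; have [k kE] := descend Feq Fl.
  by exists (\sum_i k i *: stdb i) => n; rewrite -kE.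
have Pl : linear (fun h => \sum_j v2r h 0 j *: p j).
  move=> a x y; rewrite scaler_sumr -big_split; apply: eq_bigr => j _.
  by rewrite linearP !mxE scalerDl scalerA.
have [P PE] := linear_bundle Pl; exists P => h n.
rewrite -PE {2}[h]stdb_sum -![c _ n]/(ev n _) !linear_sum mulr_sumr.
by apply: eq_bigr => j _; rewrite !linearZ /= /ev pE scalerAr.
Qed.

Lemma supported_hopf (A : {set N}) : left_ideal B A -> is_hopf_sub (supported A).
Proof.
case=> gA Al; pose A' := group gA; have AE x : (x \in A) = (x \in A') by [].
apply/and4P; split.
- apply/supportedP => n An; rewrite cf_one.
  by case: eqP An => // ->; rewrite AE group1.
- apply/prodvP => h k /supportedP hA /supportedP kA; apply/supportedP => n An.
  rewrite cf_mul big1 // => m _; have [Am | /hA->] := boolP (m \in A); last exact: mul0r.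
  rewrite kA ?mulr0 //; apply: contra An; rewrite !AE.
  by rewrite groupMl // groupV -AE.
- apply/subvP => _ /memv_imgP[h /supportedP hA ->]; rewrite lfunE /=.
  have [P PE] := projection Al.
  have PA x : P x \in supported A.
    by apply/supportedP => n /negPf An; rewrite PE An mul0r.
  (* The coordinates of [comul h] live on the diagonal over [A], so [P] applied to both factors
     changes nothing while landing in the tensors of [supported A]. *)
  have -> : comul h = tens_map P P (comul h).
    have tP t m n : tens_coord c c (tens_map P P t) (m, n)
        = (m \in A)%:R * (n \in A)%:R * tens_coord c c t (m, n).
      move: t; apply: tensP1 => [x y|x y|x y].
      - by rewrite /tens_coord !linearD.
      - by rewrite /tens_coord linearD mulrDr.
      rewrite tens_mapE !(tens_coordE (cf_linear C) (cf_linear C)) !PE.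
      by rewrite mulrACA.
    apply: tens_cf_inj => m n; rewrite tP !cf_comul.
    have [-> | _] := eqVneq m n; last by rewrite mul0r mulr0.
    have [_ | /hA->] := boolP (n \in A); first by rewrite !mul1r.
    by rewrite !mulr0.
  move: (comul h); apply: tensor_ind => [|x y|x y].
  - by rewrite linear0 mem0v.
  - by rewrite linearD; apply: memvD.
  by rewrite tens_mapE memv_tens.
apply/subvP => _ /memv_imgP[h /supportedP hA ->]; rewrite lfunE /=.
apply/supportedP => n An; rewrite cf_antipode hA //.
by apply: contra An; rewrite !AE groupV.
Qed.

(** In coordinates, [h] acts on [x] through its counit exactly when the sum of
    [cf h n * (theta n x - x)] is 0. Running over truncated elements, [cf_free] separates the
    terms. *)
Lemma fixed_supported (A : {set N}) x : left_ideal B A ->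
  (x \in hg_fixed S (supported A)) = [forall n in A, theta n x == x].
Proof.
case=> _ Al; apply/hg_fixedP/forall_inP => [fx n An | fx h /supportedP hA].
  have [P PE] := projection Al.
  pose b n := (n \in A)%:R * (theta n x - x).
  have : b n = 0.
    apply: (@cf_free _ _ _ _ _ _ C b) => h.
    have := fx (P h); rewrite (cf_act C) -mulr_algl -(cf_counit C) mulr_suml => E.
    have PA : P h \in supported A.
      by apply/supportedP => m /negPf Am; rewrite PE Am mul0r.
    move/eqP: (E PA); rewrite -subr_eq0 -sumrB => /eqP E0; rewrite -[RHS]E0.
    apply: eq_bigr => m _; rewrite PE /b -mulrBr mulrAC.
    by rewrite -!mulrA.
  by rewrite /b An mul1r => /eqP; rewrite subr_eq0.
rewrite (cf_act C) -mulr_algl -(cf_counit C) mulr_suml; apply: eq_bigr => n _.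
by have [/fx/eqP-> // | /hA->] := boolP (n \in A); rewrite !mul0r.
Qed.

Lemma support_stable (A : {vspace H}) g n :
  n \in support A -> B g n \in support A.
Proof.
case/supportP=> h Ah hn; apply/supportP; exists h => //.
by rewrite -cf_gal fmorph_eq0.
Qed.

(* Slicing the comultiplication of an element of A that does not vanish at n. *)
Lemma support_delta (A : hopf_sub H) n : n \in support A ->
  exists l : 'I_(\dim A) -> L, forall m, (m == n)%:R = \sum_i l i * c (vbasis A)`_i m.
Proof.
case/supportP=> h Ah hn; have /and4P[_ _ /subvP Ad _] := hopf_subP A.
have {}Ad : comul h \in tensv A A by rewrite -[comul h]lfunE Ad ?memv_img.
suff [l lE] : exists l : 'I_(\dim A) -> L,
    forall m, tens_coord c c (comul h) (m, n) = \sum_i l i * c (vbasis A)`_i m.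
  exists (fun i => (c h n)^-1 * l i) => m.
  under eq_bigr => i _ do rewrite -mulrA.
  by rewrite -mulr_sumr -lE cf_comul mulrCA mulVf ?mulr1.
move: (comul h) Ad; rewrite /tensv => t /(coord_span (X := in_tuple _))->.
pose P t := exists l : 'I_(\dim A) -> L,
  forall m, tens_coord c c t (m, n) = \sum_i l i * c (vbasis A)`_i m.
apply: (big_ind P) => [|x y [k kE] [l lE]|j _].
- exists (fun=> 0) => m; rewrite /tens_coord linear0 big1 // => i _.
  by rewrite mul0r.
- exists (fun i => k i + l i) => m.
  rewrite /tens_coord linearD /= -!/(tens_coord _ _ _ (m, n)).
  by rewrite kE lE -big_split; apply: eq_bigr => i _; rewrite mulrDl.
have /allpairsP[[a b] /= [/vbasis_mem Aa _ ->]] := mem_nth 0 (ltn_ord j).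
move: (coord _ _ _) => q.
exists (fun i => q *: (coord (vbasis A) i a *: c b n)) => m.
rewrite /tens_coord linearZ /= -!/(tens_coord _ _ _ (m, n)).
rewrite (tens_coordE (cf_linear C) (cf_linear C)) {1}(coord_vbasis Aa).
rewrite -[c (\sum_i _) m]/(ev m _) linear_sum mulr_suml scaler_sumr.
by apply: eq_bigr => i _; rewrite linearZ /= /ev -!scalerAl mulrC.
Qed.

(** The indicators of [m] and [n] are [L]-combinations of elements of [A]. Their convolution takes
    the value 1 at [m * n], so some product of two basis elements of [A] is nonzero there. *)
Lemma support_ideal (A : hopf_sub H) : left_ideal B (support A).
Proof.
split=> [|g n]; last exact: support_stable.
have /and4P[A1 /prodvP AM _ _] := hopf_subP A.
apply/group_setP; split=> [|m n].
  by apply/supportP; exists 1 => //; rewrite cf_one eqxx oner_eq0.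
move=> /support_delta[k kE] /support_delta[l lE].
apply/supportP.
have [/forallP c0 | ] := boolP [forall i : 'I_(\dim A), forall j : 'I_(\dim A),
  c ((vbasis A)`_i * (vbasis A)`_j) (m * n)%g == 0]; last first.
  rewrite negb_forall => /existsP[i]; rewrite negb_forall => /existsP[j cij].
  exists ((vbasis A)`_i * (vbasis A)`_j) => //.
  by rewrite AM ?vbasis_mem ?memt_nth.
have : \sum_x (x == m)%:R * (x^-1 * (m * n) == n)%g%:R = 0 :> L.
  under eq_bigr => x _ do rewrite kE lE mulr_suml.
  rewrite exchange_big big1 // => i _ /=.
  under eq_bigr => x _ do rewrite mulr_sumr.
  rewrite exchange_big big1 // => j _ /=.
  under eq_bigr => x _ do rewrite mulrACA.
  rewrite -mulr_sumr -cf_mul.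
  by have /forallP/(_ j)/eqP-> := c0 i; rewrite mulr0.
rewrite (bigD1 m) //= big1 => [|x /negPf->]; last by rewrite mul0r.
by rewrite mulKg !eqxx mulr1 addr0 => /eqP; rewrite oner_eq0.
Qed.

(** All indicators of points of the support lie in the [L]-span of [A], hence so does every [h]
    supported there; [descend] makes the coefficients lie in [K]. *)
Lemma supported_support (A : hopf_sub H) : supported (support A) = A.
Proof.
apply/eqP; rewrite eqEsubv; apply/andP; split; last first.
  apply/subvP => h Ah; apply/supportedP => n.
  by apply: contraNeq => hn; apply/supportP; exists h.
apply/subvP => h /supportedP hA.
have [l lE] : exists l : 'I_(\dim A) -> L,
    forall n, c h n = \sum_i l i * c (vbasis A)`_i n.
  have /fin_all_exists[l lE] (m : N) : exists l : {ffun 'I_(\dim A) -> L},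
      forall n, c h m * (n == m)%:R = \sum_i l i * c (vbasis A)`_i n.
    have [/support_delta[l lE] | /hA->] := boolP (m \in support A).
      exists [ffun i => c h m * l i] => n; rewrite lE mulr_sumr.
      by apply: eq_bigr => i _; rewrite ffunE mulrA.
    exists [ffun=> 0] => n; rewrite mul0r big1 // => i _.
    by rewrite ffunE mul0r.
  exists (fun i => \sum_m l m i) => n.
  under [RHS]eq_bigr => i _ do rewrite mulr_suml.
  rewrite exchange_big /= -(eq_bigr _ (fun m _ => lE m n)) (bigD1 n) //=.
  rewrite eqxx mulr1 big1 ?addr0 // => m; rewrite eq_sym => /negPf->.
  by rewrite mulr0.
have [k kE] := descend (cf_equivariant h) lE.
rewrite (cf_inj kE); apply: memv_suml => i _.
by rewrite memvZ // vbasis_mem ?memt_nth.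
Qed.

Lemma theta1 : theta 1%g = 1%g.
Proof.
apply/gal_eq => x; rewrite gal_id.
have e : theta 1%g (theta 1%g x) = theta 1%g x by rewrite -th_circ circ1g.
exact: (fmorph_inj _ e).
Qed.

Lemma theta_group (A : {set N}) : circ_subgroup B A -> group_set (theta @: A).
Proof.
case=> A1 AM; apply/group_setP; split=> [|_ _ /imsetP[m Am ->] /imsetP[n An ->]].
  by apply/imsetP; exists 1%g; rewrite ?theta1.
apply/imsetP; exists (circ B n m); first exact: AM.
by apply/gal_eq => x; rewrite gal_compE th_circ.
Qed.

Lemma fixed_theta_inj (A A' : {set N}) :
    circ_subgroup B A -> circ_subgroup B A' ->
    (forall x, [forall n in A, theta n x == x] = [forall n in A', theta n x == x]) ->
  A = A'.
Proof.
move=> /theta_group gA /theta_group gA' AA'.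
have fixE (D : {set N}) x :
    (x \in fixedField (theta @: D)) = [forall n in D, theta n x == x].
  apply/(fixedFieldP (memvf x))/forall_inP => [fx n Dn | fx _ /imsetP[n Dn ->]].
    by apply/eqP/fx/imset_f.
  exact/eqP/fx.
apply: (imset_inj (bij_inj (th_bij C))).
rewrite -[theta @: A]/(group gA : {set _}) -[theta @: A']/(group gA' : {set _}).
rewrite -(gal_fixedField (group gA)) -(gal_fixedField (group gA')).
congr 'Gal(_ / _)%g; apply/vspaceP => x.
by rewrite /= !fixE.
Qed.

Lemma correspondence_fixed (A : hopf_sub H) x :
  (x \in hg_correspondence S A) = [forall n in support A, theta n x == x].
Proof.
by rewrite -fixed_supported ?supported_support //; apply: support_ideal.
Qed.

Lemma fixed_preim (F : {subfield L}) x :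
  [forall n in theta @^-1: 'Gal({:L} / F)%g, theta n x == x] = (x \in F).
Proof.
have [f fK Kf] := th_bij C.
have /galois_fixedField fixF : galois F {:L}.
  by apply: galoisS galL; rewrite sub1v subvf.
rewrite -[in RHS]fixF; apply/forall_inP/(fixedFieldP (memvf x)) => [fx g gF | fx n].
  by apply/eqP; rewrite -(Kf g) fx // inE Kf.
by rewrite inE => nF; apply/eqP/fx.
Qed.

Theorem coordinates_criterion : bijective (hg_correspondence S) <-> all_ideals B.
Proof.
split=> [[f fK Kf] A cA | idB].
  (* The Hopf subalgebra attached to this fixed field has a left ideal as support, and equal fixed
     fields force that support to be [A]. *)
  pose F : {subfield L} := fixedField_aspace (theta @: A).
  have := support_ideal (f F); suff -> : support (f F) = A by [].
  apply: fixed_theta_inj (left_ideal_circ (support_ideal _)) cA _ => x.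
  rewrite -correspondence_fixed Kf.
  apply/(fixedFieldP (memvf x))/forall_inP => [fx n An | fx _ /imsetP[n An ->]].
    by apply/eqP/fx/imset_f.
  exact/eqP/fx.
have idF (F : {subfield L}) : left_ideal B (theta @^-1: 'Gal({:L} / F)%g).
  apply: idB; split=> [|m n]; rewrite !inE.
    by rewrite theta1 group1.
  move=> mF nF; suff -> : theta (circ B m n) = (theta n * theta m)%g by rewrite groupM.
  by apply/gal_eq => x; rewrite gal_compE th_circ.
exists (fun F => HopfSub (supported_hopf (idF F))) => [A | F].
  apply: val_inj => /=; rewrite -[RHS]supported_support; congr supported.
  have idA := left_ideal_circ (idF (hg_correspondence S A)).
  apply: (fixed_theta_inj idA (left_ideal_circ (support_ideal A))) => x.
  by rewrite fixed_preim correspondence_fixed.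
apply: val_inj => /=; apply/vspaceP => x.
by rewrite fixed_supported // fixed_preim.
Qed.
End Coordinates.

(** * The operations of a group algebra in coefficients *)

Section GroupAlgebraCoordinates.
Local Open Scope ring_scope.
Variables (F : fieldType) (N : finGroupType).
Implicit Types x y : group_algebra F N.

Lemma galg_mulE_coord x y n : (x * y) n = \sum_m x m * y (m^-1 * n)%g.
Proof.
rewrite -[x * y]/(galg_mul x y) /galg_mul /galg_lift sum_ffunE.
apply: eq_bigr => m _; rewrite !ffunE sum_ffunE; congr (_ * _).
rewrite (bigD1 (m^-1 * n)%g) //= big1 => [|k /negPf kn].
  by rewrite !ffunE mulKVg eqxx addr0 [LHS]mulr1.
by rewrite !ffunE -(inj_eq (mulgI m^-1%g)) mulKg eq_sym kn [LHS]mulr0.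
Qed.

Lemma galg_counit_coord x : galg_counit x = \sum_n x n.
Proof. by apply: eq_bigr => n _; rewrite -[LHS]/(_ * _) mulr1. Qed.

Lemma galg_antipode_coord x n : galg_antipode x n = x n^-1%g.
Proof.
rewrite /galg_antipode /galg_lift sum_ffunE (bigD1 n^-1%g) //= big1.
  by rewrite !ffunE invgK eqxx addr0 [LHS]mulr1.
move=> k /negPf kn.
by rewrite !ffunE -(inj_eq invg_inj) invgK eq_sym kn [LHS]mulr0.
Qed.

Lemma galg_comul_coord x m n :
  tens_lift (fun u v : group_algebra F N => u m * v n : F^o) (galg_comul x)
    = (m == n)%:R * x n.
Proof.
have ul (v : group_algebra F N) : linear (fun u : group_algebra F N => u m * v n : F^o).
  by move=> a u u'; rewrite !ffunE mulrDl -[a *: u m]/(a * _) -mulrA.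
have vl (u : group_algebra F N) : linear (fun v : group_algebra F N => u m * v n : F^o).
  by move=> a v v'; rewrite !ffunE mulrDr -[a *: v n]/(a * _) mulrCA.
rewrite /galg_comul /galg_lift linear_sum (bigD1 n) //= big1 => [|k /negPf kn].
  rewrite linearZ /= tens_liftE // !ffunE eqxx mulr1 addr0.
  by rewrite -[LHS]/(_ * _) mulrC.
rewrite linearZ /= tens_liftE // !ffunE [n == k]eq_sym kn mulr0.
by rewrite -[LHS]/(_ * _) mulr0.
Qed.
End GroupAlgebraCoordinates.

(** * From a structure of type N to a skew brace *)

Section OfType.
Local Open Scope ring_scope.
Variables (K : fieldType) (L : splittingFieldType K) (H : hopfType K).
Variables (S : hopf_galois L H) (N : finGroupType).
Variable f : {lrmorphism scalar_ext L H -> group_algebra L N}.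
Variable g : group_algebra L N -> scalar_ext L H.
Hypothesis fK : cancel f g.
Hypothesis gK : cancel g f.
Hypothesis fH : hopf_morphism f.

Let c (h : H) (n : N) : L := (f (sext_in L h) : group_algebra L N) n.

Let c_linear n : linear (c^~ n).
Proof.
move=> a h k; rewrite /c sext_inD sext_inZ linearP !ffunE; congr (_ + _).
by rewrite -[LHS]/(_ * _) mulr_algl.
Qed.

Let c_mul h k n : c (h * k) n = \sum_m c h m * c k (m^-1 * n)%g.
Proof. by rewrite /c sext_inM rmorphM galg_mulE_coord. Qed.

Let c_one n : c 1 n = (n == 1%g)%:R.
Proof.
by rewrite /c -[sext_in L 1]/(1 : scalar_ext L H) rmorph1 -gelt1 ffunE.
Qed.

Let c_counit h : \sum_n c h n = (counit h : K)%:A.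
Proof.
have [_ fe _] := fH; rewrite -galg_counit_coord.
by rewrite -sext_counitE; apply: (fe (sext_in L h)).
Qed.

Let c_antipode h n : c (antipode h) n = c h n^-1%g.
Proof.
have [_ _ fS] := fH; rewrite /c -sext_antipodeE -galg_antipode_coord.
by have := fS (sext_in L h) => /(congr1 (fun x : group_algebra L N => x n)).
Qed.

Let c_comul h m n : tens_coord c c (comul h) (m, n) = (m == n)%:R * c h n.
Proof.
have [fD _ _] := fH; rewrite -galg_comul_coord.
have -> : galg_comul (f (sext_in L h)) = tens_map f f (sext_in2 L (comul h)).
  by rewrite -sext_comulE; apply: (fD (sext_in L h)).
move: (comul h); apply: tensP1 => [u v|u v|a b].
- by rewrite /tens_coord linearD.
- by rewrite sext_in2D !linearD.
rewrite tens_coordE // sext_in2E tens_mapE tens_liftE //.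
  by move=> v a' u u'; rewrite !ffunE mulrDl -[a' *: u m]/(a' * _) -mulrA.
by move=> u a' v v'; rewrite !ffunE mulrDr -[a' *: v n]/(a' * _) mulrCA.
Qed.

(* The coefficients of a K-linear form H -> L on the basis of coordinate forms. *)
Let ext (phi : H -> L) (n : N) : L :=
  sext_lift (phi : H -> L^o) (g (gelt L n)).

Let ext_linear (phi : H -> L) : linear phi ->
  linear (sext_lift (L := L) (phi : H -> L^o)).
Proof.
move=> phil; apply: sext_lift_linear => a x y /=.
by rewrite phil -[X in _ = X + _]/(_ * _) mulr_algl.
Qed.

Let extE phi h : linear phi -> phi h = \sum_n ext phi n * c h n.
Proof.
move=> phil; have [psi psiE] := linear_bundle (ext_linear phil).
have -> : phi h = psi (sext_in L h).
  rewrite -psiE sext_liftE0 ?scale1r // => a x y /=.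
  by rewrite phil -[X in _ = X + _]/(_ * _) mulr_algl.
have -> : sext_in L h = \sum_n c h n *: g (gelt L n).
  apply: (can_inj fK); rewrite linear_sum [LHS]galg_sum; apply: eq_bigr => n _.
  by rewrite linearZ /= gK.
rewrite linear_sum; apply: eq_bigr => n _.
by rewrite linearZ /= -psiE -[LHS]/(_ * _) mulrC.
Qed.

Let c_span : spanning c.
Proof. by move=> phi phil; exists (ext phi) => h; apply: extE. Qed.

Let c_free b : (forall h, \sum_n b n * c h n = 0) -> forall n, b n = 0.
Proof.
move=> b0 n.
have ul : linear (fun t : scalar_ext L H =>
    \sum_k b k * (f t : group_algebra L N) k : L^o).
  move=> a x y; rewrite scaler_sumr -big_split; apply: eq_bigr => k _ /=.
  by rewrite linearP !ffunE mulrDr -[a *: _]/(a * _) mulrCA.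
have [psi psiE] := linear_bundle ul.
have z : linear (fun _ : scalar_ext L H => 0 : L^o).
  by move=> a x y; rewrite scaler0 addr0.
have [zero zeroE] := linear_bundle z.
have /(_ (g (gelt L n))) : psi =1 zero.
  by apply: sextP => h; rewrite -psiE -zeroE b0.
rewrite -psiE -zeroE gK (bigD1 n) //= ffunE eqxx mulr1 big1 ?addr0 // => k /negPf kn.
by rewrite ffunE kn mulr0.
Qed.

Let c_sep m m' : (forall h, c h m = c h m') -> m = m'.
Proof.
move=> mm'; apply/eqP; apply: contraT => /negPf nmm'.
suff : (m == m)%:R - (m == m')%:R = 0 :> L.
  by rewrite eqxx nmm' subr0 => /eqP; rewrite oner_eq0.
apply: (c_free (b := fun n => (n == m)%:R - (n == m')%:R)) => h.
under eq_bigr => n _ do rewrite mulrBl.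
rewrite sumrB (bigD1 m) //= [X in _ - X](bigD1 m') //= !eqxx !mul1r mm'.
by rewrite !big1 ?addr0 ?subrr // => n /negPf->; rewrite mul0r.
Qed.

Let act_n (n : N) (x : L) : L := ext (fun h => S h x) n.

Let act_nE h x : S h x = \sum_n c h n * act_n n x.
Proof.
rewrite (extE (phi := fun h => S h x)) => [|a u v].
  by apply: eq_bigr => n _; rewrite mulrC.
by rewrite linearP add_lfunE scale_lfunE.
Qed.

Let c_free_eq (b b' : N -> L) :
  (forall h, \sum_n c h n * b n = \sum_n c h n * b' n) -> b =1 b'.
Proof.
move=> bb' n; apply/eqP; rewrite -subr_eq0; apply/eqP.
apply: (c_free (b := fun n => b n - b' n)) => h.
under eq_bigr => k _ do rewrite mulrC mulrBr.
by rewrite sumrB bb' subrr.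
Qed.

Let act_n_linear n : linear (act_n n).
Proof.
move=> a x y; apply: (c_free_eq (b := fun n => act_n n (a *: x + y))
  (b' := fun n => a *: act_n n x + act_n n y)) => h.
rewrite -act_nE linearP /= !act_nE scaler_sumr -big_split; apply: eq_bigr => k _ /=.
by rewrite mulrDr scalerAr.
Qed.

Let act_n1 n : act_n n 1 = 1.
Proof.
apply: (c_free_eq (b := act_n^~ 1) (b' := fun=> 1)) => h.
by rewrite -act_nE hg_unit -c_counit; apply: eq_bigr => k _; rewrite mulr1.
Qed.

(** Since [comul] is diagonal in the coordinates, comparing coefficients in [hg_mul] makes each
    [act_n n] multiplicative, hence an automorphism of [L]. *)
Let act_nM n x y : act_n n (x * y) = act_n n x * act_n n y.
Proof.
apply: (c_free_eq (b := act_n^~ (x * y)) (b' := fun n => act_n n x * act_n n y)) => h.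
rewrite -act_nE hg_mul.
have -> : tens_lift (fun h1 h2 => S h1 x * S h2 y) (comul h) =
    \sum_m \sum_n tens_coord c c (comul h) (m, n) * (act_n m x * act_n n y).
  move: (comul h); apply: tensP1 => [u v|u v|a b].
  - by rewrite linearD.
  - rewrite -big_split; apply: eq_bigr => m _; rewrite -big_split.
    by apply: eq_bigr => k _; rewrite /tens_coord linearD mulrDl.
  rewrite tens_liftE => [|v k u u'|u k v v'].
  - rewrite !act_nE mulr_suml; apply: eq_bigr => m _; rewrite mulr_sumr.
    by apply: eq_bigr => k _; rewrite tens_coordE // mulrACA.
  - by rewrite linearP add_lfunE scale_lfunE mulrDl scalerAl.
  by rewrite linearP add_lfunE scale_lfunE mulrDr scalerAr.
apply: eq_bigr => m _; rewrite (bigD1 m) //= c_comul eqxx mul1r big1 ?addr0 //.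
by move=> k /negPf km; rewrite c_comul eq_sym km !mul0r.
Qed.

Let gal_of_n n : {s : gal_of {:L} | forall x, s x = act_n n x}.
Proof.
pose l := HB.pack_for {linear L -> L} (act_n n)
  (GRing.isLinear.Build K L L _ (act_n n) (act_n_linear n)).
have : kAut 1 {:L} (linfun l).
  rewrite kAutfE; apply/kHom_monoid_morphism; split=> [|x y].
    by rewrite lfunE; apply: act_n1.
  by rewrite !lfunE; apply: act_nM.
case/kAut_to_gal=> s _ sE; exists s => y.
by rewrite -sE ?memvf // lfunE.
Qed.

Let theta n : gal_of {:L} := sval (gal_of_n n).

Let thetaE n x : theta n x = act_n n x.
Proof. exact: (svalP (gal_of_n n)). Qed.

Let S_theta h x : S h x = \sum_n c h n * theta n x.
Proof. by rewrite act_nE; apply: eq_bigr => n _; rewrite thetaE. Qed.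

Local Notation Theta :=
  (tens_lift (fun (l : L) (h : H) => (amull l \o S h)%VF) : tensor L H -> 'End(L)).

Let ThetaE (t : tensor L H) x :
  Theta t x = \sum_n (f (t : scalar_ext L H) : group_algebra L N) n * theta n x.
Proof.
move: t; apply: tensP1 => [u v|u v|l h].
- by rewrite linearD add_lfunE.
- rewrite rmorphD -big_split; apply: eq_bigr => n _ /=.
  by rewrite ffunE mulrDl.
rewrite tens_liftE => [|v k u u'|u k v v'].
- rewrite comp_lfunE lfunE /= S_theta mulr_sumr; apply: eq_bigr => n _.
  by rewrite sext_inE linearZ /= ffunE mulrA.
- apply/lfunP => y; rewrite add_lfunE scale_lfunE !comp_lfunE !lfunE /=.
  by rewrite mulrDl scalerAl.
apply/lfunP => y; rewrite add_lfunE scale_lfunE !comp_lfunE !lfunE /= linearP.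
by rewrite add_lfunE scale_lfunE mulrDr scalerAr.
Qed.

Let Theta_gelt n x : Theta (g (gelt L n)) x = theta n x.
Proof.
rewrite ThetaE gK (bigD1 n) //= ffunE eqxx mul1r big1 ?addr0 // => k /negPf kn.
by rewrite ffunE kn mul0r.
Qed.

Let theta_inj : injective theta.
Proof.
move=> m n mn; have := bij_inj (hg_bij S).
move=> /(_ (g (gelt L m)) (g (gelt L n))) e.
have /e/(can_inj gK)/ffunP/(_ m) : Theta (g (gelt L m)) = Theta (g (gelt L n)).
  by apply/lfunP => x; rewrite !Theta_gelt mn.
by rewrite !ffunE eqxx; case: eqP => // _ /eqP; rewrite oner_eq0.
Qed.

(** The preimage of [s] under the bijection onto End(L) writes [s] as an [L]-combination of the
    [theta n]; independence of automorphisms forces [s] to be one of them. *)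
Let theta_surj s : exists n, theta n = s.
Proof.
have [T' _ T'K] := hg_bij S; pose t := T' (s : 'End(L)).
suff /existsP[n /eqP nE] : [exists n, theta n == s] by exists n.
apply: contraT => /existsPn ns.
pose d (r : gal_of {:L}) : L :=
  \sum_(n | theta n == r) (f (t : scalar_ext L H) : group_algebra L N) n - (r == s)%:R.
have : d s = 0.
  apply: gal_free => x; rewrite /d.
  under eq_bigr => r _ do rewrite mulrBl mulr_suml.
  rewrite sumrB; apply/eqP; rewrite subr_eq0; apply/eqP.
  transitivity (Theta t x); last first.
    rewrite T'K (bigD1 s) //= eqxx mul1r big1 ?addr0 // => r /negPf->.
    by rewrite mul0r.
  rewrite ThetaE (partition_big theta xpredT) //=.
  by apply: eq_bigr => r _; apply: eq_bigr => n /eqP->.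
rewrite /d big1 => [/eqP|n ns']; last by have := ns n; rewrite ns'.
by rewrite eqxx sub0r oppr_eq0 oner_eq0.
Qed.

Let theta_bij : bijective theta.
Proof.
have t_surj s : exists n, theta n == s.
  by have [n <-] := theta_surj s; exists n.
have tK s : theta (xchoose (t_surj s)) = s by apply/eqP/(xchooseP (t_surj s)).
by exists (fun s => xchoose (t_surj s)) => [n | //]; apply: theta_inj.
Qed.

(* The twist of a coordinate form by a Galois automorphism is a sum of
   coordinate forms, by orthogonality of idempotents in the convolution
   algebra Hom_K(H, L), hence again a coordinate form. *)
Let gal_coord (s : gal_of {:L}) n : exists m, forall h, s (c h n) = c h m.
Proof.
have sl k : linear (fun h => s (c h k)).
  by move=> a u v; rewrite /= c_linear linearP.
pose M k m := ext (fun h => s (c h k)) m.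
have ME k h : s (c h k) = \sum_m c h m * M k m.
  by rewrite (extE h (sl k)); apply: eq_bigr => m _; rewrite mulrC.
have M_orth k l m : M k m * M l m = (k == l)%:R * M k m.
  apply: (c_free_eq (b := fun m => M k m * M l m)
    (b' := fun m => (k == l)%:R * M k m)) => h.
  transitivity (s (tens_coord c c (comul h) (k, l))); last first.
    rewrite c_comul rmorphM rmorph_nat; have [<- | _] := eqVneq k l.
      by rewrite mul1r [LHS](ME k h); apply: eq_bigr => x _; rewrite mul1r.
    by rewrite mul0r big1 // => x _; rewrite mul0r mulr0.
  transitivity (\sum_x \sum_y tens_coord c c (comul h) (x, y) * (M k x * M l y)).
    apply: eq_bigr => x _; rewrite (bigD1 x) //= c_comul eqxx mul1r big1 ?addr0 //.
    by move=> y /negPf yx; rewrite c_comul eq_sym yx !mul0r.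
  move: (comul h); apply: tensP1 => [u v|u v|a b].
  - rewrite -big_split; apply: eq_bigr => x _; rewrite -big_split.
    by apply: eq_bigr => y _; rewrite /tens_coord linearD mulrDl.
  - by rewrite /tens_coord !linearD.
  rewrite tens_coordE // rmorphM [X in X * _](ME k a) [X in _ * X](ME l b).
  rewrite mulr_suml; apply: eq_bigr => x _.
  by rewrite mulr_sumr; apply: eq_bigr => y _; rewrite tens_coordE // mulrACA.
have M_sum m : \sum_k M k m = 1.
  apply: (c_free_eq (b := fun m => \sum_k M k m) (b' := fun=> 1)) => h.
  under eq_bigr => x _ do rewrite mulr_sumr.
  rewrite exchange_big /=; under eq_bigr => k _ do rewrite -ME.
  rewrite -rmorph_sum c_counit [LHS]gal_alg -c_counit.
  by apply: eq_bigr => k _; rewrite mulr1.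
have M01 k m : M k m = 0 \/ M k m = 1.
  have := M_orth k k m; rewrite eqxx mul1r => /eqP; rewrite -subr_eq0.
  rewrite -{3}[M k m]mulr1 -mulrBr mulf_eq0 subr_eq0.
  by case/orP=> /eqP; [left | right].
have /fin_all_exists[sg sgE] (m : N) : exists k, M k m = 1.
  suff /existsP[k /eqP kE] : [exists k, M k m == 1] by exists k.
  apply: contraT => /existsPn nk; have := M_sum m.
  rewrite big1 => [/esym/eqP|k _]; first by rewrite oner_eq0.
  by have [// | k1] := M01 k m; have := nk k; rewrite k1 eqxx.
have M_delta k m : M k m = (k == sg m)%:R.
  have [-> // | ksg] := eqVneq k (sg m).
  by have := M_orth k (sg m) m; rewrite sgE mulr1 (negPf ksg) mul0r.
(* An index missed by [sg] would make the form [c^~ k] vanish, against freeness. *)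
have sg_surj k : exists m, sg m == k.
  apply/existsP; apply: contraT => /existsPn nk.
  have ck0 h : c h k = 0.
    apply: (fmorph_inj s); rewrite rmorph0 [LHS](ME k h) big1 // => m _.
    by rewrite M_delta eq_sym (negPf (nk m)) mulr0.
  suff /(_ k)/eqP : forall m, (m == k)%:R = 0 :> L by rewrite eqxx oner_eq0.
  apply: (c_free (b := fun m => (m == k)%:R)) => h.
  by rewrite (bigD1 k) //= ck0 mulr0 big1 ?addr0 // => m /negPf->; rewrite mul0r.
have sg_inj : injective sg.
  have tK k : sg (xchoose (sg_surj k)) = k by apply/eqP/(xchooseP (sg_surj k)).
  by apply: bij_inj; apply: (bij_can_bij _ tK); apply: injF_bij; apply: can_inj tK.
exists (xchoose (sg_surj n)) => h; have /eqP sgn := xchooseP (sg_surj n).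
rewrite ME (bigD1 (xchoose (sg_surj n))) //= M_delta sgn eqxx mulr1 big1 ?addr0 //.
by move=> m mn; rewrite M_delta -{1}sgn (inj_eq sg_inj) eq_sym (negPf mn) mulr0.
Qed.

Lemma c_free_perm (p : N -> N) (b b' : N -> L) : injective p ->
  (forall h, \sum_n c h (p n) * b n = \sum_n c h (p n) * b' n) -> b =1 b'.
Proof.
move=> p_inj bb' n; rewrite -(invF_f p_inj n).
apply: (c_free_eq (b := fun m => b (invF p_inj m))
  (b' := fun m => b' (invF p_inj m))) => h.
rewrite [LHS](reindex_inj p_inj) [RHS](reindex_inj p_inj) /=.
under eq_bigr => m _ do rewrite invF_f.
by under [RHS]eq_bigr => m _ do rewrite invF_f.
Qed.

Theorem coordinates_of_type : exists B : brace N, inhabited (coordinates S B).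
Proof.
have /fin_all_exists[pi piE] (s : gal_of {:L}) :
    exists p : {ffun N -> N}, forall n h, s (c h n) = c h (p n).
  have /fin_all_exists[p pE] := gal_coord s.
  by exists (finfun p) => n h; rewrite ffunE.
have pi_inj s : injective (pi s).
  move=> m n mn; apply: c_sep => h; apply: (fmorph_inj s).
  by rewrite [LHS]piE [RHS]piE mn.
have piM s : {morph pi s : x y / (x * y)%g}.
  move=> x y.
  have key k m : c k (pi s (m^-1 * (x * y)))%g = c k ((pi s m)^-1 * pi s (x * y))%g.
    apply: (c_free_perm (p := pi s) (b := fun m => c k (pi s (m^-1 * (x * y)))%g)
      (b' := fun m => c k ((pi s m)^-1 * pi s (x * y))%g)) => // h.
    transitivity (c (h * k) (pi s (x * y)%g)).
      rewrite -piE c_mul rmorph_sum; apply: eq_bigr => n _.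
      by rewrite rmorphM; congr (_ * _); apply/esym/piE.
    by rewrite c_mul (reindex_inj (pi_inj s)).
  have : pi s y = ((pi s x)^-1 * pi s (x * y))%g.
    by apply: c_sep => k; rewrite -key mulKg.
  by move=> ->; rewrite mulKVg.
(* The coefficients of [S (h * k) = S h \o S k] are compared first in [h], then in [k]. *)
have thetaM m n x : theta (m * pi (theta m) n)%g x = theta m (theta n x).
  have key k y m' : \sum_p c k (pi (theta m') p) * theta (m' * pi (theta m') p)%g y
      = \sum_p c k (pi (theta m') p) * theta m' (theta p y).
    transitivity (\sum_p c k p * theta (m' * p)%g y).
      by rewrite [RHS](reindex_inj (pi_inj (theta m'))).
    transitivity (theta m' (S k y)); last first.
      rewrite S_theta rmorph_sum; apply: eq_bigr => p _.
      by rewrite rmorphM; congr (_ * _); apply: piE.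
    apply: (c_free_eq (b := fun m => \sum_p c k p * theta (m * p)%g y)
      (b' := fun m => theta m (S k y))) => h.
    rewrite -S_theta -comp_lfunE -hg_actM S_theta.
    under [RHS]eq_bigr => r _ do rewrite c_mul mulr_suml.
    rewrite [RHS]exchange_big; apply: eq_bigr => r _ /=; rewrite mulr_sumr.
    rewrite [RHS](reindex_inj (mulgI r)); apply: eq_bigr => p _.
    by rewrite mulKg mulrA.
  apply: (c_free_perm (p := pi (theta m)) (b := fun p => theta (m * pi (theta m) p)%g x)
    (b' := fun p => theta m (theta p x))) => // k.
pose lam m := pi (theta m) : N -> N.
(* Both sides describe how the composite of [theta p] after [theta q] permutes the coordinate
   forms. *)
have lam_comp p q x : lam p (lam q x) = lam (p * lam p q)%g x.
  by apply: c_sep => h; rewrite /lam -!piE thetaM.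
pose B := @Brace N lam (fun m => piM (theta m)) lam_comp (fun m => pi_inj (theta m)).
exists B; constructor.
by exists c theta => // [m h n]; rewrite ?piE.
Qed.
End OfType.

(** * The Hopf-Galois structure of a skew brace *)

Section Construction.
Local Open Scope ring_scope.

(** The dual families and the element of trace 1 are kept as data because the comultiplication and
    the inverse maps below are defined by formulas in them. *)
Record realization (K : fieldType) (L : splittingFieldType K)
    (N : finGroupType) (B : brace N) := Realization {
  rth : N -> gal_of {:L};
  r_galois : galois 1 {:L};
  r_bij : bijective rth;
  r_circ : forall m n x, rth (circ B m n) x = rth m (rth n x);
  r_dim : nat;
  r_a : 'I_r_dim -> L;
  r_b : 'I_r_dim -> L;
  r_dual : forall s : gal_of {:L}, \sum_i r_a i * s (r_b i) = (s == 1%g)%:R;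
  r_e : L;
  r_trace : trace r_e = 1 }.

Variables (K : fieldType) (L : splittingFieldType K) (N : finGroupType).
Variables (B : brace N) (R : realization L B).
Local Notation th := (rth R).
Local Notation ra := (@r_a _ _ _ _ R).
Local Notation rb := (@r_b _ _ _ _ R).

Lemma r_th1 x : th 1%g x = x.
Proof.
have e : th 1%g (th 1%g x) = th 1%g x by rewrite -r_circ circ1g.
exact: (fmorph_inj _ e).
Qed.

Lemma r_trace_th : \sum_m th m (r_e R) = 1.
Proof. by rewrite -(r_trace R) /trace (reindex _ (onW_bij _ (r_bij R))). Qed.

Lemma r_free (d : N -> L) : (forall x, \sum_m d m * th m x = 0) -> forall m, d m = 0.
Proof.
have [f fK Kf] := r_bij R => d0 m; rewrite -(fK m).
apply: (gal_free (c := fun s => d (f s))) => x.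
rewrite (reindex _ (onW_bij _ (r_bij R))) -[RHS](d0 x).
by apply: eq_bigr => k _; rewrite fK.
Qed.

Lemma r_end_span (f : L -> L) : linear f ->
  exists d : N -> L, forall x, f x = \sum_m d m * th m x.
Proof.
case/(end_gal_span (r_galois R)) => d fE; exists (fun m => d (th m)) => x.
by rewrite fE (reindex _ (onW_bij _ (r_bij R))).
Qed.

Lemma r_dual_th m n : \sum_i th m (ra i) * th n (rb i) = (m == n)%:R.
Proof.
pose s := (th n * (th m)^-1)%g.
have sE x : th m (s x) = th n x by rewrite -gal_compE /s mulgKV.
under eq_bigr => i _ do rewrite -sE.
have -> : (m == n)%:R = th m (s == 1%g)%:R.
  by rewrite rmorph_nat -eq_mulgV1 (inj_eq (bij_inj (r_bij R))) eq_sym.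
by rewrite -(r_dual R s) rmorph_sum; apply: eq_bigr => i _; rewrite rmorphM.
Qed.

Definition twist_op (m : N) (F : {ffun N -> L}) : {ffun N -> L} :=
  [ffun n => F (B m n) - th m (F n)].
Fact twist_op_linear m : linear (twist_op m).
Proof.
move=> a F F'; apply/ffunP => n; rewrite !ffunE linearP scalerBr.
by rewrite opprD addrACA.
Qed.
HB.instance Definition _ m := GRing.isLinear.Build K {ffun N -> L} {ffun N -> L} _
  (twist_op m) (twist_op_linear m).

(* The fixed points of the semilinear action of the circle group on L[N]. *)
Definition equivariants : {vspace {ffun N -> L}} :=
  (\bigcap_(m : N) lker (linfun (twist_op m)))%VS.

Lemma equivariantsP (F : {ffun N -> L}) :
  reflect (forall m n, F (B m n) = th m (F n)) (F \in equivariants).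
Proof.
rewrite memvE; apply: (iffP subv_bigcapP) => [FE m n | FE m _].
  have := FE m isT; rewrite -memvE memv_ker lfunE => /eqP/ffunP/(_ n).
  by rewrite !ffunE => /eqP; rewrite subr_eq0 => /eqP.
rewrite -memvE memv_ker lfunE; apply/eqP/ffunP => n.
by rewrite !ffunE FE subrr.
Qed.

Definition descent_alg : Type := subvs_of equivariants.
Local Notation A := descent_alg.
HB.instance Definition _ := Vector.copy A (subvs_of equivariants).

Definition galg_val (x : A) : group_algebra L N := vsval x.
Definition dcf (x : A) (n : N) : L := galg_val x n.

Lemma dcf_inj x y : (forall n, dcf x n = dcf y n) -> x = y.
Proof. by move=> xy; apply: subvs_inj; apply/ffunP. Qed.

Lemma dcf_linear n : linear (dcf^~ n).
Proof. by move=> a x y; rewrite /dcf /galg_val linearP !ffunE. Qed.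

Lemma dcf_equiv x m n : dcf x (B m n) = th m (dcf x n).
Proof. by apply/equivariantsP; apply: subvsP. Qed.

(* Junk unless F is equivariant: vsproj is then an arbitrary projection. *)
Definition mk_eq (F : N -> L) : A := vsproj equivariants (finfun F).

Lemma mk_eqE F n : (forall m n, F (B m n) = th m (F n)) -> dcf (mk_eq F) n = F n.
Proof.
move=> FE; rewrite /dcf /galg_val vsprojK ?ffunE //.
by apply/equivariantsP => k l; rewrite !ffunE.
Qed.

Definition dmul (x y : A) : A := mk_eq (galg_val x * galg_val y).
Definition dunit : A := mk_eq (1 : group_algebra L N).

Lemma dmul_val x y : galg_val (dmul x y) = galg_val x * galg_val y.
Proof.
apply/ffunP => n; apply: mk_eqE => g k; rewrite !galg_mulE_coord.
rewrite (reindex_inj (@lam_inj _ B g)) rmorph_sum; apply: eq_bigr => m _.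
rewrite rmorphM; congr (_ * _); first exact: dcf_equiv.
have -> : ((B g m)^-1 * B g k)%g = B g (m^-1 * k)%g.
  by apply: (mulgI (B g m)); rewrite -lamM !mulKVg.
exact: dcf_equiv.
Qed.

Lemma dunit_val : galg_val dunit = 1.
Proof.
apply/ffunP => n; apply: mk_eqE => g k; rewrite !ffunE rmorph_nat.
by rewrite -{1}(lamg1 B g) (inj_eq (@lam_inj _ B g)).
Qed.

Lemma galg_val_inj : injective galg_val.
Proof. exact: subvs_inj. Qed.

Lemma galg_valD x y : galg_val (x + y) = galg_val x + galg_val y.
Proof. by []. Qed.

Lemma galg_valZ (k : K) x : galg_val (k *: x) = k%:A *: galg_val x.
Proof. by apply/ffunP => n; rewrite !ffunE -[RHS]/(_ * _) mulr_algl. Qed.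

Fact dmulA : associative dmul.
Proof. by move=> x y z; apply: galg_val_inj; rewrite !dmul_val mulrA. Qed.
Fact dmul1l : left_id dunit dmul.
Proof. by move=> x; apply: galg_val_inj; rewrite dmul_val dunit_val mul1r. Qed.
Fact dmul1r : right_id dunit dmul.
Proof. by move=> x; apply: galg_val_inj; rewrite dmul_val dunit_val mulr1. Qed.
Fact dmulDl : left_distributive dmul +%R.
Proof. by move=> x y z; apply: galg_val_inj; rewrite !(galg_valD, dmul_val) mulrDl. Qed.
Fact dmulDr : right_distributive dmul +%R.
Proof. by move=> x y z; apply: galg_val_inj; rewrite !(galg_valD, dmul_val) mulrDr. Qed.
Fact dunit_neq0 : dunit != 0.
Proof.
apply/eqP => /(congr1 galg_val); rewrite dunit_val => /ffunP/(_ 1%g)/eqP.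
by rewrite !ffunE eqxx oner_eq0.
Qed.
HB.instance Definition _ := GRing.Zmodule_isNzRing.Build A
  dmulA dmul1l dmul1r dmulDl dmulDr dunit_neq0.

Fact dscaleAl (k : K) (x y : A) : k *: (x * y) = (k *: x) * y.
Proof.
by apply: galg_val_inj; rewrite galg_valZ !dmul_val galg_valZ scalerAl.
Qed.
Fact dscaleAr (k : K) (x y : A) : k *: (x * y) = x * (k *: y).
Proof.
by apply: galg_val_inj; rewrite galg_valZ !dmul_val galg_valZ scalerAr.
Qed.
HB.instance Definition _ := GRing.Lmodule_isLalgebra.Build K A dscaleAl.
HB.instance Definition _ := GRing.Lalgebra_isAlgebra.Build K A dscaleAr.
HB.instance Definition _ := Algebra_isFalgebra.Build K A.

Lemma dcf_mul x y n : dcf (x * y) n = \sum_m dcf x m * dcf y (m^-1 * n)%g.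
Proof. by rewrite /dcf dmul_val galg_mulE_coord. Qed.

Lemma dcf_one n : dcf 1 n = (n == 1%g)%:R.
Proof. by rewrite /dcf dunit_val ffunE. Qed.

(** The trace of the element [l * k] of L[N]: the sum of its transforms under the circle group,
    which acts both on coefficients and on [N]. *)
Definition avg (k : N) (l : L) : A :=
  mk_eq (fun n => \sum_m th m l * (B m k == n)%:R).

Lemma avgE k l n : dcf (avg k l) n = \sum_m th m l * (B m k == n)%:R.
Proof.
apply: mk_eqE => g n'; rewrite (reindex_inj (@circI _ B g)) rmorph_sum.
apply: eq_bigr => m _; rewrite rmorphM rmorph_nat /= r_circ /circ -lam_comp.
by rewrite (inj_eq (@lam_inj _ B g)).
Qed.

Lemma avg_linear k : linear (avg k).
Proof.
move=> a x y; apply: dcf_inj => n; rewrite dcf_linear !avgE scaler_sumr -big_split.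
by apply: eq_bigr => m _; rewrite linearP mulrDl scalerAl.
Qed.

Lemma sum_indicator (m k : N) (F : N -> L) :
  \sum_n F n * (B m k == n)%:R = F (B m k).
Proof.
rewrite (bigD1 (B m k)) //= eqxx mulr1 big1 ?addr0 // => n.
by rewrite eq_sym => /negPf->; rewrite mulr0.
Qed.

Lemma sum_indicatorV (m n : N) (F : N -> L) :
  \sum_k F (B m k) * (B m k == n)%:R = F n.
Proof.
transitivity (\sum_k F k * (k == n)%:R).
  by rewrite [RHS](reindex_inj (@lam_inj _ B m)).
rewrite (bigD1 n) //= eqxx mulr1 big1 ?addr0 // => k /negPf->.
by rewrite mulr0.
Qed.

(** An invariant [x] factors out of the average of [r_e R * x], leaving the trace of [r_e R], which
    is 1. *)
Lemma avg_expand x n : dcf x n = \sum_k dcf (avg k (r_e R * dcf x k)) n.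
Proof.
under eq_bigr => k _ do rewrite avgE.
transitivity ((\sum_m th m (r_e R)) * dcf x n); first by rewrite r_trace_th mul1r.
rewrite exchange_big /= mulr_suml; apply: eq_bigr => m _.
rewrite -(sum_indicatorV m n (fun n => th m (r_e R) * dcf x n)).
by apply: eq_bigr => k _; rewrite rmorphM; congr (_ * _ * _); apply: dcf_equiv.
Qed.

(** On [avg k l] the relation reads: the sum of [b (B m k) * th m l] is 0 for all [l]. Independence
    of automorphisms then kills every [b (B m k)]. *)
Lemma dcf_free b : (forall x : A, \sum_n b n * dcf x n = 0) -> forall n, b n = 0.
Proof.
move=> b0 k; rewrite -(lam1g B k); apply: (r_free (d := fun m => b (B m k))) => l.
rewrite -[RHS](b0 (avg k l)).
under [RHS]eq_bigr => n _ do rewrite avgE mulr_sumr.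
rewrite exchange_big; apply: eq_bigr => m _ /=.
rewrite -(sum_indicator m k (fun n => b n * th m l)).
by apply: eq_bigr => n _; rewrite mulrA.
Qed.

(** By [avg_expand] a form is a sum of endomorphisms of [L] applied to the [dcf x k]. Each is a
    combination of the [th m], and [th m (dcf x k)] is again a coordinate, at [B m k]. *)
Lemma dcf_span : spanning dcf.
Proof.
move=> phi /linear_bundle[p pE].
have pl k : linear (fun l => p (avg k (r_e R * l))).
  by move=> a x y; rewrite mulrDr -scalerAr avg_linear linearP.
have /fin_all_exists[d dE] (k : N) : exists d : {ffun N -> L},
    forall l, p (avg k (r_e R * l)) = \sum_m d m * th m l.
  have [d dE] := r_end_span (pl k); exists (finfun d) => l.
  by rewrite dE; apply: eq_bigr => m _; rewrite ffunE.
exists (fun n => \sum_k \sum_m d k m * (B m k == n)%:R) => x.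
have xE : x = \sum_k avg k (r_e R * dcf x k).
  apply: dcf_inj => n; rewrite avg_expand /dcf /galg_val linear_sum /=.
  by rewrite sum_ffunE.
rewrite pE {1}xE linear_sum.
under [RHS]eq_bigr => n _ do rewrite mulr_suml.
rewrite [RHS]exchange_big; apply: eq_bigr => k _ /=; rewrite dE.
under [RHS]eq_bigr => n _ do rewrite mulr_suml.
rewrite [RHS]exchange_big; apply: eq_bigr => m _ /=.
rewrite -dcf_equiv -(sum_indicator m k (fun n => d k m * dcf x n)).
by apply: eq_bigr => n _; rewrite mulrAC.
Qed.

Local Notation cc := (tens_coord dcf dcf).

Lemma ccE x y m n : cc (tens x y) (m, n) = dcf x m * dcf y n.
Proof. exact: tens_coordE dcf_linear dcf_linear _ _ _ _. Qed.

Lemma cc_inj t t' : (forall m n, cc t (m, n) = cc t' (m, n)) -> t = t'.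
Proof. exact: tens_coord_inj dcf_linear dcf_linear _ _ dcf_span dcf_span. Qed.

(* By duality of r_a and r_b, this is n |-> n (x) n on the group-like basis of
   L[N]; see dcomulE. *)
Definition dcomul (x : A) : tensor A A :=
  \sum_k \sum_i tens (avg k (ra i)) (avg k (rb i * (r_e R * dcf x k))).

Lemma dcomulE x m n : cc (dcomul x) (m, n) = (m == n)%:R * dcf x n.
Proof.
have swap (p q r s t : L) : p * q * (r * t * s) = p * r * (q * (s * t)).
  by rewrite -[r * t * s]mulrA mulrACA [t * s]mulrC.
transitivity (\sum_k \sum_i dcf (avg k (ra i)) m *
    dcf (avg k (rb i * (r_e R * dcf x k))) n).
  rewrite /dcomul /tens_coord linear_sum; apply: eq_bigr => k _.
  by rewrite linear_sum; apply: eq_bigr => i _; rewrite -[LHS]/(cc _ (m, n)) ccE.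
transitivity (\sum_k \sum_g (B g k == m)%:R * (B g k == n)%:R
    * (th g (r_e R) * dcf x (B g k))).
  apply: eq_bigr => k _.
  transitivity (\sum_g \sum_g' (\sum_i th g (ra i) * th g' (rb i)) *
      ((B g k == m)%:R * ((B g' k == n)%:R * th g' (r_e R * dcf x k)))).
    under eq_bigr => i _ do rewrite !avgE mulr_suml.
    rewrite exchange_big; apply: eq_bigr => g _ /=.
    under eq_bigr => i _ do rewrite mulr_sumr.
    rewrite exchange_big; apply: eq_bigr => g' _ /=.
    rewrite mulr_suml; apply: eq_bigr => i _; rewrite rmorphM /=.
    exact: swap.
  apply: eq_bigr => g _.
  rewrite (bigD1 g) //= [X in _ + X]big1 ?addr0 => [|g' /negPf g'g].
    rewrite r_dual_th eqxx mul1r rmorphM mulrA; congr (_ * (_ * _)).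
    exact/esym/dcf_equiv.
  by rewrite r_dual_th eq_sym g'g mul0r.
rewrite exchange_big /=.
have [<- | nmn] := eqVneq m n.
  transitivity ((\sum_m th m (r_e R)) * dcf x m); last by rewrite r_trace_th.
  rewrite mulr_suml; apply: eq_bigr => g _.
  rewrite -(sum_indicatorV g m (fun n => th g (r_e R) * dcf x n)).
  apply: eq_bigr => k _; rewrite [RHS]mulrC; congr (_ * _).
  by case: (_ == _); rewrite ?mulr1 ?mulr0.
rewrite mul0r big1 // => g _; rewrite big1 // => k _.
by case: eqP => [->|]; rewrite ?(negPf nmn) ?mulr0 ?mul0r.
Qed.

Lemma dcomul_linear : linear dcomul.
Proof.
move=> a x y; apply: cc_inj => m n.
have /= -> := tens_coord_linear dcf dcf (m, n) a (dcomul x) (dcomul y).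
by rewrite !dcomulE dcf_linear mulrDr scalerAr.
Qed.
HB.instance Definition _ := GRing.isLinear.Build K A (tensor A A) _
  dcomul dcomul_linear.

Lemma ccM s t m n : cc (s * t) (m, n) =
  \sum_p \sum_q cc s (p, q) * cc t ((p^-1 * m)%g, (q^-1 * n)%g).
Proof.
move: s; apply: tensP1 => [u v|u v|x y].
- by rewrite mulrDl /tens_coord linearD.
- rewrite -big_split; apply: eq_bigr => p _; rewrite -big_split.
  by apply: eq_bigr => q _; rewrite /tens_coord linearD mulrDl.
move: t; apply: tensP1 => [u v|u v|x' y'].
- by rewrite mulrDr /tens_coord linearD.
- rewrite -big_split; apply: eq_bigr => p _; rewrite -big_split.
  by apply: eq_bigr => q _; rewrite /tens_coord linearD mulrDr.
rewrite tensM ccE !dcf_mul mulr_suml; apply: eq_bigr => p _.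
by rewrite mulr_sumr; apply: eq_bigr => q _; rewrite !ccE mulrACA.
Qed.

Lemma dcomul_monoid : monoid_morphism dcomul.
Proof.
split=> [|x y]; apply: cc_inj => m n.
  rewrite -[1 in RHS]/(tens 1 1) dcomulE ccE !dcf_one.
  by have [-> // | _] := eqVneq n 1%g; rewrite !mulr0.
rewrite ccM dcomulE dcf_mul mulr_sumr; apply: eq_bigr => p _.
rewrite (bigD1 p) //= big1 ?addr0 => [|q /negPf qp]; last first.
  by rewrite dcomulE eq_sym qp !mul0r.
by rewrite !dcomulE eqxx mul1r (inj_eq (mulgI _)) mulrCA.
Qed.
HB.instance Definition _ := GRing.isMonoidMorphism.Build A (tensor A A)
  dcomul dcomul_monoid.

Lemma sum_dcf_in1 (x : A) : \sum_n dcf x n \in 1%VS.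
Proof.
apply: (gal_fixed (r_galois R)) => s; have [f fK Kf] := r_bij R.
rewrite rmorph_sum -(Kf s) [RHS](reindex_inj (@lam_inj _ B (f s))).
by apply: eq_bigr => n _; rewrite dcf_equiv.
Qed.

Definition dcounit (x : A) : K^o := scalar_part (\sum_n dcf x n).

Lemma dcounitE x : (dcounit x : K)%:A = \sum_n dcf x n.
Proof. exact/scalar_partE/sum_dcf_in1. Qed.

Lemma alg_inj : injective (fun k : K => k%:A : L).
Proof. exact: (fmorph_inj (in_alg L)). Qed.

Lemma dcounit_linear : linear dcounit.
Proof.
move=> a x y; apply: alg_inj; rewrite scalerDl -scalerA !dcounitE.
rewrite scaler_sumr -big_split; apply: eq_bigr => n _.
exact: dcf_linear.
Qed.
HB.instance Definition _ := GRing.isLinear.Build K A K^o _ dcounit dcounit_linear.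

Lemma dcounit_monoid : monoid_morphism dcounit.
Proof.
split=> [|x y]; apply: alg_inj.
  rewrite scale1r dcounitE (bigD1 1%g) //= dcf_one eqxx big1 ?addr0 // => n /negPf n1.
  by rewrite dcf_one n1.
transitivity ((dcounit x : K)%:A * (dcounit y : K)%:A : L); last first.
  exact/esym/(rmorphM (in_alg L)).
rewrite !dcounitE.
under eq_bigr => n _ do rewrite dcf_mul.
rewrite exchange_big mulr_suml; apply: eq_bigr => m _ /=.
by rewrite -mulr_sumr [in RHS](reindex_inj (mulgI m^-1%g)).
Qed.
HB.instance Definition _ := GRing.isMonoidMorphism.Build A K^o
  dcounit dcounit_monoid.

Definition dantipode (x : A) : A := mk_eq (fun n => dcf x n^-1%g).

Lemma dantipodeE x n : dcf (dantipode x) n = dcf x n^-1%g.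
Proof.
apply: mk_eqE => g k; rewrite -dcf_equiv; congr (dcf x _).
by apply: (mulgI (B g k)); rewrite mulgV -lamM mulgV lamg1.
Qed.

Lemma dantipode_linear : linear dantipode.
Proof.
by move=> a x y; apply: dcf_inj => n; rewrite dcf_linear !dantipodeE dcf_linear.
Qed.
HB.instance Definition _ := GRing.isLinear.Build K A A _
  dantipode dantipode_linear.

Lemma dcomulA x : tens_assoc (tens_map dcomul idfun (dcomul x))
  = tens_map idfun dcomul (dcomul x).
Proof.
have ccl (mn : N * N) : linear ((tens_coord dcf dcf)^~ mn) by apply: tens_coord_linear.
apply: (tens_coord_inj dcf_linear ccl dcf_span).
  exact: spanning_tens dcf_linear dcf_linear dcf_span dcf_span.
move=> k [m n].
have assocE s y : tens_coord dcf cc (tens_assoc (tens s y)) (k, (m, n)) =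
    cc s (k, m) * dcf y n.
  move: s; apply: tensP1 => [u v|u v|a b].
  - by rewrite tensDl linearD /tens_coord linearD.
  - by rewrite /tens_coord linearD mulrDl.
  by rewrite tens_assocE (tens_coordE dcf_linear ccl) !ccE mulrA.
transitivity ((k == m)%:R * cc (dcomul x) (m, n)).
  move: (dcomul x); apply: tensP1 => [u v|u v|a b].
  - by rewrite linearD /= linearD /tens_coord linearD.
  - by rewrite /tens_coord linearD mulrDr.
  by rewrite tens_mapE assocE dcomulE ccE mulrA.
transitivity ((m == n)%:R * cc (dcomul x) (k, n)).
  by rewrite !dcomulE; have [<- | _] := eqVneq m n; rewrite ?mul1r // !mul0r mulr0.
move: (dcomul x); apply: tensP1 => [u v|u v|a b].
- by rewrite /tens_coord linearD mulrDr.
- by rewrite linearD /tens_coord linearD.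
by rewrite tens_mapE (tens_coordE dcf_linear ccl) ccE dcomulE mulrCA.
Qed.

(** A common tool for the counit and antipode axioms: [P] lists the pairs of coordinates that
    contribute at [n], and [dcomulE] keeps only the diagonal ones. *)
Lemma dcf_tens_lift (g : A -> A -> A) (P : N -> N * N) n t :
    (forall v, linear (g^~ v)) -> (forall u, linear (g u)) ->
    (forall a b, dcf (g a b) n = \sum_m dcf a (P m).1 * dcf b (P m).2) ->
  dcf (tens_lift g t) n = \sum_m cc t (P m).
Proof.
move=> gl gr gE; move: t; apply: tensP1 => [u v|u v|a b].
- by rewrite linearD /dcf galg_valD ffunE.
- by rewrite -big_split; apply: eq_bigr => m _; rewrite /tens_coord linearD.
rewrite tens_liftE // gE; apply: eq_bigr => m _.
by case: (P m) => p q; rewrite ccE.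
Qed.

Lemma dcfZ (k : K) x n : dcf (k *: x) n = k%:A * dcf x n.
Proof. by rewrite /dcf galg_valZ ffunE. Qed.

Lemma dcounitl x : tens_lift (fun a b => (dcounit a : K) *: b) (dcomul x) = x.
Proof.
apply: dcf_inj => n; rewrite (dcf_tens_lift (P := fun m => (m, n))).
- rewrite (bigD1 n) //= dcomulE eqxx mul1r big1 ?addr0 // => m /negPf mn.
  by rewrite dcomulE mn mul0r.
- by move=> v k a b; rewrite linearP scalerDl scalerA.
- by move=> u k a b; rewrite scalerDr !scalerA mulrC.
by move=> a b; rewrite dcfZ dcounitE mulr_suml.
Qed.

Lemma dcounitr x : tens_lift (fun a b => (dcounit b : K) *: a) (dcomul x) = x.
Proof.
apply: dcf_inj => n; rewrite (dcf_tens_lift (P := fun m => (n, m))).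
- rewrite (bigD1 n) //= dcomulE eqxx mul1r big1 ?addr0 // => m /negPf mn.
  by rewrite dcomulE eq_sym mn mul0r.
- by move=> v k a b; rewrite scalerDr !scalerA mulrC.
- by move=> u k a b; rewrite linearP scalerDl scalerA.
by move=> a b; rewrite dcfZ dcounitE mulrC mulr_sumr.
Qed.

Lemma dantipodel x :
  tens_lift (fun a b => dantipode a * b) (dcomul x) = (dcounit x : K)%:A.
Proof.
apply: dcf_inj => n; rewrite (dcf_tens_lift (P := fun m => (m^-1, m^-1 * n)%g)).
- rewrite dcfZ dcf_one dcounitE (reindex_inj invg_inj) /= mulr_suml.
  apply: eq_bigr => m _; rewrite invgK dcomulE mulrC.
  by rewrite -[X in X == _]mulg1 (inj_eq (mulgI m)) eq_sym; case: eqP => [->|];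
     rewrite ?mulg1 ?mulr0.
- by move=> v k a b; rewrite linearP mulrDl scalerAl.
- by move=> u k a b; rewrite mulrDr scalerAr.
by move=> a b; rewrite dcf_mul; apply: eq_bigr => m _; rewrite dantipodeE.
Qed.

Lemma dantipoder x :
  tens_lift (fun a b => a * dantipode b) (dcomul x) = (dcounit x : K)%:A.
Proof.
apply: dcf_inj => n; rewrite (dcf_tens_lift (P := fun m => (m, n^-1 * m)%g)).
- rewrite dcfZ dcf_one dcounitE mulr_suml.
  apply: eq_bigr => m _; rewrite dcomulE mulrC.
  rewrite -[X in X == _]mul1g (inj_eq (mulIg m)) eq_sym -eq_invg1 invgK.
  by case: eqP => [->|]; rewrite ?invg1 ?mul1g ?mulr0.
- by move=> v k a b; rewrite mulrDl scalerAl.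
- by move=> u k a b; rewrite linearP mulrDr scalerAr.
move=> a b; rewrite dcf_mul; apply: eq_bigr => m _.
by rewrite dantipodeE invMg invgK.
Qed.

HB.instance Definition _ := Falgebra_isHopf.Build K A
  dcomulA dcounitl dcounitr dantipodel dantipoder.

Definition dact_fun (x : A) (y : L) : L := \sum_n dcf x n * th n y.
Lemma dact_fun_linear x : linear (dact_fun x).
Proof.
move=> a y z; rewrite /dact_fun scaler_sumr -big_split; apply: eq_bigr => n _ /=.
by rewrite linearP mulrDr scalerAr.
Qed.
HB.instance Definition _ x := GRing.isLinear.Build K L L _
  (dact_fun x) (dact_fun_linear x).

Definition dact (x : A) : 'End(L) := linfun (dact_fun x).

Lemma dactE x y : dact x y = \sum_n dcf x n * th n y.
Proof. by rewrite lfunE. Qed.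

Lemma dact_linear : linear dact.
Proof.
move=> a x y; apply/lfunP => z; rewrite add_lfunE scale_lfunE !dactE.
rewrite scaler_sumr -big_split; apply: eq_bigr => n _ /=.
by rewrite dcf_linear mulrDl scalerAl.
Qed.
HB.instance Definition _ := GRing.isLinear.Build K A 'End(L) _ dact dact_linear.

Lemma dact1 : dact 1 = \1%VF.
Proof.
apply/lfunP => y; rewrite dactE id_lfunE (bigD1 1%g) //= dcf_one eqxx mul1r r_th1.
by rewrite big1 ?addr0 // => n /negPf n1; rewrite dcf_one n1 mul0r.
Qed.

Lemma dactM x y : dact (x * y) = (dact x \o dact y)%VF.
Proof.
apply/lfunP => z; rewrite comp_lfunE !dactE.
under eq_bigr => n _ do rewrite dcf_mul mulr_suml.
rewrite exchange_big; apply: eq_bigr => m _ /=.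
rewrite rmorph_sum mulr_sumr (reindex_inj (mulgI m)).
rewrite (reindex_inj (@lam_inj _ B m)); apply: eq_bigr => n _ /=.
rewrite mulKg dcf_equiv -[(m * B m n)%g]/(circ B m n) r_circ rmorphM.
by rewrite mulrA.
Qed.

Lemma dact_unit x : dact x 1 = (counit x : K)%:A.
Proof.
by rewrite dactE dcounitE; apply: eq_bigr => n _; rewrite rmorph1 mulr1.
Qed.

Lemma dact_mul x y z : dact x (y * z) =
  tens_lift (fun x1 x2 => dact x1 y * dact x2 z) (comul x).
Proof.
have -> : comul x = dcomul x by [].
transitivity (\sum_m \sum_n cc (dcomul x) (m, n) * (th m y * th n z)).
  rewrite dactE; apply: eq_bigr => m _; rewrite (bigD1 m) //= dcomulE eqxx mul1r.
  rewrite big1 ?addr0 => [|n /negPf nm]; first by rewrite rmorphM.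
  by rewrite dcomulE eq_sym nm !mul0r.
move: (dcomul x); apply: tensP1 => [u v|u v|a b].
- rewrite -big_split; apply: eq_bigr => m _; rewrite -big_split.
  by apply: eq_bigr => n _; rewrite /tens_coord linearD mulrDl.
- by rewrite linearD.
rewrite tens_liftE => [|v k u u'|u k v v'].
- rewrite !dactE mulr_suml; apply: eq_bigr => m _; rewrite mulr_sumr.
  by apply: eq_bigr => n _; rewrite ccE mulrACA.
- by rewrite linearP add_lfunE scale_lfunE mulrDl scalerAl.
by rewrite linearP add_lfunE scale_lfunE mulrDr scalerAr.
Qed.

Let lc (t : tensor L A) (n : N) : L := tens_lift (fun (l : L) x => l * dcf x n) t.

Let lcE l x n : lc (tens l x) n = l * dcf x n.
Proof.
rewrite /lc tens_liftE // => [v|u] k a b; first by rewrite mulrDl scalerAl.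
by rewrite dcf_linear mulrDr scalerAr.
Qed.

Let lcD n : {morph lc^~ n : s t / s + t}.
Proof. by move=> s t; rewrite /lc linearD. Qed.

(** The forms [r] of [L] and [dcf] on the second factor determine a tensor; by equivariance [r] can
    be pulled out, which leaves a value of [lc] at a moved point. *)
Let lc_inj s t : (forall n, lc s n = lc t n) -> s = t.
Proof.
have spL : spanning (fun (l : L) (r : gal_of {:L}) => r l).
  by move=> phi /(end_gal_span (r_galois R)).
have ll (r : gal_of {:L}) : linear (fun l => r l) by move=> a u v; rewrite linearP.
move=> st; apply: (tens_coord_inj ll dcf_linear spL dcf_span) => r n.
have [f fK Kf] := r_bij R.
have key u : tens_coord (fun l (s : gal_of {:L}) => s l) dcf u (r, n) =
    r (lc u (B (circ_inv B (f r)) n)).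
  move: u; apply: tensP1 => [u v|u v|l x].
  - by rewrite /tens_coord linearD.
  - by rewrite lcD rmorphD.
  rewrite (tens_coordE ll dcf_linear) lcE rmorphM; congr (_ * _).
  transitivity (th (f r) (dcf x (B (circ_inv B (f r)) n))); last by rewrite Kf.
  by rewrite -dcf_equiv lam_comp -/(circ B _ _) circVg lam1g.
by rewrite !key st.
Qed.

(** In the average over the circle group, duality of [ra] and [rb] leaves only the term of the
    identity, so the summand of [m] is sent to [d m] times the indicator of [m]. *)
Let lc_inv (d : N -> L) : tensor L A :=
  \sum_m \sum_i tens (ra i) (avg m (rb i * d m)).

Let lc_invE d n : lc (lc_inv d) n = d n.
Proof.
transitivity (\sum_m \sum_i ra i * dcf (avg m (rb i * d m)) n).
  rewrite /lc_inv /lc linear_sum; apply: eq_bigr => m _.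
  rewrite linear_sum; apply: eq_bigr => i _; exact: lcE.
transitivity (\sum_m (B 1%g m == n)%:R * d m); last first.
  under eq_bigr => m _ do rewrite lam1g.
  rewrite (bigD1 n) //= eqxx mul1r big1 ?addr0 // => m /negPf->.
  by rewrite mul0r.
apply: eq_bigr => m _.
transitivity (\sum_g (\sum_i th 1%g (ra i) * th g (rb i)) *
    (th g (d m) * (B g m == n)%:R)).
  under eq_bigr => i _ do rewrite avgE mulr_sumr.
  rewrite exchange_big; apply: eq_bigr => g _ /=; rewrite mulr_suml.
  by apply: eq_bigr => i _; rewrite r_th1 rmorphM !mulrA.
rewrite (bigD1 1%g) //= [X in _ + X]big1 ?addr0 => [|g /negPf g1].
  by rewrite r_dual_th eqxx mul1r r_th1 mulrC.
by rewrite r_dual_th eq_sym g1 mul0r.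
Qed.

Lemma dact_bij : bijective
  (tens_lift (fun (l : L) x => (amull l \o dact x)%VF) : tensor L A -> 'End(L)).
Proof.
set Theta := (X in bijective X).
have ThetaE t y : Theta t y = \sum_n lc t n * th n y.
  rewrite /Theta; move: t; apply: tensP1 => [u v|u v|l x].
  - by rewrite linearD add_lfunE.
  - by rewrite -big_split; apply: eq_bigr => n _; rewrite lcD mulrDl.
  rewrite tens_liftE => [|v k u u'|u k v v'].
  - rewrite comp_lfunE lfunE /= dactE mulr_sumr; apply: eq_bigr => n _.
    by rewrite lcE mulrA.
  - apply/lfunP => z; rewrite add_lfunE scale_lfunE !comp_lfunE !lfunE /=.
    by rewrite mulrDl scalerAl.
  rewrite linearP; apply/lfunP => z.
  by rewrite !(add_lfunE, scale_lfunE, comp_lfunE, lfunE) /= mulrDr scalerAr.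
(* These are the coefficients of [f] on the automorphisms [th n] given by [dual_expand]. *)
pose d (f : 'End(L)) (n : N) : L := \sum_i f (ra i) * th n (rb i).
have Theta_inj : injective Theta.
  move=> s t st; apply: lc_inj => n; apply/eqP; rewrite -subr_eq0; apply/eqP.
  apply: (r_free (d := fun n => lc s n - lc t n)) => y.
  under eq_bigr => m _ do rewrite mulrBl.
  by rewrite sumrB -!ThetaE st subrr.
suff ThetaK : cancel (fun f => lc_inv (d f)) Theta.
  by exists (fun f => lc_inv (d f)) => //; apply: inj_can_sym ThetaK Theta_inj.
move=> f; apply/lfunP => y; rewrite ThetaE.
rewrite (dual_expand (r_galois R) f y (@r_dual _ _ _ _ R)).
rewrite [RHS](reindex _ (onW_bij _ (r_bij R))); apply: eq_bigr => n _.
by rewrite lc_invE.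
Qed.

Definition dhopf_galois : hopf_galois L A :=
  @HopfGalois K L A dact dact1 dactM dact_unit dact_mul dact_bij.

Fact galg_val_semilinear : linear_for (in_alg L \; *:%R) galg_val.
Proof. by move=> k x y; rewrite galg_valD galg_valZ. Qed.

Definition dlift (t : scalar_ext L A) : group_algebra L N :=
  sext_lift galg_val t.

HB.instance Definition _ := GRing.isLinear.Build L (scalar_ext L A)
  (group_algebra L N) _ dlift (sext_lift_linear galg_val_semilinear).

Lemma dlift_tens l x : dlift (tens l x) = l *: galg_val x.
Proof. exact: (sext_liftE0 galg_val_semilinear). Qed.

Lemma dlift_in x : dlift (sext_in L x) = galg_val x.
Proof. by rewrite dlift_tens scale1r. Qed.

Lemma dlift_monoid : monoid_morphism dlift.
Proof.
split=> [|x y]; first by rewrite -[1]/(sext_in L (1 : A)) dlift_in dunit_val.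
move: x; apply: tensP1 => [u v|u v|a h].
- by rewrite mulrDl linearD.
- by rewrite linearD mulrDl.
move: y; apply: tensP1 => [u v|u v|b k].
- by rewrite mulrDr linearD.
- by rewrite linearD mulrDr.
rewrite -[tens a h * tens b k]/((tens a h : tensor L A) * tens b k) tensM.
rewrite !dlift_tens -[galg_val (h * k)]/(galg_val (dmul h k)) dmul_val.
by rewrite -scalerAl -scalerAr scalerA.
Qed.
HB.instance Definition _ := GRing.isMonoidMorphism.Build (scalar_ext L A)
  (group_algebra L N) dlift dlift_monoid.

Lemma dlift_coord t n : dlift t n = lc t n.
Proof.
move: t; apply: tensP1 => [u v|u v|l x].
- by rewrite linearD ffunE.
- exact: lcD.
by rewrite dlift_tens lcE ffunE.
Qed.

Lemma dlift_bij : bijective dlift.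
Proof.
have dlift_inj : injective dlift.
  by move=> s t st; apply: lc_inj => n; rewrite -!dlift_coord st.
suff dK : cancel (fun F : group_algebra L N => lc_inv F) dlift.
  by exists (fun F : group_algebra L N => lc_inv F) => //; apply: inj_can_sym dK _.
by move=> F; apply/ffunP => n; rewrite dlift_coord lc_invE.
Qed.

Lemma tens_dlift t : tens_map dlift dlift (sext_in2 L t) =
  \sum_m \sum_n cc t (m, n) *: tens (gelt L m) (gelt L n).
Proof.
move: t; apply: tensP1 => [u v|u v|a b].
- by rewrite sext_in2D linearD.
- rewrite -big_split; apply: eq_bigr => m _; rewrite -big_split.
  by apply: eq_bigr => n _; rewrite /tens_coord linearD scalerDl.
rewrite sext_in2E tens_mapE /= !dlift_in.
have [f fE] := linear_bundle
  (@tens_linearl L (group_algebra L N) (group_algebra L N) (galg_val b)).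
rewrite fE [galg_val a]galg_sum linear_sum; apply: eq_bigr => m _.
rewrite linearZ /= -fE [galg_val b]galg_sum linear_sum scaler_sumr.
by apply: eq_bigr => n _; rewrite linearZ /= scalerA ccE.
Qed.

Lemma dlift_hopf : hopf_morphism dlift.
Proof.
split=> t.
- have [u uE] := linear_bundle (fun a x y => etrans (congr1 (tens_map dlift dlift)
    (linearP (@sext_comul K L A) a x y)) (linearP (tens_map dlift dlift) a _ _)).
  transitivity (u t); last by rewrite -uE.
  apply: (sextP (f := @galg_comul L N \o dlift)) => h /=.
  rewrite -uE dlift_in.
  transitivity (tens_map dlift dlift (sext_in2 L (dcomul h))); last first.
    by congr (tens_map _ _ _); apply/esym/sext_comulE.
  rewrite tens_dlift.
  rewrite /galg_comul /galg_lift; apply: eq_bigr => m _.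
  rewrite (bigD1 m) //= dcomulE eqxx mul1r big1 ?addr0 // => n /negPf nm.
  by rewrite dcomulE eq_sym nm mul0r scale0r.
- apply: (sextP (f := @galg_counit L N \o dlift) (g := @sext_counit K L A)) => h /=.
  rewrite sext_counitE dlift_in galg_counit_coord.
  exact/esym/dcounitE.
- apply: (sextP (f := @galg_antipode L N \o dlift)
    (g := dlift \o @sext_antipode K L A)) => h /=.
  rewrite sext_antipodeE !dlift_in; apply/ffunP => n.
  by rewrite galg_antipode_coord; exact/esym/dantipodeE.
Qed.

Lemma descent_of_type : of_type L A N.
Proof. by exists dlift; [apply: dlift_bij | apply: dlift_hopf]. Qed.

Definition descent_coordinates : coordinates dhopf_galois B :=
  @Coordinates K L A dhopf_galois N B dcf (rth R) dcf_linear dcf_mul dcf_one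
    dcomulE (fun x => esym (dcounitE x)) dantipodeE dcf_span dcf_free (r_bij R)
    (r_circ R) (fun m x n => esym (dcf_equiv x m n)) dactE.
End Construction.

Lemma realization_exists (N : finGroupType) (B : brace N) :
  exists (K : fieldType) (L : splittingFieldType K), inhabited (realization L B).
Proof.
have [K [L [theta [galL bij thetaM]]]] := galois_realization (circ_of B).
have [n [a [b ab]]] := dual_system L.
have [e te] := trace_surj galL.
exists K, L; split.
by exists (theta : N -> _) n a b e.
Qed.

Local Open Scope nat_scope.

Theorem theorem1p2 (N : finGroupType) :
  (forall (K : fieldType) (L : splittingFieldType K) (H : hopfType K)
          (S : hopf_galois L H),
      galois 1 {:L} -> of_type L H N -> bijective (hg_correspondence S))
  <->
  [\/ [set: N] \isog [set: 'Z_2],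
      [set: N] \isog [set: ('Z_2 * 'Z_2)%type]
    | [/\ cyclic [set: N], odd #|[set: N]|
       & forall p q : nat, prime p -> prime q ->
           p %| #|[set: N]| -> q %| #|[set: N]| -> ~~ (q %| p - 1)]].
Proof.
apply: iff_trans (all_idealsP N); split=> [bijS B | idealsN K L H S galL].
  have [K [L [R]]] := realization_exists B.
  have galL := r_galois R.
  apply/(coordinates_criterion (descent_coordinates R) galL)/bijS => //.
  exact: descent_of_type.
case=> f [g fK gK] fH.
have [B [C]] := coordinates_of_type S fK gK fH.
exact/(coordinates_criterion C galL).
Qed.
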